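(* Let $\mathcal{P}_0\subset\mathcal{P}$ and $\mathcal{H}_0=\mathcal{P}_0\cap\mathcal{H}$. Suppose that for each $P\in\mathcal{P}_0$ there exist deterministic rate functions $g_P,h_P$ tending to zero as $n\to\infty$ and functions $\xi,\xi':[0,1]\times[0,1]^d\to\mathbb{R}$ such that (i) $\|F_{X\mid Z}-\hat F^{(n)}_{X\mid Z}\|_{\mathcal{T},\infty}\in\mathcal{O}_P(g_P(n))$ and $\|F_{Y\mid Z}-\hat F^{(n)}_{Y\mid Z}\|'_{\mathcal{T},\infty}\in\mathcal{O}_P(h_P(n))$; (ii) $\|\xi-\hat F^{(n)}_{X\mid Z}\|_{\mathcal{T}^c,\infty}\in\mathcal{O}_P(g_P(n))$ and $\|\xi'-\hat F^{(n)}_{Y\mid Z}\|'_{\mathcal{T}^c,\infty}\in\mathcal{O}_P(h_P(n))$; and that $\sqrt n\,g_P(n)h_P(n)\to0$ as $n\to\infty$ for each $P\in\mathcal{P}_0$. Let $\alpha\in(0,1)$ and let $\hat\Psi_n=1(T_n>n^{-1}z_{1-\alpha})$, where $z_{1-\alpha}$ is the $(1-\alpha)$-quantile of the $\chi^2_{q^2}$-distribution. Then $\hat\Psi_n$ has asymptotic pointwise level over $\mathcal{H}_0$, i.e. $$\limsup_{n\to\infty}E_P(\hat\Psi_n)=\alpha$$ for each fixed $P\in\mathcal{H}_0$.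
   Context: $\mathcal{P}$ is the set of distributions of $(X,Y,Z)$ on $[0,1]^{2+d}$ ($X,Y\in[0,1]$, $Z\in[0,1]^d$) absolutely continuous with respect to Lebesgue measure; $\mathcal{H}\subset\mathcal{P}$ is the subset for which $X$ and $Y$ are conditionally independent given $Z$. Throughout, for every $z$ the conditional distributions of $X$ and of $Y$ given $Z=z$ are continuous. $F_{X\mid Z}(t\mid z)=P(X\le t\mid Z=z)$ and $Q_{X\mid Z}(\tau\mid z)=\inf\{t\in[0,1]:F_{X\mid Z}(t\mid z)\ge\tau\}$; similarly for $Y$. $(X_i,Y_i,Z_i)_{i=1}^n$ is an i.i.d. sample from $P$. An estimator $\hat F^{(n)}_{X\mid Z}$ is a mapping from the sample $(X_i,Z_i)_{i=1}^n$ to functions $\hat F^{(n)}_{X\mid Z}(\cdot\mid z):[0,1]\to[0,1]$ that for every $z\in[0,1]^d$ are continuous and increasing with value $0$ at $0$ and $1$ at $1$; similarly $\hat F^{(n)}_{Y\mid Z}$ is such a mapping from $(Y_i,Z_i)_{i=1}^n$. Put $\hat U_{1,i}=\hat F^{(n)}_{X\mid Z}(X_i\mid Z_i)$ and $\hat U_{2,i}=\hat F^{(n)}_{Y\mid Z}(Y_i\mid Z_i)$. The function $\phi=(\phi_1,\dots,\phi_q):[0,1]\to\mathbb{R}^q$ satisfies: each $\phi_k$ has support $\mathcal{T}_k$ that is a compact subset of $(0,1)$; each $\phi_k$ is Lipschitz continuous; $\int_0^1\phi_k(u)\,\mathrm{d}u=0$ and $\int_0^1\phi_k(u)^2\,\mathrm{d}u=1$;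 $\phi_1,\dots,\phi_q$ are linearly independent. $\hat\rho_n=\frac1n\sum_{i=1}^n\phi(\hat U_{1,i})\phi(\hat U_{2,i})^T$, $\Sigma_{k,s}=\int_0^1\phi_k(u)\phi_s(u)\,\mathrm{d}u$, and $T_n=\|\Sigma^{-1/2}\hat\rho_n\Sigma^{-1/2}\|_F^2$ with $\|\cdot\|_F$ the Frobenius norm. $\tau_{\min}=\inf(\mathcal{T}_1\cup\dots\cup\mathcal{T}_q)$, $\tau_{\max}=\sup(\mathcal{T}_1\cup\dots\cup\mathcal{T}_q)$, $\mathcal{T}=[\tau_{\min},\tau_{\max}]$. $\|f\|_{\mathcal{T},\infty}=\sup_{z\in[0,1]^d}\sup_{t\in Q_{X\mid Z}(\mathcal{T}\mid z)}|f(t,z)|$ with $Q_{X\mid Z}(\mathcal{T}\mid z)=[Q_{X\mid Z}(\tau_{\min}\mid z),Q_{X\mid Z}(\tau_{\max}\mid z)]$, and $\|f\|_{\mathcal{T}^c,\infty}$ is the same with the inner supremum over the complement $[0,1]\setminus Q_{X\mid Z}(\mathcal{T}\mid z)$. $\|\cdot\|'_{\mathcal{T},\infty}$ and $\|\cdot\|'_{\mathcal{T}^c,\infty}$ are defined in the same way with $Q_{Y\mid Z}$ in place of $Q_{X\mid Z}$. $X_n\in\mathcal{O}_P(a_n)$ (for a nonzero sequence $a_n$) means: for every $\epsilon>0$ there is $M>0$ with $\sup_nP(|X_n/a_n|>M)<\epsilon$. *)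

(* Defs.v *)
From HB Require Import structures.
From mathcomp Require Import all_boot all_order all_algebra finmap.
From mathcomp Require Import all_classical all_reals all_analysis.
Set Implicit Arguments.
Unset Strict Implicit.
Unset Printing Implicit Defensive.
Import Order.TTheory GRing.Theory Num.Theory.
Import numFieldNormedType.Exports.
Local Open Scope classical_set_scope.
Local Open Scope ring_scope.

(* An observation w = (x, y, z): x = w.1.1, y = w.1.2, z = w.2. *)
Notation covariate R d := (d.-tuple R)%type.
Notation obs R d := (R * R * covariate R d)%type.

Section lebesgue_product.
Context {R : realType}.
(* R with the sigma-algebra on which [lebesgue_measure] is declared: the Borel
   sets of R, up to conversion. *)
Local Notation RB := (measurableTypeR R).

Fixpoint lebesgue_tuple n : set (n.-tuple RB) -> \bar R :=
  if n is m.+1 then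
    pushforward (lebesgue_tuple (n := m) \x lebesgue_measure)%E
      (fun x : m.-tuple RB * RB => [tuple of x.2 :: x.1])
  else \d_([tuple] : 0.-tuple RB).

Definition lebesgue_obs d : set (obs R d) -> \bar R :=
  ((lebesgue_measure \x lebesgue_measure) \x^ lebesgue_tuple (n := d))%E.

End lebesgue_product.
Arguments lebesgue_tuple {R} n A.
Arguments lebesgue_obs {R} d A.

Section distributions.
Context {R : realType} {d : nat}.
Implicit Types (P : probability (obs R d) R) (z : covariate R d).

Definition cube : set (covariate R d) :=
  [set z | forall i, tnth z i \in `[0, 1]].

Definition obs_cube : set (obs R d) :=
  [set w | [/\ w.1.1 \in `[0, 1], w.1.2 \in `[0, 1] & cube w.2]].

Definition ac_distributions : set (probability (obs R d) R) :=
  [set P | P obs_cube = 1%E /\ P `<< lebesgue_obs d].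

(* [z |-> f z] is a version of z |-> P(E | Z = z). *)
Definition cond_prob_version P (E : set (obs R d)) (f : covariate R d -> R) :=
  [/\ measurable_fun [set: covariate R d] f,
      P.-integrable [set: obs R d] (fun w => (f w.2)%:E) &
      forall C, measurable C ->
        P (E `&` [set w | C w.2]) =
        (\int[P]_(w in [set w | C w.2]) (f w.2)%:E)%E].

(* P(X \in A, Y \in B | Z) = P(X \in A | Z) P(Y \in B | Z) almost surely, stated
   for arbitrary versions f, g of the two factors. *)
Definition cond_indep P := forall (A B : set R) (f g : covariate R d -> R),
  measurable A -> measurable B ->
  cond_prob_version P [set w | A w.1.1] f ->
  cond_prob_version P [set w | B w.1.2] g ->
  cond_prob_version P [set w | A w.1.1 /\ B w.1.2] (fun z => f z * g z).

Definition null_distributions : set (probability (obs R d) R) :=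
  [set P | ac_distributions P /\ cond_indep P].

Definition cond_cdf (K : R.-pker (covariate R d) ~> R) (t : R) z : R :=
  fine (K z `]-oo, t]%classic).

(* [K] is a regular conditional distribution of the [0, 1]-valued variable [V]
   given Z under P; K z is an atomless law on [0, 1] for every z in [0, 1]^d. *)
Definition continuous_cond_law P (V : obs R d -> R)
    (K : R.-pker (covariate R d) ~> R) :=
  (forall A, measurable A ->
     cond_prob_version P [set w | A (V w)] (fun z => fine (K z A))) /\
  (forall z, cube z ->
     K z `[0, 1]%classic = 1%E /\ continuous (fun t => cond_cdf K t z)).

Definition cond_quantile (K : R.-pker (covariate R d) ~> R) (tau : R) z : R :=
  inf [set t | t \in `[0, 1] /\ tau <= cond_cdf K t z].

Definition quantile_band K (tau0 tau1 : R) z : set R :=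
  `[cond_quantile K tau0 z, cond_quantile K tau1 z].

(* sup_{z in [0,1]^d} sup_{t in A z} |f(t, z)|, possibly +oo *)
Definition sup_norm_on (A : covariate R d -> set R)
    (f : R -> covariate R d -> R) : \bar R :=
  ereal_sup [set ereal_sup [set `|f t z|%:E | t in A z] | z in cube].

Definition norm_in K (tau0 tau1 : R) f :=
  sup_norm_on (quantile_band K tau0 tau1) f.

Definition norm_out K (tau0 tau1 : R) f :=
  sup_norm_on (fun z => `[0, 1] `\` quantile_band K tau0 tau1 z) f.

End distributions.

Section sampling.
Context {R : realType} {dO : measure_display} {Omega : measurableType dO}.

Definition iid_sample d (Pr : probability Omega R)
    (W : nat -> Omega -> obs R d) (P : probability (obs R d) R) :=
  [/\ forall i, measurable_fun [set: Omega] (W i),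
      forall i A, measurable A -> Pr (W i @^-1` A) = P A &
      forall (J : {fset nat}) (A : nat -> set (obs R d)),
        (forall i, measurable (A i)) ->
        Pr (\bigcap_(i in [set` J]) (W i @^-1` A i)) =
        (\prod_(i <- J) Pr (W i @^-1` A i))%E].

(* X_n \in O_P(a_n), for sample sizes n >= 1. The random quantities may be
   infinite, and suprema over uncountable families need not be measurable, so
   the probability is the outer one; it is [Pr] itself on measurable events. *)
Definition bigO_P (Pr : probability Omega R) (X : nat -> Omega -> \bar R)
    (a : nat -> R) :=
  (forall n, (0 < n)%N -> a n != 0) /\
  forall e : R, 0 < e -> exists2 M : R, 0 < M &
    (ereal_sup [set mu_ext Pr [set w | M%:E < `|X n w / (a n)%:E| ]
               | n in [set n | (0 < n)%N]] < e%:E)%E.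

End sampling.

Section estimators.
Context {R : realType} {d : nat}.

(* [F n s t z] is the estimate of F(t | z) from the sample s of size n. *)
Definition cdf_estimator :=
  forall n, n.-tuple (R * covariate R d) -> R -> covariate R d -> R.

Definition sample_cube n : set (n.-tuple (R * covariate R d)) :=
  [set s | forall i, (tnth s i).1 \in `[0, 1] /\ cube (tnth s i).2].

(* "Increasing" is non-strict. Measurability is only asked of the estimated
   residuals F(X_i | Z_i), as functions of the sample. *)
Definition is_cdf_estimator (F : cdf_estimator) := forall n, (0 < n)%N ->
  (forall s z, sample_cube s -> cube z ->
     [/\ {within `[0, 1], continuous (fun t => F n s t z)},
         {in `[0, 1] &, {homo (fun t => F n s t z) : t u / t <= u}},
         F n s 0 z = 0 &
         F n s 1 z = 1]) /\
  (forall i : 'I_n, measurable_fun (@sample_cube n)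
     (fun s => F n s (tnth s i).1 (tnth s i).2)).

Definition xz_sample Omega (W : nat -> Omega -> obs R d) n (w : Omega) :
    n.-tuple (R * covariate R d) :=
  [tuple ((W i w).1.1, (W i w).2) | i < n].

Definition yz_sample Omega (W : nat -> Omega -> obs R d) n (w : Omega) :
    n.-tuple (R * covariate R d) :=
  [tuple ((W i w).1.2, (W i w).2) | i < n].

End estimators.
Arguments cdf_estimator R d : clear implicits.

Section score_functions.
Context {R : realType} {q : nat}.
Implicit Type phi : 'I_q -> R -> R.

(* The functions are only used on [0, 1]. *)
Definition support01 (f : R -> R) : set R :=
  closure [set u | u \in `[0, 1] /\ f u != 0].

Definition score_functions phi :=
  [/\ forall k, compact (support01 (phi k)) /\ support01 (phi k) `<=` `]0, 1[,
      forall k, [lipschitz (phi k u : R^o) | u in (`[0, 1] : set R^o)],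
      forall k, \int[lebesgue_measure]_(u in `[0, 1]) phi k u = 0,
      forall k, \int[lebesgue_measure]_(u in `[0, 1]) (phi k u ^+ 2) = 1 &
      forall c : 'I_q -> R,
        (forall u, u \in `[0, 1] -> \sum_k c k * phi k u = 0) ->
        forall k, c k = 0].

Definition tau_min phi : R := inf (\bigcup_k support01 (phi k)).
Definition tau_max phi : R := sup (\bigcup_k support01 (phi k)).

Definition Sigma phi : 'M[R]_q :=
  \matrix_(k, s) \int[lebesgue_measure]_(u in `[0, 1]) (phi k u * phi s u).

Definition sym_posdef (S : 'M[R]_q) :=
  S^T = S /\ forall v : 'rV[R]_q, v != 0 -> 0 < (v *m S *m v^T) 0 0.

(* A^(-1/2): the symmetric positive definite square root of A^-1 (junk value 0
   if A is not symmetric positive definite). *)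
Definition inv_sqrtmx (A : 'M[R]_q) : 'M[R]_q :=
  xget 0 [set S | sym_posdef S /\ S *m S = invmx A].

Definition frobenius (A : 'M[R]_q) : R :=
  Num.sqrt (\sum_i \sum_j A i j ^+ 2).

Section statistic.
Context {d : nat} {Omega : Type}.
Variables (phi : 'I_q -> R -> R) (FX FY : cdf_estimator R d).
Variables (W : nat -> Omega -> obs R d) (n : nat) (w : Omega).

Definition U1 (i : 'I_n) : R := FX (xz_sample W n w) (W i w).1.1 (W i w).2.
Definition U2 (i : 'I_n) : R := FY (yz_sample W n w) (W i w).1.2 (W i w).2.

Definition rho_hat : 'M[R]_q :=
  n%:R^-1 *: \sum_(i < n)
    (\col_k phi k (U1 i)) *m (\col_k phi k (U2 i))^T.

Definition test_stat : R :=
  frobenius (inv_sqrtmx (Sigma phi) *m rho_hat *m inv_sqrtmx (Sigma phi)) ^+ 2.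

Definition test (c : R) : R := (test_stat > n%:R^-1 * c)%R%:R.

End statistic.
End score_functions.

Section chi_squared.
Context {R : realType}.
Local Notation RB := (measurableTypeR R).

Definition sqr_add (x : RB * RB) : RB := (x.1 : R) ^+ 2 + x.2.

Lemma measurable_sqr_add : measurable_fun [set: RB * RB] sqr_add.
Proof.
exact: (@measurable_realfun.measurable_funD _ (RB * RB)%type R _ _ _
  (measurable_realfun.measurable_funX 2 measurable_fst) measurable_snd).
Qed.

HB.instance Definition _ :=
  isMeasurableFun.Build _ _ _ _ sqr_add measurable_sqr_add.

(* The law of the sum of the squares of m independent standard normals. *)
Fixpoint chi_squared (m : nat) : probability RB R :=
  if m is k.+1 then
    distribution (normal_prob (0 : R) 1 \x chi_squared k)%E sqr_add
  else \d_(0 : RB).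

Definition quantile (mu : probability RB R) (p : R) : R :=
  inf [set x : R | (p%:E <= mu `]-oo, x]%classic)%E].

End chi_squared.

(* Main.v *)
Require Import Defs.
From HB Require Import structures.
From mathcomp Require Import all_boot all_order all_algebra finmap.
From mathcomp Require Import all_classical all_reals all_analysis measurable_realfun.
From mathcomp Require Import spectral complex.
From mathcomp Require Import ring lra.
Set Implicit Arguments.
Unset Strict Implicit.
Unset Printing Implicit Defensive.
Import Order.TTheory GRing.Theory Num.Theory.
Import numFieldNormedType.Exports.
Local Open Scope classical_set_scope.
Local Open Scope ring_scope.

(** Write U1 = F(X | Z) and U2 = F(Y | Z) for the true residuals. By the probability
    integral transform U2 is uniform on [0, 1] given Z, and under conditional
    independence even given (X, Z); so it is independent of every function of
    (X, Z), and symmetrically for U1 ([residual_indep]). Hence the entries of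
    S phi(U1) phi(U2)^T S, with S the inverse square root of Sigma, are centred with
    identity covariance ([oracle_mean], [oracle_cov]), and with the true residuals in
    place of the estimated ones n T_n would be the squared norm of a normalised sum of
    i.i.d. vectors of dimension q^2.

    Replacing the true residuals by the estimated ones costs three terms. On the
    support of phi the error of a score is at most a constant times the error of the
    estimated distribution function on the band, and this remains true off the band,
    because phi vanishes there and the estimate is monotone ([score_perturbation]). In the
    two terms with a single error, the error is a function of the (X, Z)-sample (or of
    the (Y, Z)-sample), given which the other factors are independent and centred;
    the second moment of the normalised sum is therefore the average of the second
    moments of the errors, and vanishes without any rate ([cross_term_small]). The term with
    two errors is bounded by sqrt n g(n) h(n) up to a constant
    ([product_error_negligible]).

    The limit law is found through Laplace transforms of the squared norm, which avoids
    weak convergence in several dimensions. The function exp (- s |x|^2 / 2) evolves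
    explicitly under the heat flow; adding one centred summand of covariance 1/n
    has the same effect as a time step 1/n, up to O(n^(-3/2)) uniformly
    ([heat_one_step]), and n steps give the limit (1 + s)^(- q^2 / 2) ([laplace_clt]),
    which is the transform of the chi-squared law with q^2 degrees of freedom
    ([chi_squared_laplace]). Since these Gaussian profiles are Lipschitz, negligible
    remainders do not change the limit ([laplace_negligible]). Convergence of Laplace
    transforms is turned into convergence of tail probabilities by squeezing the
    indicator of a half-line between polynomials in exp (- theta x) ([cvg_tail]); the
    chi-squared law has no atoms, so the tail beyond its (1 - alpha)-quantile is
    alpha. *)

(** * Bounded measurable functions and equality in law *)

Section bounded_measurable.
Context {d : measure_display} {T : measurableType d} {R : realType}.
Implicit Types (f g : T -> R) (P : probability T R).

(** Every integrand of the proof is bounded and measurable, which makes expectations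
    linear and monotone without integrability side conditions. *)
Definition bmfun f :=
  measurable_fun [set: T] f /\ exists M, forall x, `|f x| <= M.

Lemma bmfun_measurable f : bmfun f -> measurable_fun [set: T] f.
Proof. by case. Qed.

Lemma bmfun_bound f : bmfun f -> exists2 M, 0 < M & forall x, `|f x| <= M.
Proof.
move=> [_ [M fM]]; exists (`|M| + 1) => [|x]; first by rewrite ltr_wpDl.
by rewrite (le_trans (fM x))// (le_trans (ler_norm M))// lerDl.
Qed.

Lemma bmfun_cst (c : R) : bmfun (fun=> c).
Proof. by split; [exact: measurable_cst|exists `|c|]. Qed.

Lemma bmfunD f g : bmfun f -> bmfun g -> bmfun (fun x => f x + g x).
Proof.
move=> [mf [M fM]] [mg [N gN]]; split; first exact: measurable_funD.
by exists (M + N) => x; rewrite (le_trans (ler_normD _ _))// lerD.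
Qed.

Lemma bmfunM f g : bmfun f -> bmfun g -> bmfun (fun x => f x * g x).
Proof.
move=> [mf [M fM]] [mg [N gN]]; split; first exact: measurable_funM.
by exists (M * N) => x; rewrite normrM ler_pM.
Qed.

Lemma bmfunZ (c : R) f : bmfun f -> bmfun (fun x => c * f x).
Proof. by apply: bmfunM; exact: bmfun_cst. Qed.

Lemma bmfunB f g : bmfun f -> bmfun g -> bmfun (fun x => f x - g x).
Proof.
move=> mf mg; have := bmfunD mf (bmfunZ (-1) mg).
by under eq_fun do rewrite mulN1r.
Qed.

Lemma bmfunX f n : bmfun f -> bmfun (fun x => f x ^+ n).
Proof.
move=> mf; elim: n => [|n IH].
  by under eq_fun do rewrite expr0; exact: bmfun_cst.
by under eq_fun do rewrite exprS; exact: bmfunM.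
Qed.

Lemma bmfun_norm f : bmfun f -> bmfun (fun x => `|f x|).
Proof.
move=> [mf [M fM]]; split; first exact: measurableT_comp.
by exists M => x; rewrite normr_id.
Qed.

Lemma bmfun_sum (I : Type) (s : seq I) (h : I -> T -> R) :
  (forall i, bmfun (h i)) -> bmfun (fun x => \sum_(i <- s) h i x).
Proof.
move=> mh; elim: s => [|i s IH].
  by under eq_fun do rewrite big_nil; exact: bmfun_cst.
by under eq_fun do rewrite big_cons; exact: bmfunD.
Qed.

Lemma bmfun_indic (A : set T) : measurable A -> bmfun \1_A.
Proof.
move=> mA; split; first exact: measurable_indic.
by exists 1 => x; rewrite indicE; case: (_ \in _); rewrite ?normr1 ?normr0.
Qed.

Lemma bmfun_integrable P f : bmfun f -> P.-integrable [set: T] (EFin \o f).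
Proof.
move=> [mf [M fM]]; apply: measurable_bounded_integrable => //.
  by rewrite (le_lt_trans (probability_le1 P measurableT))// ltry.
exists M; split; first exact: num_real.
by move=> N MN x _; apply: le_trans (fM x) (ltW MN).
Qed.

Lemma EFin_Rintegral P f : bmfun f ->
  (\int[P]_x f x)%:E = (\int[P]_x (f x)%:E)%E.
Proof.
move=> mf; rewrite /Rintegral fineK//.
exact: integrable_fin_num (bmfun_integrable P mf).
Qed.

Lemma RintegralDb P f g : bmfun f -> bmfun g ->
  \int[P]_x (f x + g x) = \int[P]_x f x + \int[P]_x g x.
Proof. by move=> mf mg; rewrite RintegralD//; exact: bmfun_integrable. Qed.

Lemma RintegralBb P f g : bmfun f -> bmfun g ->
  \int[P]_x (f x - g x) = \int[P]_x f x - \int[P]_x g x.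
Proof. by move=> mf mg; rewrite RintegralB//; exact: bmfun_integrable. Qed.

Lemma RintegralZb P (c : R) f : bmfun f ->
  \int[P]_x (c * f x) = c * \int[P]_x f x.
Proof. by move=> mf; rewrite RintegralZl//; exact: bmfun_integrable. Qed.

Lemma Rintegral_cstb P (c : R) : \int[P]_(_ in [set: T]) c = c.
Proof. by rewrite Rintegral_cst//= probability_setT mulr1. Qed.

Lemma Rintegral_sumb P (I : Type) (s : seq I) (h : I -> T -> R) :
  (forall i, bmfun (h i)) ->
  \int[P]_x (\sum_(i <- s) h i x) = \sum_(i <- s) \int[P]_x h i x.
Proof.
move=> mh; elim: s => [|i s IH].
  rewrite big_nil (_ : (fun x => _) = fun=> 0) ?Rintegral_cstb//.
  by apply/funext => x; rewrite big_nil.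
rewrite big_cons -IH -RintegralDb//; last exact: bmfun_sum.
by congr Rintegral; apply/funext => x; rewrite big_cons.
Qed.

Lemma le_Rintegralb P f g : bmfun f -> bmfun g -> (forall x, f x <= g x) ->
  \int[P]_x f x <= \int[P]_x g x.
Proof. by move=> mf mg fg; apply: le_Rintegral => //; exact: bmfun_integrable. Qed.

Lemma Rintegral_norm_le P f g : bmfun f -> bmfun g ->
  (forall x, `|f x| <= g x) -> `|\int[P]_x f x| <= \int[P]_x g x.
Proof.
move=> mf mg fg; apply: le_trans (le_normr_Rintegral _ _) _ => //.
  exact: bmfun_integrable.
by apply: le_Rintegralb => //; exact: bmfun_norm.
Qed.

Lemma Rintegral_norm_le_cst P f (c : R) : bmfun f ->
  (forall x, `|f x| <= c) -> `|\int[P]_x f x| <= c.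
Proof.
move=> mf fc; rewrite -[leRHS](Rintegral_cstb P).
by apply: Rintegral_norm_le => //; exact: bmfun_cst.
Qed.

Lemma Rintegral_indicb P (A : set T) : measurable A ->
  \int[P]_x \1_A x = fine (P A).
Proof. by move=> mA; rewrite /Rintegral integral_indic// setIT. Qed.

End bounded_measurable.

Lemma bmfun_comp d d' (T : measurableType d) (T' : measurableType d')
    (R : realType) (X : T -> T') (f : T' -> R) :
  measurable_fun [set: T] X -> bmfun f -> bmfun (fun x => f (X x)).
Proof.
move=> mX [mf [M fM]]; split; first exact: measurableT_comp.
by exists M => x; exact: fM.
Qed.

(** A bounded continuous post-composition is only asked to be bounded on the
    range of the inner function, which is what exponentials of sums need. *)
Lemma bmfun_continuous_comp d (T : measurableType d) (R : realType)
    (g : R -> R) (f : T -> R) :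
  continuous g -> measurable_fun [set: T] f ->
  (exists M, forall x, `|g (f x)| <= M) -> bmfun (fun x => g (f x)).
Proof.
move=> cg mf gM; split => //.
by apply: measurableT_comp => //; exact: continuous_measurable_fun.
Qed.

Section fubini_bounded.
Context {d d' : measure_display} {T : measurableType d}
  {T' : measurableType d'} {R : realType}.
Variables (P : probability T R) (Q : probability T' R).

Lemma bmfun_section (f : T * T' -> R) x : bmfun f -> bmfun (fun y => f (x, y)).
Proof. by apply: bmfun_comp; exact: measurable_pair1. Qed.

Lemma bmfun_Rintegral (f : T * T' -> R) : bmfun f ->
  bmfun (fun x => \int[Q]_y f (x, y)).
Proof.
move=> mf; split; last first.
  have [M _ fM] := bmfun_bound mf; exists M => x.
  by apply: Rintegral_norm_le_cst => //; exact: bmfun_section.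
apply/measurable_EFinP.
have := measurable_fubini_F (bmfun_integrable (P \x Q)%E mf).
apply: eq_measurable_fun => x _.
by rewrite /fubini_F/= EFin_Rintegral//; exact: bmfun_section.
Qed.

Lemma Rintegral_fubini (f : T * T' -> R) : bmfun f ->
  \int[(P \x Q)%E]_z f z = \int[P]_x \int[Q]_y f (x, y).
Proof.
move=> mf; rewrite {1}/Rintegral.
rewrite -(integral12_prod_meas1 (bmfun_integrable (P \x Q)%E mf)).
congr fine; apply: eq_integral => x _.
by rewrite /fubini_F/= EFin_Rintegral//; exact: bmfun_section.
Qed.

End fubini_bounded.

(** Uniqueness of measures, read off from integrals. *)
Lemma eq_law_Rintegral d1 d2 d (T1 : measurableType d1) (T2 : measurableType d2)
    (T : measurableType d) (R : realType) (P1 : probability T1 R)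
    (P2 : probability T2 R) (X1 : T1 -> T) (X2 : T2 -> T) (G : set (set T)) :
  measurable = <<s G >> -> setI_closed G -> G [set: T] ->
  measurable_fun [set: T1] X1 -> measurable_fun [set: T2] X2 ->
  (forall A, G A -> P1 (X1 @^-1` A) = P2 (X2 @^-1` A)) ->
  forall f : T -> R, bmfun f -> \int[P1]_x f (X1 x) = \int[P2]_x f (X2 x).
Proof.
move=> sG GI GT mX1 mX2 P12 f mf.
have eqP A : measurable A -> pushforward P1 X1 A = pushforward P2 X2 A.
  move=> mA; apply: (measure_unique G (fun=> setT)) => //.
    by rewrite bigcup_const.
  move=> _; apply: le_lt_trans (ltry 1); apply: probability_le1.
  by rewrite -[X in measurable X]setTI; exact: mX1.
have mEf : measurable_fun [set: T] (EFin \o f).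
  by apply/measurable_EFinP; exact: bmfun_measurable.
rewrite /Rintegral.
transitivity (fine (\int[pushforward P1 X1]_y (f y)%:E)).
  rewrite (integral_pushforward mX1)//.
  by apply: bmfun_integrable; exact: bmfun_comp.
transitivity (fine (\int[pushforward P2 X2]_y (f y)%:E)).
  by congr fine; apply: eq_measure_integral => A mA _; exact: eqP.
rewrite (integral_pushforward mX2)//.
by apply: bmfun_integrable; exact: bmfun_comp.
Qed.

(** * The heat kernel applied to a Gaussian profile *)

Section exponential_bounds.
Context {R : realType}.
Implicit Types y r b : R.

Lemma expR_sub1_le y : expR y - 1 <= y * expR y.
Proof.
have := expR_ge1Dx (- y); rewrite expRN => h.
have e0 := expR_gt0 y.
have : (1 - y) * expR y <= 1.
  by rewrite -ler_pdivlMr// div1r.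
lra.
Qed.

(** Taylor remainders valid on both half-lines: for c between 0 and y, exp c is at most
    1 + exp y. *)
Lemma expR_taylor1 y :
  0 <= expR y - 1 - y <= y ^+ 2 * (1 + expR y).
Proof.
have h1 := expR_ge1Dx y; have h2 := expR_sub1_le y; have e0 := expR_gt0 y.
apply/andP; split; first lra.
have [y0|y0] := leP 0 y.
  have : y * (expR y - 1) <= y * (y * expR y) by exact: ler_wpM2l.
  have := sqr_ge0 y; rewrite expr2; nra.
have : (- y) * (1 - expR y) <= (- y) * (- y) by apply: ler_wpM2l; lra.
by rewrite expr2; have := sqr_ge0 y; rewrite expr2; nra.
Qed.

Lemma expR_taylor2 y :
  `|expR y - 1 - y - y ^+ 2 / 2| <= 2 * `|y| ^+ 3 * (1 + expR y).
Proof.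
pose f := fun z : R => expR z - 1 - z - z ^+ 2 / 2.
pose f' := fun z : R => expR z - 1 - z.
have df (z : R) : is_derive z 1 f (f' z).
  have h := is_deriveB (is_deriveB (is_deriveB (is_derive_expR z)
    (is_derive_cst (1 : R) z 1)) (is_derive_id z 1))
    (is_deriveZ (2^-1) (is_deriveX 2 (is_derive_id z 1))).
  have <- : expR - cst 1 - id - 2^-1 \*: (id ^+ 2) = f.
    by apply/funext => x; rewrite /f !fctE [X in _ = _ - X]mulrC.
  apply: (is_derive_eq h); rewrite /f' subr0; congr (_ - _).
  by rewrite -[LHS]/(2^-1 * (2 * z ^+ 1 * 1)); field.
have cf (a b : R) : {within `[a, b], continuous f}.
  apply: continuous_subspaceT => z.
  by apply: differentiable_continuous; apply/derivable1_diffP; have [] := df z.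
have bound c : `|c| <= `|y| -> expR c <= 1 + expR y ->
    `|f' c * y| <= 2 * `|y| ^+ 3 * (1 + expR y).
  move=> cy ecy; have /andP[f0 f1] := expR_taylor1 c.
  rewrite normrM (ger0_norm f0).
  have e0 := expR_gt0 y; have y0 := normr_ge0 y.
  have c2 : c ^+ 2 <= `|y| ^+ 2.
    by rewrite -real_normK ?num_real// lerXn2r// nnegrE.
  apply: (@le_trans _ _ (`|y| ^+ 2 * (2 * (1 + expR y)) * `|y|)).
    apply: ler_wpM2r => //; apply: (le_trans f1); apply: ler_pM => //.
    - exact: sqr_ge0.
    - by have := expR_gt0 c; lra.
  lra.
have f0 : f 0 = 0 by rewrite /f expR0; ring.
rewrite -/(f y).
have [y0|y0|y0] := ltgtP 0 y.
- have [c cy] := @MVT _ f f' 0 y y0 (fun z _ => df z) (cf 0 y).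
  rewrite f0 !subr0 => ->; move: cy; rewrite in_itv/= => /andP[c0 cy].
  apply: bound; first by rewrite !ger0_norm// ltW.
  by rewrite ler_wpDl// ler_expR ltW.
- have [c cy] := @MVT _ f f' y 0 y0 (fun z _ => df z) (cf y 0).
  rewrite f0 !sub0r => /(congr1 -%R); rewrite opprK => ->.
  move: cy; rewrite in_itv/= => /andP[yc c0].
  rewrite mulrN opprK; apply: bound; first by rewrite !ltr0_norm// lerN2 ltW.
  by rewrite ler_wpDr ?expR_ge0// -expR0 ler_expR ltW.
- by rewrite -y0 f0 normr0 mulr_ge0// ?mulr_ge0 ?exprn_ge0 ?addr_ge0 ?expR_ge0.
Qed.

(** The cubic growth is beaten by the cube of exp (b r / 3) >= 1 + b r / 3. *)
Lemma poly_expR_le b r : 0 < b -> 0 <= r ->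
  (1 + r) ^+ 3 * expR (- (b * r)) <= (1 + 3 / b) ^+ 3.
Proof.
move=> b0 r0; rewrite expRN ler_pdivrMr ?expR_gt0//.
have -> : expR (b * r) = expR (b * r / 3) ^+ 3.
  by rewrite -expRM_natl; congr expR; field.
rewrite -exprMn; apply: lerXn2r; rewrite ?nnegrE.
- lra.
- by rewrite mulr_ge0 ?expR_ge0// addr_ge0// divr_ge0// ltW.
have h : 1 + b * r / 3 <= expR (b * r / 3) by exact: expR_ge1Dx.
have b3 : 0 < 3 / b by rewrite divr_gt0.
have -> : 1 + r = 1 + (3 / b) * (b * r / 3) by field; rewrite gt_eqF.
have : 0 <= b * r / 3 by rewrite divr_ge0// mulr_ge0// ltW.
nra.
Qed.

Lemma ln_le_sub1 y : 0 < y -> ln y <= y - 1.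
Proof. by move=> y0; have := expR_ge1Dx (ln y); rewrite lnK ?posrE//; lra. Qed.

Lemma ln1p_bounds y : 0 <= y -> y - y ^+ 2 <= ln (1 + y) <= y.
Proof.
move=> y0; apply/andP; split; last first.
  by have := @ln_le_sub1 (1 + y); lra.
have y1 : 0 < 1 + y by lra.
have : ln (1 + y)^-1 <= (1 + y)^-1 - 1 by rewrite ln_le_sub1// invr_gt0.
rewrite lnV ?posrE// => h.
have -> : y - y ^+ 2 = 1 - (1 + y)^-1 - y ^+ 3 / (1 + y).
  by field; rewrite gt_eqF.
have : 0 <= y ^+ 3 / (1 + y) by rewrite divr_ge0 ?exprn_ge0// ltW.
lra.
Qed.

End exponential_bounds.

Local Ltac nonneg := repeat first
  [ done | assumption | exact: ltW | exact: expR_ge0 | exact: sqr_ge0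
  | apply: addr_ge0 | apply: divr_ge0 | apply: mulr_ge0 | apply: exprn_ge0 ].

Section gaussian_steps.
Context {R : realType}.
Variables s m B : R.
Hypotheses (s0 : 0 < s) (m0 : 0 <= m) (B0 : 0 <= B).

(** The smallest inverse variance met on the time interval [0, 1]; it makes the
    bounds below uniform in time. *)
Let b0 := s / (1 + s).
Let K := (1 + 3 / (b0 / 2)) ^+ 3.

Let b0_gt0 : 0 < b0. Proof. by rewrite divr_gt0// ltr_wpDl. Qed.

Let K_ge0 : 0 <= K.
Proof. by rewrite exprn_ge0// addr_ge0// divr_ge0// ltW// divr_gt0. Qed.

Let damp b r : b0 <= b -> 0 <= r -> (1 + r) ^+ 3 * expR (- (b * r / 2)) <= K.
Proof.
move=> b0b r0; apply: (@le_trans _ _ ((1 + r) ^+ 3 * expR (- (b0 / 2 * r)))).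
  rewrite ler_wpM2l ?exprn_ge0 ?addr_ge0// ler_expR lerN2.
  by rewrite mulrAC ler_wpM2r// ler_wpM2r.
by apply: poly_expR_le => //; rewrite divr_gt0.
Qed.

(** Moving the centre: third-order Taylor expansion in the displacement. Here r
    and r' are the squared norms of x and x + delta v, p is the inner product of
    x and v, and q the squared norm of v. The Gaussian factor absorbs the
    polynomial growth of the remainder, so the bound does not depend on x. *)
Lemma gaussian_space_step : exists2 C, 0 <= C & forall b delta r p q y : R,
  b0 <= b -> b <= s -> 0 <= delta <= 1 -> 0 <= r -> 0 <= q <= B ->
  `|p| <= (r + q) / 2 ->
  r <= 2 * (r + 2 * delta * p + delta ^+ 2 * q) + 2 * B ->
  0 <= r + 2 * delta * p + delta ^+ 2 * q ->
  y = - b * (delta * p + delta ^+ 2 * q / 2) ->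
  `|expR (- (b * (r + 2 * delta * p + delta ^+ 2 * q) / 2))
    - expR (- (b * r / 2)) * (1 + y + y ^+ 2 / 2)| <= C * delta ^+ 3.
Proof.
pose D := (s * (1 + B)) ^+ 3.
have D0 : 0 <= D by rewrite exprn_ge0// mulr_ge0 ?addr_ge0// ltW.
exists (2 * D * (K + (2 + 2 * B) ^+ 3 * K)).
  by nonneg.
move=> b delta r p q y b0b bs /andP[d0 d1] r0 /andP[q0 qB] pr.
set r' := r + 2 * delta * p + delta ^+ 2 * q; move=> rr' r'0 yE.
set N := expR (- (b * r / 2)).
have N0 : 0 < N by exact: expR_gt0.
have bge0 : 0 <= b by rewrite (le_trans _ b0b)// ltW.
have Ney : expR (- (b * r' / 2)) = N * expR y.
  by rewrite -expRD; congr expR; rewrite yE /r'; field.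
have -> : expR (- (b * r' / 2)) - N * (1 + y + y ^+ 2 / 2) =
    N * (expR y - 1 - y - y ^+ 2 / 2) by rewrite Ney; ring.
rewrite normrM gtr0_norm//.
apply: (le_trans (ler_wpM2l (ltW N0) (expR_taylor2 y))).
have yb : `|y| <= s * (1 + B) * delta * (1 + r).
  rewrite yE mulNr normrN normrM (ger0_norm bge0).
  have -> : s * (1 + B) * delta * (1 + r) = s * (delta * ((1 + B) * (1 + r))).
    by ring.
  apply: ler_pM => //.
  have -> : delta * p + delta ^+ 2 * q / 2 = delta * (p + delta * q / 2).
    by ring.
  rewrite normrM (ger0_norm d0); apply: ler_wpM2l => //.
  apply: (le_trans (ler_normD _ _)).
  have dq : `|delta * q / 2| <= q / 2.
    rewrite ger0_norm ?divr_ge0 ?mulr_ge0// ler_wpM2r//.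
    by rewrite -[leRHS]mul1r ler_wpM2r.
  have : 0 <= B * r by rewrite mulr_ge0.
  lra.
have y3 : `|y| ^+ 3 <= D * delta ^+ 3 * (1 + r) ^+ 3.
  rewrite /D -!exprMn; apply: lerXn2r => //; rewrite nnegrE// !mulr_ge0//.
  - exact: ltW.
  - exact: addr_ge0.
  - exact: addr_ge0.
have h1 : (1 + r) ^+ 3 * N <= K by exact: damp.
have h2 : (1 + r) ^+ 3 * (N * expR y) <= (2 + 2 * B) ^+ 3 * K.
  rewrite -Ney.
  apply: (@le_trans _ _ (((2 + 2 * B) * (1 + r')) ^+ 3
      * expR (- (b * r' / 2)))).
    rewrite ler_wpM2r ?expR_ge0//; apply: lerXn2r; rewrite ?nnegrE.
    - exact: addr_ge0.
    - by nonneg.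
    - have : 0 <= B * r' by rewrite mulr_ge0.
      lra.
  rewrite exprMn -(mulrA (_ ^+ 3)); apply: ler_wpM2l; first by nonneg.
  exact: damp.
apply: (@le_trans _ _ (2 * (D * delta ^+ 3) *
    ((1 + r) ^+ 3 * N + (1 + r) ^+ 3 * (N * expR y)))).
  have -> : N * (2 * `|y| ^+ 3 * (1 + expR y)) =
      2 * `|y| ^+ 3 * (N * (1 + expR y)) by ring.
  have -> : 2 * (D * delta ^+ 3) *
      ((1 + r) ^+ 3 * N + (1 + r) ^+ 3 * (N * expR y)) =
      2 * (D * delta ^+ 3 * (1 + r) ^+ 3) * (N * (1 + expR y)) by ring.
  apply: ler_wpM2r; first by nonneg.
  by rewrite ler_wpM2l.
have -> : 2 * D * (K + (2 + 2 * B) ^+ 3 * K) * delta ^+ 3 =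
  2 * (D * delta ^+ 3) * (K + (2 + 2 * B) ^+ 3 * K) by ring.
apply: ler_wpM2l; first by nonneg.
exact: lerD.
Qed.

(** Moving in time: the Gaussian profile solves the heat equation, so a time
    increment h has the same first-order effect as a centred displacement with
    covariance h times the identity. *)
Lemma gaussian_time_step : exists2 C, 0 <= C & forall b h r : R,
  b0 <= b -> b <= s -> 0 <= h <= 1 -> 0 <= r -> b0 <= b / (1 + b * h) ->
  `|expR (- (m / 2 * ln (1 + b * h)) - b / (1 + b * h) * r / 2)
    - expR (- (b * r / 2)) * (1 - b * h * m / 2 + b * (b * h) * r / 2)|
  <= C * h ^+ 2.
Proof.
pose D := s * (m + s).
have D0 : 0 <= D by rewrite mulr_ge0 ?addr_ge0// ltW.
pose D' := s ^+ 2 * (m + s).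
have D'0 : 0 <= D' by rewrite mulr_ge0 ?addr_ge0 ?sqr_ge0// ltW.
exists (D ^+ 2 * (K + K) + D' * K).
  by nonneg.
move=> b h r b0b bs /andP[h0 h1] r0 b0bh.
have bge0 : 0 <= b by rewrite (le_trans _ b0b)// ltW.
set k := b * h in b0bh *.
have k0 : 0 <= k by rewrite mulr_ge0.
have ks : k <= s * h by rewrite ler_wpM2r.
have k1 : 0 < 1 + k by lra.
set N := expR (- (b * r / 2)).
have N0 : 0 < N by exact: expR_gt0.
set y := - (m / 2 * ln (1 + k)) + b * k / (1 + k) * r / 2.
have Ney : expR (- (m / 2 * ln (1 + k)) - b / (1 + k) * r / 2) = N * expR y.
  by rewrite -expRD; congr expR; rewrite /y; field; rewrite gt_eqF.
have /andP[ln1 ln2] := ln1p_bounds k0.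
have ln0 : 0 <= ln (1 + k) by rewrite ln_ge0// lerDl.
have Ney_le : N * expR y <= expR (- (b / (1 + k) * r / 2)).
  rewrite -Ney ler_expR gerDr oppr_le0 mulr_ge0// divr_ge0//.
pose y' := k * (- m / 2 + b * r / 2).
have -> : expR (- (m / 2 * ln (1 + k)) - b / (1 + k) * r / 2) -
    N * (1 - k * m / 2 + b * k * r / 2) =
    N * (expR y - 1 - y) + N * (y - y').
  by rewrite Ney /y'; field.
have w1 : 1 <= 1 + r by lra.
have w13 : 1 + r <= (1 + r) ^+ 3 by rewrite -[leLHS]expr1 ler_weXn2l.
have w23 : (1 + r) ^+ 2 <= (1 + r) ^+ 3 by rewrite ler_weXn2l.
have frac : 0 <= b * k / (1 + k) * r / 2 <= k * (b * r / 2).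
  apply/andP; split.
    by rewrite divr_ge0// mulr_ge0// divr_ge0 ?mulr_ge0// ltW.
  have -> : b * k / (1 + k) * r / 2 = k * (b * r / 2) * (1 + k)^-1.
    by field; rewrite gt_eqF.
  by rewrite ler_piMr ?invf_le1 ?lerDl//; nonneg.
have yb : `|y| <= D * h * (1 + r).
  have br : b * r <= s * r by rewrite ler_wpM2r.
  have kk : k * (m + b * r) <= s * h * (m + s * r).
    by rewrite ler_pM// ?addr_ge0 ?mulr_ge0// lerD2l.
  have -> : D * h * (1 + r) = s * h * (m + s * r) + s * h * (m * r + s).
    by rewrite /D; ring.
  have : 0 <= s * h * (m * r + s).
    by rewrite !mulr_ge0 ?addr_ge0 ?mulr_ge0// ltW.
  have ml : m * ln (1 + k) <= m * k by rewrite ler_wpM2l.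
  have ml0 : 0 <= m * ln (1 + k) by rewrite mulr_ge0.
  have kbr : 0 <= k * (b * r) by rewrite !mulr_ge0.
  have km : 0 <= k * m by rewrite !mulr_ge0.
  move: frac => /andP[f1 f2] ?.
  rewrite ler_norml; apply/andP; split; rewrite /y; lra.
have yy : `|y - y'| <= D' * h ^+ 2 * (1 + r).
  have k2 : k ^+ 2 <= s ^+ 2 * h ^+ 2.
    by rewrite -exprMn; apply: lerXn2r; rewrite ?nnegrE// mulr_ge0// ltW.
  have -> : y - y' = m / 2 * (k - ln (1 + k)) - b * r / 2 * (k ^+ 2 / (1 + k)).
    by rewrite /y /y'; field; rewrite gt_eqF.
  have g1 : 0 <= m / 2 * (k - ln (1 + k)) <= m * k ^+ 2.
    apply/andP; split; first by rewrite mulr_ge0 ?divr_ge0// subr_ge0.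
    apply: (@le_trans _ _ (m * (k - ln (1 + k)))).
      by apply: ler_wpM2r; [rewrite subr_ge0|rewrite ler_pdivrMr// ler_peMr// ler1n].
    by apply: ler_wpM2l => //; rewrite lerBlDl -lerBlDr.
  have g2 : 0 <= b * r / 2 * (k ^+ 2 / (1 + k)) <= s * r * k ^+ 2.
    apply/andP; split; first by nonneg.
    apply: ler_pM; [by nonneg|by nonneg| |].
      apply: (@le_trans _ _ (b * r)); last by rewrite ler_wpM2r.
      by rewrite ler_pdivrMr// ler_peMr ?ler1n//; nonneg.
    by rewrite ler_pdivrMr// ler_peMr ?sqr_ge0// lerDl.
  apply: (@le_trans _ _ (k ^+ 2 * (m + s * r))).
    move: g1 g2 => /andP[? ?] /andP[? ?].
    have : 0 <= k ^+ 2 by exact: sqr_ge0.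
    rewrite ler_norml; move=> ?; apply/andP; split; lra.
  have -> : D' * h ^+ 2 * (1 + r) = s ^+ 2 * h ^+ 2 * ((m + s) * (1 + r)).
    by rewrite /D'; ring.
  have s0' := ltW s0.
  apply: ler_pM; rewrite ?sqr_ge0 ?addr_ge0 ?mulr_ge0//.
  have : 0 <= m * r by rewrite mulr_ge0.
  lra.
apply: (le_trans (ler_normD _ _)).
rewrite !normrM !(gtr0_norm N0) mulrDl.
have d1 : (1 + r) ^+ 3 * N <= K by exact: damp.
have d2 : (1 + r) ^+ 3 * (N * expR y) <= K.
  apply: (le_trans _ (damp b0bh r0)).
  by apply: ler_wpM2l => //; nonneg.
apply: lerD.
  have /andP[t0 t1] := expR_taylor1 y.
  rewrite (ger0_norm t0).
  apply: (le_trans (ler_wpM2l (ltW N0) t1)).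
  have -> : N * (y ^+ 2 * (1 + expR y)) = y ^+ 2 * (N * (1 + expR y)) by ring.
  apply: (@le_trans _ _ (D ^+ 2 * h ^+ 2 * (1 + r) ^+ 3 * (N * (1 + expR y)))).
    apply: ler_wpM2r; first by nonneg.
    rewrite -real_normK ?num_real//.
    apply: (@le_trans _ _ ((D * h * (1 + r)) ^+ 2)).
      by apply: lerXn2r => //; rewrite nnegrE; nonneg.
    by rewrite !exprMn; apply: ler_wpM2l => //; nonneg.
  have -> : D ^+ 2 * h ^+ 2 * (1 + r) ^+ 3 * (N * (1 + expR y)) =
    D ^+ 2 * h ^+ 2 * ((1 + r) ^+ 3 * N + (1 + r) ^+ 3 * (N * expR y)) by ring.
  have -> : D ^+ 2 * (K + K) * h ^+ 2 = D ^+ 2 * h ^+ 2 * (K + K) by ring.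
  by apply: ler_wpM2l; [nonneg|exact: lerD].
apply: (@le_trans _ _ (N * (D' * h ^+ 2 * (1 + r) ^+ 3))).
  rewrite ler_wpM2l ?(ltW N0)//; apply: (le_trans yy).
  by apply: ler_wpM2l => //; nonneg.
have -> : N * (D' * h ^+ 2 * (1 + r) ^+ 3) =
  D' * h ^+ 2 * ((1 + r) ^+ 3 * N) by ring.
have -> : D' * K * h ^+ 2 = D' * h ^+ 2 * K by ring.
by apply: ler_wpM2l => //; nonneg.
Qed.

End gaussian_steps.

Definition sqnorm {R : realType} {I : finType} (x : I -> R) : R :=
  \sum_i x i ^+ 2.

Lemma sqnorm_ge0 {R : realType} {I : finType} (x : I -> R) : 0 <= sqnorm x.
Proof. by apply: sumr_ge0 => i _; exact: sqr_ge0. Qed.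

Lemma sqnorm_displace {R : realType} {I : finType} (x v : I -> R) (delta : R) :
  sqnorm (fun i => x i + delta * v i) =
  sqnorm x + 2 * delta * (\sum_i x i * v i) + delta ^+ 2 * sqnorm v.
Proof.
rewrite /sqnorm !mulr_sumr -!big_split/=; apply: eq_bigr => i _; ring.
Qed.

Lemma dot_le_sqnorm {R : realType} {I : finType} (x v : I -> R) :
  `|\sum_i x i * v i| <= (sqnorm x + sqnorm v) / 2.
Proof.
have h := sqnorm_ge0 (fun i => x i + 1 * v i).
have h' := sqnorm_ge0 (fun i => x i + (-1) * v i).
by move: h h'; rewrite !sqnorm_displace ler_norml => h h'; apply/andP; split; lra.
Qed.

(** With m the dimension, the value at (t, x) of the solution of the heat equation
    (with half the Laplacian) with initial datum exp (- s |x|^2 / 2), as a function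
    of t and r = |x|^2: the mean of the datum at x plus a centred Gaussian vector of
    covariance t times the identity. *)
Definition heat_profile {R : realType} (s m t r : R) : R :=
  expR (- (m / 2 * ln (1 + s * t)) - s / (1 + s * t) * r / 2).

Lemma heat_profile_ge0 {R : realType} (s m t r : R) :
  0 <= heat_profile s m t r.
Proof. exact: expR_ge0. Qed.

Lemma heat_profile_le1 {R : realType} (s m t r : R) :
  0 <= s -> 0 <= m -> 0 <= t -> 0 <= r -> heat_profile s m t r <= 1.
Proof.
move=> s0 m0 t0 r0; rewrite -[leRHS]expR0 ler_expR -opprD oppr_le0.
have st0 : 0 <= s * t by rewrite mulr_ge0.
apply: addr_ge0; first by rewrite mulr_ge0 ?ln_ge0 ?lerDl// divr_ge0.
by rewrite divr_ge0// mulr_ge0// divr_ge0// addr_ge0.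
Qed.

Section heat_one_step.
Context {R : realType} {d : measure_display} {T : measurableType d}
  {I : finType}.
Variables (P : probability T R) (xi : I -> T -> R) (s B : R).
Hypotheses (s0 : 0 < s) (mxi : forall i, bmfun (xi i))
  (xiB : forall w, sqnorm (xi ^~ w) <= B)
  (xi_mean : forall i, \int[P]_w xi i w = 0)
  (xi_cov : forall i j, \int[P]_w (xi i w * xi j w) = (i == j)%:R).
Let m : R := #|I|%:R.

Let p (x : I -> R) w := \sum_i x i * xi i w.
Let q w := sqnorm (xi ^~ w).

Let B0 : 0 <= B. Proof. exact: le_trans (sqnorm_ge0 _) (xiB point). Qed.

Let mp x : bmfun (p x).
Proof. by apply: bmfun_sum => i; exact: bmfunZ. Qed.

Let mq : bmfun q.
Proof. by apply: bmfun_sum => i; exact: bmfunX. Qed.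

Let E_p x : \int[P]_w p x w = 0.
Proof.
rewrite Rintegral_sumb; last by move=> i; exact: bmfunZ.
by rewrite big1// => i _; rewrite RintegralZb// xi_mean mulr0.
Qed.

Let E_pp x : \int[P]_w (p x w ^+ 2) = sqnorm x.
Proof.
transitivity (\int[P]_w \sum_i \sum_j x i * x j * (xi i w * xi j w)).
  congr Rintegral; apply/funext => w; rewrite expr2 mulr_suml.
  by apply: eq_bigr => i _; rewrite mulr_sumr; apply: eq_bigr => j _; ring.
have mij i j : bmfun (fun w => x i * x j * (xi i w * xi j w)).
  by apply: bmfunZ; exact: bmfunM.
rewrite Rintegral_sumb; last by move=> i; exact: bmfun_sum.
apply: eq_bigr => i _; rewrite Rintegral_sumb// (bigD1 i)//= big1 => [|j ji].
  by rewrite addr0 RintegralZb ?xi_cov ?eqxx ?mulr1//; exact: bmfunM.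
rewrite RintegralZb; last exact: bmfunM.
by rewrite xi_cov eq_sym (negbTE ji) mulr0.
Qed.

Let E_q : \int[P]_w q w = m.
Proof.
rewrite Rintegral_sumb; last by move=> i; exact: bmfunX.
under eq_bigr do rewrite xi_cov eqxx.
by rewrite sumr_const.
Qed.

Let q_bounds w : 0 <= q w <= B.
Proof. by rewrite sqnorm_ge0 xiB. Qed.

Let p_bound x w : `|p x w| <= (sqnorm x + q w) / 2.
Proof. exact: dot_le_sqnorm. Qed.

(** One step of the Lindeberg scheme: a centred displacement with identity
    covariance, scaled by delta, moves the heat profile like the time increment
    delta^2, up to an error of third order that is uniform in time and space. *)
Lemma heat_one_step : exists2 C, 0 <= C & forall (t delta : R) (x : I -> R),
  0 <= t -> 0 <= delta -> t + delta ^+ 2 <= 1 ->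
  `|\int[P]_w heat_profile s m t (sqnorm (fun i => x i + delta * xi i w))
    - heat_profile s m (t + delta ^+ 2) (sqnorm x)| <= C * delta ^+ 3.
Proof.
have m0 : 0 <= m by exact: ler0n.
have [C1 C10 space_step] := gaussian_space_step s0 B0.
have [C2 C20 time_step] := gaussian_time_step s0 m0.
pose b0 := s / (1 + s).
have b00 : 0 < b0 by rewrite divr_gt0// ltr_wpDl.
pose K := (1 + 3 / (b0 / 2)) ^+ 3.
have K0 : 0 <= K.
  by rewrite exprn_ge0// addr_ge0// divr_ge0// ltW// divr_gt0.
exists (C1 + C2 + s ^+ 2 * (1 + B) ^+ 2 * K).
  by nonneg.
move=> t delta x t0 d0 td1.
have d2 : 0 <= delta ^+ 2 by exact: sqr_ge0.
have d1 : delta <= 1 by rewrite -(@ler_pXn2r _ 2) ?nnegrE// expr1n; lra.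
have t1 : t <= 1 by lra.
have st0 : 0 <= s * t by rewrite mulr_ge0// ltW.
pose b := s / (1 + s * t).
have b_ge u : 0 <= u -> u <= 1 -> b0 <= s / (1 + s * u).
  move=> u0 u1; rewrite ler_pM2l// lef_pV2 ?posrE ?ltr_wpDr ?mulr_ge0 ?(ltW s0)//.
  by rewrite lerD2l -[leRHS]mulr1 ler_wpM2l// ltW.
have b0b : b0 <= b by exact: b_ge.
have bs : b <= s by rewrite /b ler_pdivrMr ?ler_peMr ?lerDl ?(ltW s0) ?ltr_wpDr.
have bge0 : 0 <= b by rewrite (le_trans _ b0b)// ltW.
have bh : b / (1 + b * delta ^+ 2) = s / (1 + s * (t + delta ^+ 2)).
  have sd0 : 0 <= s * (delta ^+ 2) by rewrite mulr_ge0// ltW.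
  rewrite /b; field; apply/andP; split; apply: lt0r_neq0; lra.
have b0bh : b0 <= b / (1 + b * delta ^+ 2) by rewrite bh b_ge// addr_ge0.
set r := sqnorm x; have r0 : 0 <= r by exact: sqnorm_ge0.
pose A : R := expR (- (m / 2 * ln (1 + s * t))).
have A0 : 0 <= A by exact: expR_ge0.
have A1 : A <= 1.
  by rewrite -[leRHS]expR0 ler_expR oppr_le0 mulr_ge0 ?ln_ge0 ?lerDl// divr_ge0.
set N : R := expR (- (b * r / 2)).
have N0 : 0 <= N by exact: expR_ge0.
pose y w := - b * (delta * p x w + delta ^+ 2 * q w / 2).
pose G w := expR (- (b * (r + 2 * delta * p x w + delta ^+ 2 * q w) / 2)).
have displ w : r + 2 * delta * p x w + delta ^+ 2 * q w =
    sqnorm (fun i => x i + delta * xi i w) by rewrite sqnorm_displace.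
have displ0 w : 0 <= r + 2 * delta * p x w + delta ^+ 2 * q w.
  by rewrite displ sqnorm_ge0.
have my : bmfun y.
  apply: bmfunZ; apply: bmfunD; first exact: bmfunZ.
  by under eq_fun do rewrite mulrAC; exact: bmfunZ.
have mG : bmfun G.
  have mr : bmfun (fun w => - (b * (r + 2 * delta * p x w + delta ^+ 2 * q w) / 2)).
    under eq_fun do rewrite mulrAC -mulNr.
    apply: bmfunZ; apply: bmfunD; last exact: bmfunZ.
    by apply: bmfunD; [exact: bmfun_cst|exact: bmfunZ].
  apply: (bmfun_continuous_comp (@continuous_expR R)); first by case: mr.
  exists 1 => w; rewrite ger0_norm ?expR_ge0// -[leRHS]expR0 ler_expR oppr_le0.
  by rewrite divr_ge0// mulr_ge0.
have mQ : bmfun (fun w => 1 + y w + y w ^+ 2 / 2).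
  apply: bmfunD; first by apply: bmfunD => //; exact: bmfun_cst.
  by under eq_fun do rewrite mulrC; apply: bmfunZ; exact: bmfunX.
have heatG w : heat_profile s m t (sqnorm (fun i => x i + delta * xi i w)) =
    A * G w.
  by rewrite /heat_profile -displ expRD.
have heatr : heat_profile s m (t + delta ^+ 2) r =
    A * expR (- (m / 2 * ln (1 + b * delta ^+ 2)) -
              b / (1 + b * delta ^+ 2) * r / 2).
  rewrite /heat_profile bh -expRD; congr expR.
  rewrite addrA; congr (_ - _); rewrite -opprD -mulrDr; congr (- (_ * _)).
  have bd0 : 0 <= b * delta ^+ 2 by rewrite mulr_ge0.
  rewrite -lnM ?posrE; [|lra|lra]; congr ln.
  by rewrite /b; field; apply: lt0r_neq0; lra.
rewrite (_ : (fun w => _) = (fun w => A * G w)); last exact/funext.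
rewrite RintegralZb// heatr -mulrBr normrM (ger0_norm A0).
rewrite -[leRHS]mul1r; apply: ler_pM => //.
(* the part of order delta^3 and delta^4 of the mean of the Taylor polynomial; the
   lower orders only involve the first two moments *)
pose rest : R := b ^+ 2 * delta ^+ 3 * (\int[P]_w (p x w * q w)) / 2
  + b ^+ 2 * delta ^+ 4 * (\int[P]_w (q w ^+ 2)) / 8.
have EQ : \int[P]_w (1 + y w + y w ^+ 2 / 2) =
    1 - b * delta ^+ 2 * m / 2 + b * (b * delta ^+ 2) * r / 2 + rest.
  have mpq : bmfun (fun w => p x w * q w) by exact: bmfunM.
  have mpp : bmfun (fun w => p x w ^+ 2) by exact: bmfunX.
  have mqq : bmfun (fun w => q w ^+ 2) by exact: bmfunX.
  rewrite (_ : (fun w => _) = (fun w => 1 + ((- b * delta) * p x w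
      + (- b * delta ^+ 2 / 2 * q w + (b ^+ 2 * delta ^+ 2 / 2 * p x w ^+ 2
      + (b ^+ 2 * delta ^+ 3 / 2 * (p x w * q w)
      + b ^+ 2 * delta ^+ 4 / 8 * q w ^+ 2)))))); last first.
    by apply/funext => w; rewrite /y; field.
  have m1 := bmfunZ (b ^+ 2 * delta ^+ 4 / 8) mqq.
  have m2 := bmfunZ (b ^+ 2 * delta ^+ 3 / 2) mpq.
  have m3 := bmfunZ (b ^+ 2 * delta ^+ 2 / 2) mpp.
  have m4 := bmfunZ (- b * delta ^+ 2 / 2) mq.
  have m5 := bmfunZ (- b * delta) (mp x).
  have m12 := bmfunD m2 m1; have m123 := bmfunD m3 m12.
  have m1234 := bmfunD m4 m123; have m12345 := bmfunD m5 m1234.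
  rewrite RintegralDb ?Rintegral_cstb//; last exact: bmfun_cst.
  rewrite RintegralDb// RintegralZb// E_p.
  rewrite RintegralDb// RintegralZb// E_q.
  rewrite RintegralDb// RintegralZb// E_pp.
  by rewrite RintegralDb// !RintegralZb// /rest -/r; field.
have rest_le : `|rest| <= s ^+ 2 * (1 + B) ^+ 2 * delta ^+ 3 * (1 + r).
  have d3 : 0 <= delta ^+ 3 by exact: exprn_ge0.
  have d43 : delta ^+ 4 <= delta ^+ 3 by rewrite ler_wiXn2l.
  have Epq : `|\int[P]_w (p x w * q w)| <= (r + B) / 2 * B.
    apply: Rintegral_norm_le_cst => [|w]; first exact: bmfunM.
    have /andP[qw0 qwB] := q_bounds w.
    rewrite normrM (ger0_norm qw0); apply: ler_pM => //.
    by apply: (le_trans (p_bound x w)); rewrite -/r; lra.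
  have Eqq : `|\int[P]_w (q w ^+ 2)| <= B ^+ 2.
    apply: Rintegral_norm_le_cst => [|w]; first exact: bmfunX.
    have /andP[qw0 qwB] := q_bounds w.
    by rewrite normrX (ger0_norm qw0); apply: lerXn2r; rewrite ?nnegrE.
  have bs2 : b ^+ 2 <= s ^+ 2 by apply: lerXn2r; rewrite ?nnegrE// ltW.
  have b2 : 0 <= b ^+ 2 by exact: sqr_ge0.
  have s2 : 0 <= s ^+ 2 by exact: sqr_ge0.
  apply: (@le_trans _ _
      (b ^+ 2 * delta ^+ 3 * ((r + B) / 2 * B / 2 + B ^+ 2 / 8))).
    apply: (le_trans (ler_normD _ _)); rewrite mulrDr; apply: lerD.
      set X := \int[P]_w (p x w * q w).
      have -> : b ^+ 2 * delta ^+ 3 * X / 2 = b ^+ 2 * delta ^+ 3 / 2 * X.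
        by field.
      have -> : b ^+ 2 * delta ^+ 3 * ((r + B) / 2 * B / 2) =
        b ^+ 2 * delta ^+ 3 / 2 * ((r + B) / 2 * B) by field.
      rewrite normrM ger0_norm; last by nonneg.
      by apply: ler_wpM2l => //; nonneg.
    set X := \int[P]_w (q w ^+ 2).
    have -> : b ^+ 2 * delta ^+ 4 * X / 8 = b ^+ 2 * delta ^+ 4 / 8 * X.
      by field.
    have -> : b ^+ 2 * delta ^+ 3 * (B ^+ 2 / 8) =
      b ^+ 2 * delta ^+ 3 / 8 * B ^+ 2 by field.
    rewrite normrM ger0_norm; last by nonneg.
    apply: ler_pM => //; first by nonneg.
    by apply: ler_wpM2r => //; apply: ler_wpM2l.
  apply: (@le_trans _ _ (s ^+ 2 * delta ^+ 3 * ((1 + B) ^+ 2 * (1 + r)))).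
    apply: ler_pM.
    - by rewrite mulr_ge0.
    - by rewrite addr_ge0 ?divr_ge0 ?mulr_ge0 ?sqr_ge0 ?addr_ge0.
    - by rewrite ler_wpM2r.
    - have Br : 0 <= B * r by rewrite mulr_ge0.
      have BBr : 0 <= B * (B * r) by rewrite mulr_ge0.
      have BB : 0 <= B * B by rewrite mulr_ge0.
      have B0' := B0; rewrite !expr2; nra.
  by rewrite le_eqVlt; apply/orP; left; apply/eqP; ring.
have NK : (1 + r) * N <= K.
  apply: (@le_trans _ _ ((1 + r) ^+ 3 * expR (- (b0 / 2 * r)))).
    apply: ler_pM => //; first by rewrite addr_ge0.
      by rewrite -[leLHS]expr1 ler_weXn2l// lerDl.
    by rewrite ler_expR lerN2 mulrAC ler_wpM2r// ler_wpM2r.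
  by apply: poly_expR_le => //; rewrite divr_gt0.
have GQ : `|\int[P]_w G w - \int[P]_w (N * (1 + y w + y w ^+ 2 / 2))| <=
    C1 * delta ^+ 3.
  rewrite -RintegralBb//; last exact: bmfunZ.
  apply: Rintegral_norm_le_cst => [|w].
    by apply: bmfunB => //; exact: bmfunZ.
  apply: space_step => //; first by rewrite d0 d1.
  have := sqnorm_ge0 (fun i => x i + 2 * delta * xi i w).
  rewrite sqnorm_displace -/(p x w) -/(q w) -/r => h.
  have /andP[qw0 qwB] := q_bounds w.
  have : delta ^+ 2 * q w <= B.
    by rewrite -[leRHS]mul1r ler_pM//; lra.
  by move: h; rewrite exprMn; lra.
have := time_step b (delta ^+ 2) r b0b bs _ r0 b0bh.
rewrite d2 (le_trans _ td1) ?lerDr// => /(_ isT) HT.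
have HT' : C2 * (delta ^+ 2) ^+ 2 <= C2 * delta ^+ 3.
  by rewrite -exprM; apply: ler_wpM2l => //; rewrite ler_wiXn2l.
move: GQ; rewrite RintegralZb// EQ => GQ.
set g := \int[P]_w G w in GQ *.
set v := expR _ in HT *.
have Nrest : `|N * rest| <= s ^+ 2 * (1 + B) ^+ 2 * K * delta ^+ 3.
  rewrite normrM (ger0_norm N0).
  apply: (le_trans (ler_wpM2l N0 rest_le)).
  have -> : N * (s ^+ 2 * (1 + B) ^+ 2 * delta ^+ 3 * (1 + r)) =
    s ^+ 2 * (1 + B) ^+ 2 * delta ^+ 3 * ((1 + r) * N) by ring.
  have -> : s ^+ 2 * (1 + B) ^+ 2 * K * delta ^+ 3 =
    s ^+ 2 * (1 + B) ^+ 2 * delta ^+ 3 * K by ring.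
  by apply: ler_wpM2l => //; nonneg.
move: GQ HT; rewrite -/N.
set Q := (1 - _ + _) => GQ HT.
have -> : g - v = (g - N * (Q + rest)) + N * rest - (v - N * Q) by ring.
apply: (le_trans (ler_normB _ _)).
have -> : (C1 + C2 + s ^+ 2 * (1 + B) ^+ 2 * K) * delta ^+ 3 =
  (C1 * delta ^+ 3 + s ^+ 2 * (1 + B) ^+ 2 * K * delta ^+ 3) + C2 * delta ^+ 3.
  by ring.
apply: lerD; last exact: le_trans HT HT'.
by apply: (le_trans (ler_normD _ _)); exact: lerD.
Qed.

End heat_one_step.

(** * Independent samples *)

Section boxes.
Context {d : measure_display} {T : measurableType d} {n : nat}.

Definition box (B : 'I_n -> set T) : set (n.-tuple T) :=
  [set s | forall i, B i (tnth s i)].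

Definition boxes : set (set (n.-tuple T)) :=
  [set box B | B in [set B | forall i, measurable (B i)]].

Lemma measurable_box (B : 'I_n -> set T) :
  (forall i, measurable (B i)) -> measurable (box B).
Proof.
move=> mB; rewrite (_ : box B = \big[setI/setT]_(i < n) ((fun s => tnth s i) @^-1` B i)).
  apply: bigsetI_measurable => i _.
  by rewrite -[X in measurable X]setTI; exact: measurable_tnth.
rewrite -bigcap_seq; apply/seteqP; split => s /= Bs i; last first.
  by apply: (Bs i); rewrite /= mem_index_enum.
by move=> _; exact: Bs.
Qed.

Lemma boxesI : setI_closed boxes.
Proof.
move=> _ _ [A mA <-] [B mB <-]; exists (fun i => A i `&` B i).
  by move=> i; exact: measurableI.
apply/seteqP; split => s /= => [ABs|[As Bs] i]; last by split.
by split => i; have [] := ABs i.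
Qed.

Lemma boxesT : boxes [set: n.-tuple T].
Proof. by exists (fun=> setT) => //; apply/seteqP; split. Qed.

Lemma measurable_boxes : measurable = <<s boxes >>.
Proof.
apply/seteqP; split; last first.
  apply: smallest_sub; first exact: sigma_algebra_measurable.
  by move=> _ [B mB <-]; exact: measurable_box.
apply: smallest_sub; first exact: smallest_sigma_algebra.
rewrite -bigcup_seq; apply: bigcup_sub => i _ _ [A mA <-].
apply: sub_sigma_algebra; exists (fun j => if j == i then A else setT).
  by move=> j; case: ifP.
rewrite setTI; apply/seteqP; split => s /=; first by move=> /(_ i); rewrite eqxx.
by move=> As j; case: eqP => // ->.
Qed.

Definition tuple_upd (s : n.-tuple T) (k : 'I_n) (v : T) : n.-tuple T :=
  [tuple if i == k then v else tnth s i | i < n].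

Lemma tnth_tuple_upd (s : n.-tuple T) (k : 'I_n) (v : T) (i : 'I_n) :
  tnth (tuple_upd s k v) i = if i == k then v else tnth s i.
Proof. by rewrite tnth_mktuple. Qed.

End boxes.
Arguments boxes {d} T n.

Lemma measurable_fun_mktuple d d' (S : measurableType d) (T : measurableType d')
    n (F : 'I_n -> S -> T) :
  (forall i, measurable_fun [set: S] (F i)) ->
  measurable_fun [set: S] (fun s => [tuple F i s | i < n]).
Proof.
move=> mF; apply/measurable_fun_tnthP => i.
by apply: eq_measurable_fun (mF i) => s _; rewrite /= tnth_mktuple.
Qed.

Section resampling.
Context {R : realType} {d : nat} {dO : measure_display}
  {Omega : measurableType dO}.
Variables (Pr : probability Omega R) (W : nat -> Omega -> obs R d)
  (P : probability (obs R d) R).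
Hypothesis iidW : iid_sample Pr W P.

Definition sample n (w : Omega) : n.-tuple (obs R d) := [tuple W i w | i < n].

Lemma measurable_sample n : measurable_fun [set: Omega] (sample n).
Proof. by apply: measurable_fun_mktuple => i; case: iidW. Qed.

Lemma sample_box n (B : 'I_n -> set (obs R d)) :
  (forall i, measurable (B i)) ->
  Pr (sample n @^-1` box B) = (\prod_(i < n) P (B i))%E.
Proof.
move=> mB; have [mW lawW indW] := iidW.
pose A i := if insub i is Some j then B j else [set: obs R d].
have mA i : measurable (A i) by rewrite /A; case: insubP.
have AE (i : 'I_n) : A i = B i by rewrite /A valK.
pose J := [fset i in iota 0 n]%fset.
have memJ i : (i \in J) = (i < n)%N by rewrite !inE mem_iota.
have -> : sample n @^-1` box B = \bigcap_(i in [set` J]) (W i @^-1` A i).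
  apply/seteqP; split => w /= BW.
    move=> i /=; rewrite memJ => ltin.
    have := BW (Ordinal ltin).
    by rewrite tnth_mktuple -[B _]AE.
  by move=> i; rewrite tnth_mktuple -AE; apply: BW; rewrite /= memJ.
rewrite indW//.
have permJ : perm_eq J (iota 0 n).
  apply: uniq_perm; rewrite ?fset_uniq ?iota_uniq// => i.
  by rewrite memJ mem_iota.
rewrite (perm_big _ permJ)/= -[in LHS](subn0 n) -/(index_iota 0 n) big_mkord.
by apply: eq_bigr => i _; rewrite AE; exact: lawW.
Qed.

(** Replacing one coordinate of the sample by an independent copy does not change
    the law of the sample. All uses of the independence of the sample go through
    this identity: an expectation can be computed by first averaging over a single
    coordinate, the others being frozen. *)
Lemma resampling n (k : 'I_n) (f : n.-tuple (obs R d) -> R) : bmfun f ->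
  \int[Pr]_w f (sample n w) =
  \int[Pr]_w \int[P]_v f (tuple_upd (sample n w) k v).
Proof.
move=> mf.
pose X2 (z : Omega * obs R d) := tuple_upd (sample n z.1) k z.2.
have mX2 : measurable_fun setT X2.
  apply: measurable_fun_mktuple => i; case: (i == k).
    exact: measurable_snd.
  have /measurable_fun_tnthP/(_ i) mi := @measurable_sample n.
  exact: (measurableT_comp mi measurable_fst).
transitivity (\int[(Pr \x P)%E]_z f (X2 z)); last first.
  by rewrite Rintegral_fubini//; exact: bmfun_comp.
apply: (eq_law_Rintegral measurable_boxes boxesI boxesT) => //.
  exact: measurable_sample.
move=> _ [B mB <-]; rewrite sample_box//.
pose B' i := if i == k then setT else B i.
have mB' i : measurable (B' i) by rewrite /B'; case: ifP.
have -> : X2 @^-1` box B = (sample n @^-1` box B') `*` B k.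
  apply/seteqP; split => -[w v] /=.
    move=> Bwv; split; last by have := Bwv k; rewrite tnth_tuple_upd eqxx.
    by move=> i /=; have := Bwv i; rewrite tnth_tuple_upd /B'; case: ifP.
  move=> [B'w Bv] i; rewrite tnth_tuple_upd.
  by have := B'w i; rewrite /B'; case: eqP => [->|].
have mS : measurable (sample n @^-1` box B').
  rewrite -[X in measurable X]setTI; apply: measurable_sample => //.
  exact: measurable_box.
transitivity (Pr (sample n @^-1` box B') * P (B k))%E; last first.
  exact/esym/product_measure1E.
rewrite sample_box// (bigD1 k)//= [in RHS](bigD1 k)//= /B' eqxx.
rewrite probability_setT mul1e muleC; congr (_ * _)%E.
by apply: eq_bigr => i /negbTE ->.
Qed.

End resampling.

(** * A central limit theorem for Laplace transforms of squared norms *)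

Lemma cvg_invsqrt {R : realType} :
  (fun n => (Num.sqrt n%:R)^-1 : R) @ \oo --> (0 : R).
Proof.
apply/cvgr0Pnorm_lt => e e0; near=> n.
have n0 : (0 : R) < n%:R by near: n; exact: nbhs_infty_gtr.
have sn0 : 0 < Num.sqrt n%:R :> R by rewrite sqrtr_gt0.
rewrite ger0_norm ?invr_ge0 ?(ltW sn0)// invf_plt ?posrE//.
rewrite -[ltLHS]ger0_norm ?invr_ge0 ?(ltW e0)// -sqrtr_sqr ltr_sqrt//.
by near: n; exact: nbhs_infty_gtr.
Unshelve. all: by end_near. Qed.

Lemma bmfun_heat_profile {R : realType} {d} {T : measurableType d}
    {I : finType} (s m t : R) (g : I -> T -> R) :
  0 <= s -> 0 <= m -> 0 <= t -> (forall i, bmfun (g i)) ->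
  bmfun (fun w => heat_profile s m t (sqnorm (g ^~ w))).
Proof.
move=> s0 m0 t0 mg; rewrite /heat_profile.
apply: (bmfun_continuous_comp (@continuous_expR R)); last first.
  exists 1 => w; rewrite ger0_norm ?heat_profile_ge0//.
  by rewrite heat_profile_le1// sqnorm_ge0.
have mq : bmfun (fun w => sqnorm (g ^~ w)).
  by apply: bmfun_sum => i; exact: bmfunX.
apply: bmfun_measurable; apply: bmfunB; first exact: bmfun_cst.
by under eq_fun do rewrite mulrAC; exact: bmfunZ.
Qed.

Section laplace_clt.
Context {R : realType} {d : nat} {dO : measure_display}
  {Omega : measurableType dO} {I : finType}.
Variables (Pr : probability Omega R) (W : nat -> Omega -> obs R d)
  (P : probability (obs R d) R) (xi : I -> obs R d -> R).
Hypotheses (iidW : iid_sample Pr W P) (mxi : forall i, bmfun (xi i))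
  (xi_mean : forall i, \int[P]_w xi i w = 0)
  (xi_cov : forall i j, \int[P]_w (xi i w * xi j w) = (i == j)%:R).
Let m : R := #|I|%:R.

Definition scaled_sum n (i : I) (w : Omega) : R :=
  (Num.sqrt n%:R)^-1 * \sum_(k < n) xi i (W k w).

(** Lindeberg's scheme with an explicit heat flow in place of Gaussian variables:
    the sum is revealed one summand at a time while the heat profile runs
    backwards from time 1 to time 0. Each of the n steps costs n^(-3/2). *)
Lemma laplace_clt (s : R) : 0 < s ->
  (fun n => \int[Pr]_w expR (- (s * sqnorm (scaled_sum n ^~ w) / 2))) @ \oo -->
  expR (- (m / 2 * ln (1 + s))).
Proof.
move=> s0; have sge0 := ltW s0.
have m0 : 0 <= m by exact: ler0n.
have [B xiB] : exists B, forall w, sqnorm (xi ^~ w) <= B.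
  have : bmfun (fun w => sqnorm (xi ^~ w)).
    by apply: bmfun_sum => i; exact: bmfunX.
  by move=> [_ [B qB]]; exists B => w; exact: le_trans (ler_norm _) (qB w).
have [C C0 step] := heat_one_step s0 mxi xiB xi_mean xi_cov.
rewrite -/m in step.
suff bound n : (0 < n)%N ->
    `|\int[Pr]_w expR (- (s * sqnorm (scaled_sum n ^~ w) / 2))
      - expR (- (m / 2 * ln (1 + s)))| <= C * (Num.sqrt n%:R)^-1.
  apply/cvgrPdist_lt => e e0.
  have C1 : 0 < e / (C + 1) by rewrite divr_gt0// ltr_wpDl.
  move/cvgr0Pnorm_lt : (@cvg_invsqrt R) => /(_ _ C1) small.
  near=> n.
  have n0 : (0 < n)%N by near: n; exact: nbhs_infty_gt.
  rewrite distrC; apply: (le_lt_trans (bound n n0)).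
  have : `|(Num.sqrt n%:R)^-1 : R| < e / (C + 1) by near: n.
  rewrite ger0_norm ?invr_ge0 ?sqrtr_ge0// ltr_pdivlMr ?ltr_wpDl//.
  have : 0 <= (Num.sqrt n%:R)^-1 :> R by rewrite invr_ge0 sqrtr_ge0.
  nra.
move=> n0; set delta : R := (Num.sqrt n%:R)^-1.
have d0 : 0 <= delta by rewrite invr_ge0 sqrtr_ge0.
have nd : n%:R * delta ^+ 2 = 1.
  by rewrite exprVn sqr_sqrtr ?ler0n// divff// pnatr_eq0 -lt0n.
pose S j (i : I) w := delta * \sum_(k < j) xi i (W k w).
have mW k : measurable_fun setT (W k) by case: iidW.
have mS j i : bmfun (S j i).
  by apply: bmfunZ; apply: bmfun_sum => k; apply: bmfun_comp.
pose t j : R := (n - j)%:R * delta ^+ 2.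
have t0 j : 0 <= t j by rewrite mulr_ge0// sqr_ge0.
pose a j := \int[Pr]_w heat_profile s m (t j) (sqnorm (S j ^~ w)).
have a_step j : (j < n)%N -> `|a j.+1 - a j| <= C * delta ^+ 3.
  move=> jn; pose k := Ordinal jn.
  have tj : t j = t j.+1 + delta ^+ 2.
    by rewrite /t -[in LHS](subnSK jn) -natr1 mulrDl mul1r.
  pose f (u : n.-tuple (obs R d)) := heat_profile s m (t j.+1) (sqnorm (fun i =>
    delta * (\sum_(l < n | (l < j)%N) xi i (tnth u l)) + delta * xi i (tnth u k))).
  have mf : bmfun f.
    have mxi_tnth i (l : 'I_n) : bmfun (fun u => xi i (tnth u l)).
      by apply: bmfun_comp => //; exact: measurable_tnth.
    apply: bmfun_heat_profile => // i; apply: bmfunD; last exact: bmfunZ.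
    apply: bmfunZ; under eq_fun do rewrite -big_filter.
    exact: bmfun_sum.
  have prefix i w : \sum_(l < n | (l < j)%N) xi i (W l w) =
      \sum_(l < j) xi i (W l w).
    rewrite -(big_mkord (fun l => (l < j)%N) (fun l => xi i (W l w))).
    rewrite (big_cat_nat (n := j))//=; last exact: ltnW.
    rewrite [X in _ + X]big_nat_cond [X in _ + X]big1 ?addr0.
      by rewrite big_mkord; apply: eq_bigl => l; rewrite ltn_ord.
    by move=> l /andP[/andP[jl _]]; rewrite ltnNge jl.
  have -> : a j.+1 = \int[Pr]_w f (sample W n w).
    congr Rintegral; apply/funext => w; congr heat_profile; congr sqnorm.
    apply/funext => i; rewrite /S big_ord_recr/= mulrDr tnth_mktuple; congr (_ * _ + _).
    by rewrite -prefix; apply: eq_bigr => l _; rewrite tnth_mktuple.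
  rewrite (resampling iidW k mf).
  have mint : bmfun (fun w => \int[P]_v f (tuple_upd (sample W n w) k v)).
    apply: (@bmfun_Rintegral _ _ _ _ _ Pr P
      (fun z => f (tuple_upd (sample W n z.1) k z.2))).
    apply: bmfun_comp mf; apply: measurable_fun_mktuple => i.
    case: (i == k); first exact: measurable_snd.
    have /measurable_fun_tnthP/(_ i) mi := @measurable_sample _ _ _ _ _ _ _ iidW n.
    exact: (measurableT_comp mi measurable_fst).
  have mh : bmfun (fun w => heat_profile s m (t j) (sqnorm (S j ^~ w))).
    exact: bmfun_heat_profile.
  rewrite -RintegralBb//; apply: Rintegral_norm_le_cst => [|w]; first exact: bmfunB.
  have -> : (fun v => f (tuple_upd (sample W n w) k v)) = fun v =>
      heat_profile s m (t j.+1) (sqnorm (fun i => S j i w + delta * xi i v)).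
    apply/funext => v; congr heat_profile; congr sqnorm; apply/funext => i.
    rewrite tnth_tuple_upd eqxx; congr (_ * _ + _).
    rewrite -prefix; apply: eq_bigr => l lj; rewrite tnth_tuple_upd.
    by rewrite -val_eqE/= ltn_eqF// tnth_mktuple.
  rewrite tj; apply: step => //.
  by rewrite -tj -nd /t ler_wpM2r ?sqr_ge0// ler_nat leq_subr.
have a_sum j : (j <= n)%N -> `|a j - a 0%N| <= j%:R * (C * delta ^+ 3).
  elim: j => [_|j IH jn]; first by rewrite subrr normr0 mul0r.
  have -> : a j.+1 - a 0%N = (a j.+1 - a j) + (a j - a 0%N) by rewrite addrA subrK.
  rewrite -natr1 mulrDl mul1r [leRHS]addrC; apply: (le_trans (ler_normD _ _)).
  by apply: lerD; [exact: a_step|exact/IH/ltnW].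
have := a_sum n (leqnn n).
have -> : n%:R * (C * delta ^+ 3) = C * delta.
  by rewrite exprS; transitivity (C * delta * (n%:R * delta ^+ 2));
    [ring|rewrite nd mulr1].
have -> : a n = \int[Pr]_w expR (- (s * sqnorm (scaled_sum n ^~ w) / 2)).
  congr Rintegral; apply/funext => w.
  by rewrite /heat_profile /t subnn mul0r mulr0 addr0 ln1 mulr0 oppr0 add0r divr1.
suff -> : a 0%N = expR (- (m / 2 * ln (1 + s))) by [].
rewrite /a (_ : (fun w => _) = fun=> expR (- (m / 2 * ln (1 + s)))).
  exact: Rintegral_cstb.
apply/funext => w; rewrite /heat_profile /t subn0 nd mulr1.
have -> : sqnorm (S 0%N ^~ w) = 0.
  by apply: big1 => i _; rewrite /S big_ord0 mulr0 expr0n.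
by rewrite mulr0 mul0r subr0.
Unshelve. all: by end_near. Qed.

End laplace_clt.

(** * The chi-squared distribution *)

Section chi_squared_facts.
Context {R : realType}.
Local Notation RB := (measurableTypeR R).
Local Notation leb := (@lebesgue_measure R).
Local Notation gauss := (normal_prob (0 : R) 1 : probability RB R).

Lemma integral_normal_prob (m s : R) (f : R -> R) : bmfun (f : RB -> R) ->
  (\int[normal_prob m s]_x (f x)%:E =
   \int[leb]_x ((f x)%:E * (normal_pdf m s x)%:E))%E.
Proof.
move=> mf.
have mEf : measurable_fun [set: RB] (EFin \o f).
  by apply/measurable_EFinP; case: mf.
have dom : normal_prob m s `<< leb by exact: normal_prob_dominates.
rewrite -(Radon_Nikodym_change_of_variables dom)//=; last first.
  exact: (bmfun_integrable (normal_prob m s : probability RB R)).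
apply: ae_eq_integral => //.
- by apply: emeasurable_funM => //; exact: (measurable_int leb).
- apply: emeasurable_funM => //; apply/measurable_EFinP.
  exact: measurable_normal_pdf.
- apply: ae_eqe_mul2l => /=; rewrite Radon_NikodymE//=.
  case: cid => /= h [h1 h2 h3].
  apply: integral_ae_eq => //=.
  + by apply/measurable_EFinP; exact: measurable_normal_pdf.
  + by move=> E _ mE; rewrite -h3.
Qed.

(** The factor exp (- s x^2 / 2) turns the standard normal density into that of a
    centred normal law of variance 1 / (1 + s), up to normalisation. *)
Lemma gauss_laplace (s : R) : 0 < s ->
  (\int[normal_prob 0 1]_x (expR (- (s * x ^+ 2 / 2)))%:E)%E =
  (expR (- (1 / 2 * ln (1 + s))))%:E.
Proof.
move=> s0; have s1 : 0 < 1 + s by lra.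
rewrite integral_normal_prob; last first.
  apply: (@bmfun_continuous_comp _ RB R expR (fun x => - (s * x ^+ 2 / 2))).
  - exact: continuous_expR.
  - apply: measurableT_comp => //; apply: measurable_funM => //.
    by apply: measurable_funM => //; exact: measurable_funX.
  - exists 1 => x; rewrite ger0_norm ?expR_ge0// -[leRHS]expR0 ler_expR oppr_le0.
    by rewrite divr_ge0// mulr_ge0 ?sqr_ge0// ltW.
pose sigma : R := expR (- (1 / 2 * ln (1 + s))).
have sigma0 : sigma != 0 by rewrite gt_eqF// expR_gt0.
have sigma2 : sigma ^+ 2 = (1 + s)^-1.
  rewrite -expRM_natl; have -> : 2%:R * - (1 / 2 * ln (1 + s)) = - ln (1 + s).
    by field.
  by rewrite expRN lnK ?posrE.
rewrite (_ : (fun x => _) = (fun x => sigma%:E * (normal_pdf 0 sigma x)%:E)%E).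
  rewrite ge0_integralZl ?integral_normal_pdf ?mule1//.
  - by apply/measurable_EFinP; exact: measurable_normal_pdf.
  - by move=> x _; rewrite lee_fin normal_pdf_ge0.
  - by rewrite lee_fin expR_ge0.
apply/funext => x; rewrite -!EFinM; congr EFin.
rewrite !normal_pdfE ?oner_neq0// /normal_fun /normal_peak !subr0.
have -> : Num.sqrt (sigma ^+ 2 * pi *+ 2) =
    sigma * Num.sqrt (1 ^+ 2 * pi *+ 2) :> R.
  rewrite expr1n mul1r -mulrnAr sqrtrM ?sqr_ge0// sqrtr_sqr.
  by rewrite ger0_norm ?expR_ge0.
rewrite invfM !mulrA divff// mul1r -!mulrA.
rewrite mulrCA; congr (_ * _); rewrite -expRD; congr expR.
rewrite expr1n sigma2 -[(1 + s)^-1 *+ 2]mulr_natr; field.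
by rewrite gt_eqF.
Qed.

Lemma chi_squared_ge0 k : chi_squared k `]-oo, (0 : R)[%classic = 0%E.
Proof.
elim: k => [|k IH] /=.
  by rewrite diracE memNset//= in_itv/= ltxx.
apply/eqP; rewrite eq_le measure_ge0 andbT.
have m1 : measurable ([set: RB] `*` (`]-oo, (0 : R)[%classic : set RB)).
  by apply: measurableX.
apply: (@le_trans _ _ ((gauss \x chi_squared k)%E
    ([set: RB] `*` (`]-oo, (0 : R)[%classic : set RB)))).
  apply: le_measure; rewrite ?inE//.
    by rewrite -[X in measurable X]setTI; apply: measurable_sqr_add.
  move=> [x y] /=; rewrite !in_itv/= /sqr_add/= => h; split => //.
  by apply: le_lt_trans h; rewrite lerDr sqr_ge0.
by rewrite product_measure1E//= IH mule0.
Qed.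

Lemma chi_squared_laplace_ereal k (s : R) : 0 < s ->
  (\int[chi_squared k]_x (expR (- (s * x / 2)))%:E)%E =
  (expR (- (k%:R / 2 * ln (1 + s))))%:E.
Proof.
move=> s0.
have mexp : measurable_fun [set: RB] (fun x : RB => (expR (- (s * x / 2)))%:E).
  apply/measurable_EFinP; apply: measurableT_comp => //.
  by apply: measurableT_comp => //; apply: measurable_funM => //; apply: measurable_funM.
elim: k => [|k IH].
  by rewrite integral_dirac//= diracT mul1e mulr0 !mul0r oppr0.
transitivity (\int[(gauss \x chi_squared k)%E]_z
    (expR (- (s * sqr_add z / 2)))%:E)%E.
  exact: (@ge0_integral_distribution _ _ _ _ R (gauss \x chi_squared k)%E
    (@sqr_add R)).
rewrite fubini_tonelli1//; last exact: measurableT_comp mexp measurable_sqr_add.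
rewrite /fubini_F/=.
under eq_integral => x _.
  under eq_integral => y _.
    rewrite /sqr_add/=.
    rewrite (_ : - (s * (x ^+ 2 + y) / 2) =
      - (s * x ^+ 2 / 2) - (s * y / 2)); last by field.
    rewrite expRD EFinM; over.
  rewrite ge0_integralZl//.
  rewrite IH; over.
rewrite ge0_integralZr//; last first.
- apply/measurable_EFinP; apply: measurableT_comp => //.
  apply: measurableT_comp => //; apply: measurable_funM => //.
  by apply: measurable_funM => //; exact: measurable_funX.
rewrite gauss_laplace// -EFinM -expRD; congr (expR _)%:E.
by rewrite -natr1; field.
Qed.

(** The positive part keeps the integrand bounded on the whole line; it changes nothing
    because the chi-squared law lives on the half-line. *)
Lemma chi_squared_laplace k (s : R) : 0 < s ->
  \int[chi_squared k]_x expR (- (s * Num.max x 0 / 2)) =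
  expR (- (k%:R / 2 * ln (1 + s))).
Proof.
move=> s0; rewrite /Rintegral -[RHS]/(fine (expR (- (k%:R / 2 * ln (1 + s))))%:E).
rewrite -chi_squared_laplace_ereal//; congr fine.
apply: ae_eq_integral => //.
- apply/measurable_EFinP; apply: measurableT_comp => //.
  apply: measurableT_comp => //; apply: measurable_funM => //.
  by apply: measurable_funM => //; exact: measurable_maxr.
- apply/measurable_EFinP; apply: measurableT_comp => //.
  by apply: measurableT_comp => //; apply: measurable_funM => //; apply: measurable_funM.
exists `]-oo, (0 : R)[%classic; split => //; first exact: chi_squared_ge0.
move=> x /=; rewrite in_itv/= => h; rewrite ltNge; apply/negP => x0; apply: h => _.
by rewrite max_l.
Qed.

Lemma normal_prob_set1 (m s c : R) : normal_prob m s [set c] = 0%E.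
Proof.
have /null_content_dominatesP := @normal_prob_dominates R m s.
by apply => //; exact: lebesgue_measure_set1.
Qed.

(** Fubini: for a fixed value of the other squares, at most two values of the Gaussian
    give the sum c, and a normal law has no atoms. *)
Lemma chi_squared_set1 k (c : R) : chi_squared k.+1 [set c] = 0%E.
Proof.
rewrite /= /distribution/= /pushforward/=.
have mA : measurable (@sqr_add R @^-1` [set c]).
  by rewrite -[X in measurable X]setTI; exact: measurable_sqr_add.
rewrite -[LHS]/((gauss \x chi_squared k)%E (@sqr_add R @^-1` [set c])).
rewrite -(setIT (_ @^-1` _)) -integral_indic//.
rewrite fubini_tonelli2//; last first.
  by apply/measurable_EFinP; exact: measurable_indic.
apply: integral0_eq => y _; rewrite /fubini_G/=.
rewrite (_ : (fun x => _) =
    (fun x => (\1_[set x : RB | x ^+ 2 + y = c] x)%:E)); last first.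
  by apply/funext => x; rewrite !indicE; congr (_%:R%:E); apply/idP/idP; rewrite !inE.
have mS : measurable [set x : RB | x ^+ 2 + y = c].
  rewrite (_ : [set _ | _] = (fun x : RB => x ^+ 2 + y) @^-1` [set c])//.
  rewrite -[X in measurable X]setTI.
  by apply: measurable_funD => //; exact: measurable_funX.
rewrite integral_indic// setIT.
apply/eqP; rewrite eq_le measure_ge0 andbT.
pose a := Num.sqrt (c - y).
apply: (@le_trans _ _ (gauss ([set a] `|` [set - a]))).
  apply: le_measure; rewrite ?inE//; first exact: measurableU.
  move=> x /= xc; have : x ^+ 2 = a ^+ 2.
    by rewrite sqr_sqrtr -xc ?addrK ?sqr_ge0.
  by move/eqP; rewrite eqf_sqr => /orP[] /eqP ->; [left|right].
apply: le_trans (measureU2 _ _ _) _ => //=.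
by rewrite !normal_prob_set1 adde0.
Qed.

End chi_squared_facts.

(** * From Laplace transforms to tail probabilities *)

Lemma expn_cvg0 {R : realType} (r e : R) : 0 <= r < 1 -> 0 < e ->
  exists N, r ^+ N <= e.
Proof.
move=> /andP[r0 r1] e0.
have /cvgr0Pnorm_lt/(_ e e0)[N _ rN] : (r ^+ n) @[n --> \oo] --> (0 : R).
  by apply: cvg_expr; rewrite ger0_norm.
exists N; have := rN N (leqnn N); rewrite /= ger0_norm ?exprn_ge0//.
exact: ltW.
Qed.

Lemma bernoulli_ineq {R : realType} (x : R) n : 0 <= x <= 1 ->
  1 - n%:R * x <= (1 - x) ^+ n.
Proof.
move=> /andP[x0 x1]; elim: n => [|n IH]; first by rewrite mul0r subr0 expr0.
rewrite exprS; apply: (@le_trans _ _ ((1 - x) * (1 - n%:R * x))); last first.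
  by apply: ler_wpM2l => //; rewrite subr_ge0.
rewrite -natr1; have : 0 <= n%:R * (x * x) :> R by rewrite !mulr_ge0.
lra.
Qed.

(** The polynomial (1 - v^N)^(2^N) is close to 1 on the left of 1/2 and close to 0
    on its right; the exponential change of variables, calibrated at the middle
    of [a, b], turns it into a smooth step between a and b. *)
Lemma smooth_step {R : realType} (a b e : R) : 0 < a < b -> 0 < e ->
  exists theta (p : {poly R}), 0 < theta /\ forall x : R, 0 <= x ->
    let y := p.[expR (- (theta * x))] in
    [/\ 0 <= y <= 1, x <= a -> y <= e & b <= x -> 1 - e <= y].
Proof.
move=> /andP[a0 ab] e0; pose c := (a + b) / 2.
have c0 : 0 < c by rewrite /c; lra.
pose theta := ln 2 / c.
have theta0 : 0 < theta by rewrite divr_gt0// ln_gt0// ltr1n.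
have half : expR (- (theta * c)) = 2^-1.
  by rewrite /theta divfK ?gt_eqF// expRN lnK ?posrE.
pose r := 2 * expR (- (theta * b)).
have r0 : 0 <= r by rewrite mulr_ge0 ?expR_ge0.
have r1 : r < 1.
  rewrite /r -ltr_pdivlMl// mulr1 -half ltr_expR ltrN2 ltr_pM2l//.
  by rewrite /c; lra.
pose r' := (2 * expR (- (theta * a)))^-1.
have ea0 : 0 < expR (- (theta * a)) by exact: expR_gt0.
have r'0 : 0 <= r' by rewrite invr_ge0 mulr_ge0// ltW.
have r'1 : r' < 1.
  rewrite invf_lt1 ?mulr_gt0// -ltr_pdivrMl// mulr1 -half ltr_expR ltrN2.
  by rewrite ltr_pM2l//; rewrite /c; lra.
have [N1 rN1] : exists N, r ^+ N <= e by apply: expn_cvg0; rewrite ?r0.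
have [N2 rN2] : exists N, r' ^+ N <= e by apply: expn_cvg0; rewrite ?r'0.
pose N := maxn N1 N2.+1.
have rN : r ^+ N <= e.
  by apply: le_trans rN1; rewrite ler_wiXn2l ?leq_maxl// ltW.
have r'N : r' ^+ N <= e.
  apply: le_trans rN2; rewrite ler_wiXn2l ?(ltW r'1)//.
  by rewrite (leq_trans (leqnSn _))// leq_maxr.
exists theta, ((1 - 'X^N) ^+ (2 ^ N)); split => // x x0 /=.
set v := expR (- (theta * x)).
have v0 : 0 < v by exact: expR_gt0.
have v1 : v <= 1 by rewrite -[leRHS]expR0 ler_expR oppr_le0 mulr_ge0// ltW.
have vN0 : 0 <= v ^+ N by rewrite exprn_ge0// ltW.
have vN1 : v ^+ N <= 1 by rewrite exprn_ile1// ltW.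
rewrite !hornerE; split.
- by rewrite exprn_ge0 ?subr_ge0//= exprn_ile1// ?subr_ge0// gerBl.
- move=> xa; have va : expR (- (theta * a)) <= v.
    by rewrite ler_expR lerN2 ler_wpM2l// ltW.
  (* 1 - t <= exp (- t), and exp (- u) <= 1 / u *)
  pose u := (2 * v) ^+ N.
  have u0 : 0 < u by rewrite exprn_gt0// mulr_gt0.
  have h1 : (1 - v ^+ N) ^+ (2 ^ N) <= expR (- u).
    have -> : - u = - v ^+ N *+ (2 ^ N).
      by rewrite /u exprMn mulNrn -[in RHS]mulr_natl natrX.
    rewrite -mulr_natl expRM_natl; apply: lerXn2r; rewrite ?nnegrE ?subr_ge0//.
    exact: expR_ge1Dx.
  have h2 : expR (- u) <= u^-1.
    rewrite expRN lef_pV2 ?posrE ?expR_gt0//.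
    by have := expR_ge1Dx u; lra.
  apply: (le_trans h1); apply: (le_trans h2); apply: le_trans r'N.
  rewrite /u -exprVn; apply: lerXn2r; rewrite ?nnegrE//.
    by rewrite invr_ge0 mulr_ge0// ltW.
  by rewrite lef_pV2 ?posrE ?mulr_gt0// ler_pM2l.
- move=> bx; have vb : v <= expR (- (theta * b)).
    by rewrite ler_expR lerN2 ler_wpM2l// ltW.
  have := @bernoulli_ineq _ (v ^+ N) (2 ^ N); rewrite vN0 vN1 => /(_ isT).
  apply: le_trans; rewrite lerD2l lerN2 natrX -exprMn.
  apply: le_trans rN; apply: lerXn2r; rewrite ?nnegrE// ?mulr_ge0// ?(ltW v0)//.
  by rewrite /r ler_pM2l.
Qed.

Lemma cvg_sum_seq {R : realType} (I : Type) (r : seq I) (f : I -> nat -> R)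
    (l : I -> R) : (forall i, f i @ \oo --> l i) ->
  (fun n => \sum_(i <- r) f i n) @ \oo --> \sum_(i <- r) l i.
Proof.
move=> fl; elim: r => [|i r IH].
  by under eq_fun do rewrite big_nil; rewrite big_nil; exact: cvg_cst.
by under eq_fun do rewrite big_cons; rewrite big_cons; exact: cvgD.
Qed.

Section laplace_to_tail.
Context {R : realType} {d : measure_display} {T : measurableType d}.
Variables (Pr : probability T R) (mu : probability (measurableTypeR R) R)
  (X : nat -> T -> R).
Hypotheses (mX : forall n, measurable_fun [set: T] (X n))
  (X_ge0 : forall n w, 0 <= X n w)
  (laplace : forall s : R, 0 < s ->
    (fun n => \int[Pr]_w expR (- (s * X n w / 2))) @ \oo -->
    \int[mu]_x expR (- (s * Num.max x 0 / 2))).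

Let bm_exp d' (S : measurableType d') (Y : S -> R) (s : R) :
  measurable_fun [set: S] Y -> (forall w, 0 <= Y w) -> 0 <= s ->
  bmfun (fun w => expR (- (s * Y w))).
Proof.
move=> mY Y0 s0; apply: (bmfun_continuous_comp (@continuous_expR R)).
  by apply: measurableT_comp => //; apply: measurable_funM.
exists 1 => w; rewrite ger0_norm ?expR_ge0// -[leRHS]expR0 ler_expR oppr_le0.
by rewrite mulr_ge0.
Qed.

Let mmax : measurable_fun [set: measurableTypeR R] (fun x : R => Num.max x 0).
Proof. exact: measurable_maxr. Qed.

Let max0 (x : R) : 0 <= Num.max x 0. Proof. by rewrite le_max lexx orbT. Qed.

(** Powers of exp (- theta x) are exponentials of the same kind, so convergence of
    Laplace transforms passes to polynomials in exp (- theta x). *)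
Lemma laplace_poly (theta : R) (p : {poly R}) : 0 < theta ->
  (fun n => \int[Pr]_w p.[expR (- (theta * X n w))]) @ \oo -->
  \int[mu]_x p.[expR (- (theta * Num.max x 0))].
Proof.
move=> theta0.
have expand d' (S : measurableType d') (Q : probability S R) (Y : S -> R) :
    measurable_fun [set: S] Y -> (forall w, 0 <= Y w) ->
    \int[Q]_w p.[expR (- (theta * Y w))] =
    \sum_(i < size p) p`_i * \int[Q]_w expR (- (theta * i%:R * Y w)).
  move=> mY Y0.
  have mi (i : 'I_(size p)) : bmfun (fun w => expR (- (theta * i%:R * Y w))).
    by apply: bm_exp => //; rewrite mulr_ge0// ltW.
  under eq_bigr do rewrite -RintegralZb//.
  rewrite -Rintegral_sumb; last by move=> i; exact: bmfunZ.
  congr Rintegral; apply/funext => w; rewrite horner_coef.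
  apply: eq_bigr => i _; rewrite -expRM_natl; congr (_ * expR _).
  by ring.
under eq_fun do rewrite expand//.
rewrite expand//; apply: cvg_sum_seq => i.
apply: cvgMl_tmp; case: (posnP i) => [i0|i0].
  rewrite i0 mulr0.
  have -> : (fun n => \int[Pr]_w expR (- (0 * X n w))) = fun=> 1.
    apply/funext => n; rewrite -[RHS](Rintegral_cstb Pr).
    by congr Rintegral; apply/funext => w; rewrite mul0r oppr0 expR0.
  have -> : \int[mu]_x expR (- (0 * Num.max x 0)) = 1.
    rewrite -[RHS](Rintegral_cstb mu).
    by congr Rintegral; apply/funext => w; rewrite mul0r oppr0 expR0.
  exact: cvg_cst.
have s0 : 0 < 2 * (theta * i%:R) by rewrite !mulr_gt0// ltr0n.
have E d' (S : measurableType d') (Q : probability S R) (Y : S -> R) :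
    \int[Q]_w expR (- (theta * i%:R * Y w)) =
    \int[Q]_w expR (- (2 * (theta * i%:R) * Y w / 2)).
  by congr Rintegral; apply/funext => w; congr (expR (- _)); field.
by under eq_fun do rewrite E; rewrite E; exact: laplace.
Qed.

Let tail (x : R) : R := fine (mu `]x, +oo[%classic).

Let tail_left (c e : R) : 0 < c -> mu [set c] = 0%E -> 0 < e ->
  exists2 a, 0 < a < c & tail a <= tail c + e.
Proof.
move=> c0 muc e0.
pose F n : set (measurableTypeR R) := `](c - c / n.+2%:R), +oo[%classic.
have mF n : measurable (F n) by exact: measurable_itv.
have capF : \bigcap_n F n = [set c] `|` `]c, +oo[%classic.
  apply/seteqP; split => [x Fx|x [->|xc] n _]; last 2 first.
  - by rewrite /F/= in_itv/= andbT gtrBl divr_gt0.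
  - move: xc; rewrite /F/= !in_itv/= !andbT; apply: le_lt_trans.
    by rewrite gerBl divr_ge0// ltW.
  have [xc|cx|->] := ltgtP x c; [exfalso|right|by left].
    have [n xn] : exists n, x <= c - c / n.+2%:R.
      have cx0 : 0 < (c - x) / c by rewrite divr_gt0// subr_gt0.
      have [n] := ltr_add_invr cx0; rewrite add0r => nx.
      exists n; rewrite lerBrDl -lerBrDr -ler_pdivlMl// mulrC.
      apply: le_trans (ltW nx); rewrite lef_pV2 ?posrE//.
      by rewrite ler_nat.
    by have := Fx n I; rewrite /F/= in_itv/= andbT ltNge xn.
  by rewrite /= in_itv/= andbT.
have Fc : mu \o F @ \oo --> mu (\bigcap_n F n).
  apply: nonincreasing_cvg_mu.
  - by apply: le_lt_trans (ltry 1); exact: probability_le1 (mF 0%N).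
  - exact: mF.
  - by rewrite capF; exact: measurableU.
  - move=> n m nm; rewrite subsetEset => x; rewrite /F/= !in_itv/= !andbT.
    apply: le_lt_trans; rewrite lerD2l lerN2 ler_pM2l// lef_pV2 ?posrE//.
    by rewrite ler_nat.
have capE : mu (\bigcap_n F n) = mu `]c, +oo[%classic.
  rewrite capF measureU//.
    by rewrite [X in (X + _)%E](_ : _ = 0%E) ?add0e//; exact: muc.
  by apply/seteqP; split => // x [-> /=]; rewrite in_itv/= ltxx.
have fc : fine \o (mu \o F) @ \oo --> tail c.
  by apply: fine_cvg; rewrite /tail fineK ?fin_num_measure// -capE.
move/cvgrPdist_lt : fc => /(_ e e0)[n _ /(_ n (leqnn n))]/= fn.
exists (c - c / n.+2%:R).
  rewrite gtrBl divr_gt0// andbT subr_gt0 ltr_pdivrMr// ltr_pMr//.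
  by rewrite ltr1n.
by move: fn; rewrite ltr_norml /tail => /andP[+ _]; rewrite /F; lra.
Qed.

Let tail_right (c e : R) : 0 < e -> exists2 b, c < b & tail c - e <= tail b.
Proof.
move=> e0; pose F n : set (measurableTypeR R) := `](c + n.+1%:R^-1), +oo[%classic.
have mF n : measurable (F n) by exact: measurable_itv.
have cupF : \bigcup_n F n = `]c, +oo[%classic.
  apply/seteqP; split => x /=.
    move=> [n _]; rewrite /F/= !in_itv/= !andbT; apply: lt_trans.
    by rewrite ltrDl invr_gt0.
  rewrite in_itv/= andbT => cx; have [n cnx] := ltr_add_invr cx.
  by exists n => //; rewrite /F/= in_itv/= andbT.
have Fc : mu \o F @ \oo --> mu (\bigcup_n F n).
  apply: nondecreasing_cvg_mu => //; first by rewrite cupF.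
  move=> n m nm; rewrite subsetEset => x; rewrite /F/= !in_itv/= !andbT.
  by apply: le_lt_trans; rewrite lerD2l lef_pV2 ?posrE// ler_nat.
have fc : fine \o (mu \o F) @ \oo --> tail c.
  by apply: fine_cvg; rewrite /tail fineK ?fin_num_measure// -cupF.
move/cvgrPdist_lt : fc => /(_ e e0)[n _ /(_ n (leqnn n))]/= fn.
exists (c + n.+1%:R^-1); first by rewrite ltrDl invr_gt0.
by move: fn; rewrite ltr_norml /tail => /andP[_ +]; rewrite /F; lra.
Qed.

Let Pr_tail n c : fine (Pr [set w | c < X n w]) =
  \int[Pr]_w \1_[set w | c < X n w] w.
Proof.
rewrite Rintegral_indicb//.
have -> : [set w | c < X n w] = X n @^-1` `]c, +oo[%classic.
  by apply/seteqP; split => w /=; rewrite in_itv/= andbT.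
by rewrite -[X in measurable X]setTI; exact: mX.
Qed.

Let mXc n c : measurable [set w | c < X n w].
Proof.
have -> : [set w | c < X n w] = X n @^-1` `]c, +oo[%classic.
  by apply/seteqP; split => w /=; rewrite in_itv/= andbT.
by rewrite -[X in measurable X]setTI; exact: mX.
Qed.

(** The indicator of the half-line beyond c is squeezed between two smooth steps, one
    rising just before c and one just after; without an atom at c the
    two limits are close. *)
Lemma cvg_tail (c : R) : 0 < c -> mu [set c] = 0%E ->
  (fun n => fine (Pr [set w | c < X n w])) @ \oo --> tail c.
Proof.
move=> c0 muc; apply/cvgrPdist_le => e e0.
pose e' := e / 5; have e'0 : 0 < e' by rewrite divr_gt0.
have budget (A I1 I2 J1 J2 ta tb tc : R) : A <= I1 + e' -> I2 - e' <= A ->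
    - e' <= J1 - I1 -> J2 - I2 <= e' -> J1 <= ta + e' -> tb - e' <= J2 ->
    ta <= tc + e' -> tc - e' <= tb -> - e <= tc - A <= e.
  by rewrite /e' => ? ? ? ? ? ? ? ?; apply/andP; split; lra.
have mG d' (S : measurableType d') (Y : S -> R) theta (p : {poly R}) :
    measurable_fun [set: S] Y -> (forall w, 0 <= Y w) ->
    (forall x, 0 <= x -> 0 <= p.[expR (- (theta * x))] <= 1) ->
    bmfun (fun w => p.[expR (- (theta * Y w))]).
  move=> mY Y0 p01; split; last first.
    exists 1 => w; have /andP[p0 p1] := p01 _ (Y0 w).
    by rewrite ger0_norm.
  apply: (@measurableT_comp _ _ _ _ _ _ (fun v => p.[v])).
    by apply: continuous_measurable_fun; exact: continuous_horner.
  by apply: measurableT_comp => //; apply: measurableT_comp => //; exact: measurable_funM.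
have [a ac tail_a] := tail_left c0 muc e'0.
have [b cb tail_b] := tail_right c e'0.
have cb' : 0 < c < b by rewrite c0.
have [th1 [p1 [th10 P1]]] := smooth_step ac e'0.
have [th2 [p2 [th20 P2]]] := smooth_step cb' e'0.
have p101 x : 0 <= x -> 0 <= p1.[expR (- (th1 * x))] <= 1.
  by move=> /P1[].
have p201 x : 0 <= x -> 0 <= p2.[expR (- (th2 * x))] <= 1.
  by move=> /P2[].
have L1 := @laplace_poly _ p1 th10; have L2 := @laplace_poly _ p2 th20.
have mitv (x : R) : measurable (`]x, +oo[%classic : set (measurableTypeR R)) by [].
have lim1 : \int[mu]_x p1.[expR (- (th1 * Num.max x 0))] <= tail a + e'.
  have -> : tail a + e' = \int[mu]_x (\1_(`]a, +oo[%classic) x + e').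
    rewrite RintegralDb; [|exact: bmfun_indic|exact: bmfun_cst].
    by rewrite Rintegral_indicb// Rintegral_cstb.
  apply: le_Rintegralb; first exact: mG.
    by apply: bmfunD; [exact: bmfun_indic|exact: bmfun_cst].
  move=> x; have [/andP[q0 q1] qa _] := P1 _ (max0 x).
  rewrite indicE; case: (boolP (x \in _)) => [_|].
    by rewrite (le_trans q1)//= lerDl ltW.
  rewrite notin_setE/= in_itv/= andbT => /negP; rewrite -leNgt => xa.
  rewrite add0r; apply: qa; rewrite ge_max xa/=.
  by move: ac => /andP[/ltW].
have lim2 : tail b - e' <= \int[mu]_x p2.[expR (- (th2 * Num.max x 0))].
  have -> : tail b - e' = \int[mu]_x (\1_(`]b, +oo[%classic) x - e').
    rewrite RintegralBb; [|exact: bmfun_indic|exact: bmfun_cst].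
    by rewrite Rintegral_indicb// Rintegral_cstb.
  apply: le_Rintegralb; last 1 first.
  - move=> x; have [/andP[q0 q1] _ qb] := P2 _ (max0 x).
    rewrite indicE; case: (boolP (x \in _)) => [|_]; last first.
      by rewrite (le_trans _ q0)//= sub0r oppr_le0 ltW.
    rewrite inE/= in_itv/= andbT => bx.
    by have := qb _; rewrite le_max (ltW bx)/= => /(_ isT).
  - by apply: bmfunB; [exact: bmfun_indic|exact: bmfun_cst].
  - exact: mG.
move/cvgrPdist_le : L1 => /(_ e' e'0)[N1 _ L1].
move/cvgrPdist_le : L2 => /(_ e' e'0)[N2 _ L2].
exists (maxn N1 N2) => // n; rewrite /= geq_max => /andP[/L1 l1 /L2 l2].
move: l1 l2; rewrite /= !ler_norml => /andP[l1 _] /andP[_ l2].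
have up : fine (Pr [set w | c < X n w]) <=
    \int[Pr]_w p1.[expR (- (th1 * X n w))] + e'.
  rewrite Pr_tail -[X in _ + X](Rintegral_cstb Pr) -RintegralDb; last 2 first.
  - exact: mG.
  - exact: bmfun_cst.
  apply: le_Rintegralb; first exact: bmfun_indic.
    by apply: bmfunD; [exact: mG|exact: bmfun_cst].
  move=> w; have [/andP[q0 q1] _ qc] := P1 _ (X_ge0 n w).
  rewrite indicE; case: (boolP (w \in _)) => [|_]; last first.
    by rewrite /= addr_ge0// ltW.
  by rewrite inE/= => /ltW/qc; rewrite lerBlDr.
have lo : \int[Pr]_w p2.[expR (- (th2 * X n w))] - e' <=
    fine (Pr [set w | c < X n w]).
  rewrite Pr_tail -[X in _ - X](Rintegral_cstb Pr) -RintegralBb; last 2 first.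
  - exact: mG.
  - exact: bmfun_cst.
  apply: le_Rintegralb; last 1 first.
  - move=> w; have [/andP[q0 q1] qc _] := P2 _ (X_ge0 n w).
    rewrite indicE; case: (boolP (w \in _)) => [_|].
      by rewrite lerBlDr (le_trans q1)//= lerDl ltW.
    rewrite notin_setE/= => /negP; rewrite -leNgt => /qc.
    by rewrite lerBlDr add0r.
  - by apply: bmfunB; [exact: mG|exact: bmfun_cst].
  - exact: bmfun_indic.
exact: (budget _ _ _ _ _ _ _ _ up lo l1 l2 lim1 lim2 tail_a tail_b).
Qed.

End laplace_to_tail.

(** * Inverse square roots of positive definite matrices *)

(** Lagrange interpolation: on finitely many points, any function is a polynomial. *)
Lemma interpolation {F : fieldType} (s : seq F) (f : F -> F) :
  exists p : {poly F}, forall x, x \in s -> p.[x] = f x.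
Proof.
elim: s => [|y s [p pf]]; first by exists 0.
have [ys|ys] := boolP (y \in s).
  by exists p => x; rewrite inE => /orP[/eqP ->|]; exact: pf.
pose w := \prod_(z <- s) ('X - z%:P).
have wy : w.[y] != 0 by rewrite -/(root w y) root_prod_XsubC.
exists (p + ((f y - p.[y]) / w.[y]) *: w) => x.
rewrite hornerD hornerZ inE => /orP[/eqP ->|xs].
  by rewrite divfK// addrC subrK.
have /rootP -> : root w x by rewrite root_prod_XsubC.
by rewrite mulr0 addr0 pf.
Qed.

Lemma trmx_horner_mx {R : comNzRingType} n (A : 'M[R]_n.+1) (p : {poly R}) :
  A^T = A -> (horner_mx A p)^T = horner_mx A p.
Proof.
move=> AT; elim/poly_ind: p => [|p c IH]; first by rewrite rmorph0 trmx0.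
rewrite rmorphD rmorphM/= horner_mx_X horner_mx_C linearD/= tr_scalar_mx.
rewrite trmx_mul AT IH; congr (_ + _).
exact/esym/comm_horner_mx.
Qed.

Section spectral.
Context {R : realType} {n : nat}.
Variable A : 'M[R]_n.+1.
Hypothesis Apos : sym_posdef A.

Let toC := real_complex R.
Let Ac := map_mx toC A.
Let Re (v : 'rV[R[i]]_n.+1) := map_mx (@complex.Re R) v.
Let Im (v : 'rV[R[i]]_n.+1) := map_mx (@complex.Im R) v.

Let Re_mul (v : 'rV[R[i]]_n.+1) : Re (v *m Ac) = Re v *m A.
Proof.
apply/rowP => j; rewrite !mxE.
rewrite (big_morph (@complex.Re R) (id1 := 0) (op1 := +%R))//; last first.
  by move=> [a b] [c e].
by apply: eq_bigr => k _; rewrite !mxE; case: (v 0 k) => a b /=; rewrite mulr0 subr0.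
Qed.

Let Im_mul (v : 'rV[R[i]]_n.+1) : Im (v *m Ac) = Im v *m A.
Proof.
apply/rowP => j; rewrite !mxE.
rewrite (big_morph (@complex.Im R) (id1 := 0) (op1 := +%R))//; last first.
  by move=> [a b] [c e].
by apply: eq_bigr => k _; rewrite !mxE; case: (v 0 k) => a b /=; rewrite mulr0 add0r.
Qed.

Let real_eigenvalue_gt0 (l : R) (v : 'rV[R]_n.+1) :
  v != 0 -> v *m A = l *: v -> 0 < l.
Proof.
move=> v0 vA; have [_ /(_ v v0)] := Apos.
rewrite vA -scalemxAl mxE => h.
have vv0 : 0 <= (v *m v^T) 0 0.
  by rewrite mxE sumr_ge0// => i _; rewrite mxE -expr2 sqr_ge0.
rewrite ltNge; apply/negP => l0.
by move: h; rewrite ltNge => /negP; apply; exact: mulr_le0_ge0.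
Qed.

(** A real symmetric matrix is diagonalisable over the complex numbers with real
    eigenvalues; the real or the imaginary part of a complex eigenvector is a real
    eigenvector, so the eigenvalues are positive. *)
Lemma posdef_spectrum : exists2 s : seq R, (forall x, x \in s -> 0 < x) &
  forall p : {poly R}, (forall x, x \in s -> p.[x] = 0) -> horner_mx A p = 0.
Proof.
have [AT _] := Apos.
have Asym : Ac \is symmetricmx.
  apply/is_hermitianmxP; rewrite expr0 scale1r map_mx_id//.
  by apply/matrixP => i j; rewrite !mxE -{1}AT mxE.
have Areal : Ac \is a mxOver Num.real.
  by apply/mxOverP => i j; rewrite mxE complex_real.
have Aherm := realsym_hermsym Asym Areal.
have /orthomx_spectralP Adiag := symmetric_normalmx Asym Areal.
set P := spectralmx Ac in Adiag; set D := spectral_diag Ac in Adiag.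
have Punit : P \in unitmx by exact: spectral_unit.
have Dreal j : toC (complex.Re (D 0 j)) = D 0 j.
  apply: RRe_real.
  by have /mxOverP/(_ 0 j) := hermitian_spectral_diag_real Aherm.
exists [seq complex.Re (D 0 j) | j : 'I_n.+1] => [x /mapP[j _ ->]|p ps].
  set l := complex.Re _; pose v := row j P.
  have vA : v *m Ac = toC l *: v.
    rewrite /v -row_mul [in LHS]Adiag !mulmxA mulmxV// mul1mx row_mul row_diag_mx.
    by rewrite -scalemxAl -rowE Dreal.
  have ReA : Re v *m A = l *: Re v.
    rewrite -Re_mul vA; apply/rowP => i; rewrite !mxE.
    by case: (P j i) => a b /=; rewrite mul0r subr0.
  have ImA : Im v *m A = l *: Im v.
    rewrite -Im_mul vA; apply/rowP => i; rewrite !mxE.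
    by case: (P j i) => a b /=; rewrite mul0r addr0.
  have [Rv0|Rv0] := eqVneq (Re v) 0; last exact: real_eigenvalue_gt0 ReA.
  apply: real_eigenvalue_gt0 ImA; apply/negP => /eqP Iv0.
  have v0 : v = 0.
    apply/rowP => i; have /rowP/(_ i) := Rv0; have /rowP/(_ i) := Iv0.
    by rewrite !mxE; case: (P j i) => a b /= -> ->.
  have : row j (P *m invmx P) = 0 by rewrite row_mul -/v v0 mul0mx.
  rewrite mulmxV// row1 => /rowP/(_ j); rewrite !mxE !eqxx => /eqP.
  by rewrite oner_eq0.
apply/(map_mx_inj (f := toC)); rewrite map_horner_mx map_mx0 -/Ac Adiag.
rewrite horner_mx_uconjC// horner_mx_diag.
rewrite (_ : map_mx _ D = 0) ?linear0 ?mulmx0 ?mul0mx//.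
apply/rowP => j; rewrite !mxE -Dreal horner_map ps ?rmorph0//.
by apply/mapP; exists j; rewrite ?mem_enum.
Qed.

(** The fourth root of the inverse is a polynomial in A, hence symmetric and
    invertible; its square is positive definite. *)
Lemma posdef_inv_sqrt : A \in unitmx /\ exists S : 'M[R]_n.+1,
  sym_posdef S /\ S *m S = invmx A.
Proof.
have [s s0 sA] := posdef_spectrum; have [AT _] := Apos.
have [r rs] := interpolation s (fun x => Num.sqrt (Num.sqrt x^-1)).
pose B := horner_mx A r.
have BT : B^T = B by exact: trmx_horner_mx.
have B4 : B *m B *m (B *m B) *m A = 1%:M.
  have : horner_mx A (r * r * (r * r) * 'X - 1) = 0.
    apply: sA => x xs.
    have x4 : r.[x] * r.[x] * (r.[x] * r.[x]) = x^-1.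
      by rewrite rs// -!expr2 !sqr_sqrtr ?sqrtr_ge0 ?invr_ge0 ?(ltW (s0 _ xs)).
    by rewrite hornerD hornerN !hornerM hornerX hornerC x4 mulVf ?subrr// gt_eqF// s0.
  by rewrite rmorphB !rmorphM/= horner_mx_X rmorph1 => /eqP; rewrite subr_eq0 => /eqP.
have Binv : B *m (B *m (B *m (B *m A))) = 1%:M by rewrite -B4 !mulmxA.
have Bunit : B \in unitmx by have [] := mulmx1_unit Binv.
have [_ Aunit] := mulmx1_unit B4.
split => //; exists (B *m B); split; last first.
  by rewrite -[LHS](mulmxK Aunit) B4 mul1mx.
split; first by rewrite trmx_mul BT.
move=> v v0; rewrite mulmxA -mulmxA -{2}BT -trmx_mul.
have w0 : v *m B != 0.
  by apply: contra_neq v0 => w0; rewrite -(mulmxK Bunit v) w0 mul0mx.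
rewrite mxE lt_neqAle eq_sym; apply/andP; split; last first.
  by rewrite sumr_ge0// => i _; rewrite [X in _ * X]mxE -expr2 sqr_ge0.
apply: contra_neq w0 => h; apply/rowP => i; rewrite [RHS]mxE.
apply/eqP; rewrite -sqrf_eq0 expr2; apply/eqP.
have := psumr_eq0P _ h; rewrite -[X in _ * X](mxE trmx_key (fun i j => (v *m B) j i)).
by apply => // k _; rewrite [X in _ * X]mxE -expr2 sqr_ge0.
Qed.

(** From S S = A^-1: S (S A) = 1, hence (S A) S = 1. *)
Lemma inv_sqrtmxP : let S := inv_sqrtmx A in S^T = S /\ S *m A *m S = 1%:M.
Proof.
move=> S.
have [Aunit exS] := posdef_inv_sqrt.
have [[ST _] SS] : sym_posdef S /\ S *m S = invmx A.
  exact: (@xgetPex _ 0 [set S | sym_posdef S /\ S *m S = invmx A] exS).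
split=> //.
have SSA : S *m (S *m A) = 1%:M by rewrite mulmxA SS mulVmx.
exact: mulmx1C.
Qed.

End spectral.

(** * Continuous conditional distribution functions *)

Section cond_cdf_facts.
Context {R : realType} {d : nat}.
Variables (K : R.-pker (covariate R d) ~> R) (z : covariate R d).
Hypotheses (K01 : K z `[0, 1]%classic = 1%E)
  (cF : continuous (fun t => cond_cdf K t z)).
Local Notation F := (cond_cdf K ^~ z).

Let mitv (i : interval R) : measurable [set` i]. Proof. exact: measurable_itv. Qed.

Let fin_K (A : set R) : measurable A -> K z A \is a fin_num.
Proof.
move=> mA; rewrite ge0_fin_numE//; apply: le_lt_trans (ltry 1).
rewrite -(@prob_kernel _ _ _ _ _ K z).
by apply: le_measure; rewrite ?inE.
Qed.

Let fineE (A : set R) (x : R) : measurable A -> fine (K z A) = x -> K z A = x%:E.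
Proof. by move=> mA <-; rewrite fineK ?fin_K. Qed.

Lemma cond_cdf_ge0 t : 0 <= F t.
Proof. by rewrite /cond_cdf fine_ge0. Qed.

Lemma cond_cdf_le1 t : F t <= 1.
Proof.
rewrite -lee_fin /cond_cdf fineK ?fin_K//; apply: le_trans (_ : K z setT <= 1)%E.
  by apply: le_measure; rewrite ?inE.
by rewrite prob_kernel.
Qed.

Lemma cond_cdf_homo : {homo F : s t / s <= t}.
Proof.
move=> s t st; rewrite /cond_cdf fine_le ?fin_K//.
by apply: le_measure; rewrite ?inE//; exact: subitvPr.
Qed.

Let out01 (A : set R) : measurable A -> A `&` `[0, 1]%classic = set0 -> K z A = 0%E.
Proof.
pose I01 : set R := `[0, 1]%classic.
move=> mA A0; have : (K z (A `|` I01) <= 1)%E.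
  apply: le_trans (_ : K z setT <= 1)%E; last by rewrite prob_kernel.
  by apply: le_measure; rewrite ?inE//; apply: measurableU => //; exact: mitv.
rewrite measureU//; last exact: mitv.
rewrite [X in (_ + X)%E]K01 -[leRHS]add0e leeD2rE// => KA.
by apply/eqP; rewrite eq_le KA measure_ge0.
Qed.

Lemma cond_cdf1 t : 1 <= t -> F t = 1.
Proof.
move=> t1; apply/eqP; rewrite eq_le cond_cdf_le1/= -lee_fin /cond_cdf fineK ?fin_K//.
rewrite -K01; apply: le_measure; rewrite ?inE// => y /=.
by rewrite !in_itv/= => /andP[_ y1]; exact: le_trans t1.
Qed.

Lemma cond_cdf0 : F 0 = 0.
Proof.
apply/eqP; rewrite eq_le cond_cdf_ge0 andbT.
have F_lt0 t : t < 0 -> F t = 0.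
  move=> t0; rewrite /cond_cdf out01//; apply/seteqP; split => // y /=.
  rewrite !in_itv/= => -[yt /andP[y0 _]].
  by have := le_lt_trans (le_trans y0 yt) t0; rewrite ltxx.
apply/ler_addgt0Pr => e e0; rewrite add0r.
have /cvgrPdist_lt/(_ e e0) := @cF 0.
rewrite near_simpl => /nbhs_ballP[r /= r0 near0].
have r20 : 0 < r / 2 by rewrite divr_gt0.
have := near0 (- (r / 2)); rewrite /ball/= sub0r opprK gtr0_norm//.
rewrite ltr_pdivrMr// ltr_pMr// ltr1n => /(_ isT).
rewrite (F_lt0 (- (r / 2))) ?oppr_lt0// subr0 => /ltW; apply: le_trans; exact: ler_norm.
Qed.

Lemma cond_cdf_onto u : 0 <= u <= 1 -> exists2 t, t \in `[0, 1] & F t = u.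
Proof.
move=> u01; have FT : {within `[0, 1], continuous F}.
  exact: continuous_subspaceT.
have [|t t01 Ft] := @IVT R F 0 1 u ler01 FT; last by exists t.
by rewrite cond_cdf0 cond_cdf1// minElt maxElt ltr01.
Qed.

Let measurable_F : measurable_fun setT F.
Proof. exact: continuous_measurable_fun. Qed.

Lemma cond_cdf_lt u : 0 < u <= 1 -> K z [set t | F t < u] = u%:E.
Proof.
move=> /andP[u0 u1].
have mFu : measurable [set t | F t < u].
  rewrite (_ : [set _ | _] = F @^-1` `]-oo, u[%classic).
    by rewrite -[X in measurable X]setTI; exact: measurable_F.
  by apply/seteqP; split => t /=; rewrite in_itv.
apply/eqP; rewrite eq_le; apply/andP; split.
  have [|c c01 Fc] := @cond_cdf_onto u; first by rewrite (ltW u0) u1.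
  rewrite -[leRHS](fineE (mitv `]-oo, c]) Fc).
  apply: le_measure; rewrite ?inE// => t /= Ftu; rewrite in_itv/= leNgt.
  by apply/negP => /ltW/cond_cdf_homo; rewrite Fc leNgt Ftu.
rewrite -[leRHS]fineK ?fin_K// lee_fin.
apply/ler_addgt0Pr => e e0; rewrite -lerBlDr.
have [ue|ue] := leP (u - e) 0; first by rewrite (le_trans ue)// fine_ge0.
have [|c c01 Fc] := @cond_cdf_onto (u - e).
  by rewrite (ltW ue) (le_trans _ u1)// gerBl ltW.
rewrite -lee_fin fineK ?fin_K// -(fineE (mitv `]-oo, c]) Fc).
apply: le_measure; rewrite ?inE// => t /=; rewrite in_itv/= => /cond_cdf_homo.
by move/le_lt_trans; apply; rewrite Fc gtrBl.
Qed.

(** The probability integral transform. F need not be injective, but it is onto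
    [0, 1] by continuity, so the law of F(Y) is right on half-lines. *)
Lemma cond_cdf_uniform (B : set R) : measurable B ->
  K z (F @^-1` B) = uniform_prob (@ltr01 R) B.
Proof.
move=> mB.
have ray u : K z (F @^-1` `]-oo, u[%classic) =
    uniform_prob (@ltr01 R) `]-oo, u[%classic.
  have uE : F @^-1` `]-oo, u[%classic = [set t | F t < u].
    by apply/seteqP; split => t /=; rewrite in_itv.
  have unifE : uniform_prob (@ltr01 R) `]-oo, u[%classic =
      lebesgue_measure (`[0, 1] `&` `]-oo, u[%classic).
    have mind : measurable_fun [set: measurableTypeR R]
        (EFin \o (\1_(`]-oo, u[%classic : set R) : R -> R)).
      by apply/measurable_EFinP; exact: measurable_indic.
    have := integral_uniform (@ltr01 R) mind; rewrite !integral_indic// => h.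
    have -> : uniform_prob (@ltr01 R) `]-oo, u[%classic =
      uniform_prob (@ltr01 R) (`]-oo, u[%classic `&` setT) by rewrite setIT.
    by rewrite h ?subr0 ?invr1 ?mul1e 1?setIC// => x; rewrite lee_fin.
  rewrite uE unifE; have [u0|u0] := leP u 0.
    rewrite (_ : [set t | F t < u] = set0).
      rewrite (_ : _ `&` _ = set0) ?measure0//; apply/seteqP; split => // t /=.
      rewrite !in_itv/= => -[/andP[t0 _]] /lt_le_trans/(_ u0).
      by rewrite ltNge t0.
    apply/seteqP; split => // t /= /lt_le_trans/(_ u0).
    by rewrite ltNge cond_cdf_ge0.
  have [u1|u1] := leP u 1.
    rewrite cond_cdf_lt ?u0//.
    rewrite (_ : _ `&` _ = `[0, u[%classic).
      by rewrite lebesgue_measure_itv/= lte_fin u0 sube0.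
    apply/seteqP; split => t /=; rewrite !in_itv/=.
      by move=> [/andP[-> _]].
    by move=> /andP[-> tu]; rewrite tu (le_trans (ltW tu)).
  rewrite (_ : [set t | F t < u] = setT).
    rewrite prob_kernel (_ : _ `&` _ = `[0, 1]%classic).
      by rewrite lebesgue_measure_itv/= lte_fin ltr01 sube0.
    apply/seteqP; split => t /=; rewrite !in_itv/=; first by case.
    by move=> /andP[t0 t1]; rewrite t0 t1 (le_lt_trans t1).
  by apply/seteqP; split => // t _ /=; rewrite (le_lt_trans (cond_cdf_le1 t)).
have uniq := @measure_unique _ R (measurableTypeR R) (@RGenInftyO.G R)
  (fun n => `]-oo, n%:R[%classic).
rewrite -[LHS]/(pushforward (K z) (F : R -> measurableTypeR R) B).
apply: uniq => //.
- exact: RGenInftyO.measurableE.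
- move=> _ _ [x ->] [y ->]; exists (Num.min x y).
  apply/seteqP; split => t /=; rewrite !in_itv/= lt_min; first by move=> [-> ->].
  by move=> /andP[].
- by move=> n; exists n%:R.
- apply/seteqP; split => // x _; exists (Num.truncn x).+1 => //=.
  by rewrite in_itv/= truncnS_gt.
- by move=> _ [u ->]; exact: ray.
- move=> n; rewrite -[ltLHS]/(K z (F @^-1` `]-oo, n%:R[%classic)) ray.
  by apply: le_lt_trans (ltry 1); exact: probability_le1.
Qed.

(** The infimum defining the quantile is attained and hit exactly, by continuity. *)
Lemma cond_quantileP tau (a := cond_quantile K tau z) : 0 < tau < 1 ->
  [/\ 0 <= a <= 1, F a = tau & forall t, t \in `[0, 1] -> t < a -> F t < tau].
Proof.
move=> /andP[tau0 tau1].
pose Q := [set t | t \in `[0, 1] /\ tau <= F t].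
have Q0 : has_inf Q.
  split; last by exists 0 => t [/=]; rewrite in_itv/= => /andP[].
  by exists 1; split; rewrite ?in_itv/= ?lexx ?ler01// cond_cdf1// ltW.
have Qlb t : t \in `[0, 1] -> t < a -> F t < tau.
  move=> t01 ta; rewrite ltNge; apply/negP => tauF.
  have := ge_inf (proj2 Q0) (conj t01 tauF : Q t).
  by rewrite leNgt -/a ta.
have [|c c01 Fc] := @cond_cdf_onto tau; first by rewrite !ltW.
have ac : a <= c by apply: (ge_inf (proj2 Q0)); split => //; rewrite Fc.
have a0 : 0 <= a.
  apply: lb_le_inf; first by case: Q0.
  by move=> t [/=]; rewrite in_itv/= => /andP[].
have a1 : a <= 1 by rewrite (le_trans ac)//; move: c01; rewrite in_itv => /andP[].
split; rewrite ?a0 ?a1//; apply/eqP; rewrite eq_le; apply/andP; split.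
  by rewrite -Fc cond_cdf_homo.
apply/ler_addgt0Pr => e e0.
have /cvgrPdist_lt/(_ e e0) := @cF a.
rewrite near_simpl => /nbhs_ballP[r /= r0 neara].
have [t [t01 tauF] tar] := inf_adherent r0 Q0.
have at_ : a <= t by apply: (ge_inf (proj2 Q0)).
have : `|F a - F t| < e.
  apply: neara; rewrite /ball/= distrC ger0_norm ?subr_ge0//.
  by rewrite ltrBlDl.
rewrite ltr_norml => /andP[+ _]; lra.
Qed.

End cond_cdf_facts.

(** * Conditional independence and the residuals *)

Lemma measurable_fine_comp {R : realType} {d} {T : measurableType d}
    (f : T -> \bar R) : (forall x, f x \is a fin_num) ->
  measurable_fun setT f -> measurable_fun setT (fun x => fine (f x)).
Proof.
move=> ffin mf; apply/measurable_EFinP.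
by apply: eq_measurable_fun mf => x _ /=; rewrite fineK.
Qed.

Lemma pker_fin_num {R : realType} {d d'} {X : measurableType d}
    {Y : measurableType d'} (K : R.-pker X ~> Y) x (A : set Y) :
  measurable A -> K x A \is a fin_num.
Proof.
move=> mA; rewrite ge0_fin_numE//; apply: le_lt_trans (ltry 1).
rewrite -(@prob_kernel _ _ _ _ _ K x).
by apply: le_measure; rewrite ?inE.
Qed.

Lemma measurable_cube {R : realType} {d : nat} :
  measurable (@cube R d).
Proof.
rewrite (_ : cube = box (fun _ : 'I_d => `[0, 1]%classic : set R)) //.
by apply: measurable_box => i; exact: measurable_itv.
Qed.

Section measurable_cond_cdf.
Context {R : realType} {d : nat}.
Variable K : R.-pker (covariate R d) ~> R.

(** K seen as a kernel from pairs, so that the graph condition t <= p.2 becomes a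
    section of a measurable set. *)
Definition kernel_fst (p : covariate R d * R) : {measure set R -> \bar R} :=
  K p.1.

Let measurable_kernel_fst U : measurable U ->
  measurable_fun setT (kernel_fst ^~ U).
Proof.
move=> mU; apply: (measurableT_comp (f := K ^~ U) _ measurable_fst).
exact: measurable_kernel.
Qed.

HB.instance Definition _ := isKernel.Build _ _ _ _ _ kernel_fst
  measurable_kernel_fst.

Let kernel_fst_prob p : kernel_fst p [set: R] = 1%E.
Proof. exact: prob_kernel. Qed.

HB.instance Definition _ := Kernel_isProbability.Build _ _ _ _ _
  kernel_fst kernel_fst_prob.

Lemma measurable_cond_cdf :
  measurable_fun setT (fun p : covariate R d * R => cond_cdf K p.2 p.1).
Proof.
pose A : set ((covariate R d * R) * R) := [set q | q.2 <= q.1.2].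
have mA : measurable A.
  have mdiff : measurable_fun setT
      (fun q : (covariate R d * R) * R => q.1.2 - q.2).
    apply: measurable_funB; last exact: measurable_snd.
    exact: (measurableT_comp measurable_snd measurable_fst).
  rewrite (_ : A = (fun q : (covariate R d * R) * R => q.1.2 - q.2) @^-1`
      `[0, +oo[%classic).
    by rewrite -[X in measurable X]setTI; exact: mdiff.
  by apply/seteqP; split => q; rewrite /A/= in_itv/= andbT subr_ge0.
have := measurable_fun_xsection_finite_kernel
  (kernel_fst : R.-pker (covariate R d * R) ~> R) (mem_set mA).
move=> mk; rewrite /cond_cdf.
apply: (eq_measurable_fun (fun p => fine (kernel_fst p (xsection A p)))).
  move=> p _; rewrite /kernel_fst; congr (fine (K p.1 _)).
  by apply/seteqP; split => t; rewrite /xsection/= inE /A/= in_itv.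
apply: measurable_fine_comp mk => p.
by apply: pker_fin_num; exact: measurable_xsection.
Qed.

End measurable_cond_cdf.

Section residual_independence.
Context {R : realType} {d : nat}.
Variables (P : probability (obs R d) R) (V V' : obs R d -> R)
  (K K' : R.-pker (covariate R d) ~> R).
Hypotheses (mV : measurable_fun setT V) (mV' : measurable_fun setT V')
  (Pcube : P [set w | cube w.2] = 1%E)
  (K'P : continuous_cond_law P V' K')
  (indep : forall A B : set R, measurable A -> measurable B ->
    cond_prob_version P [set w | A (V w) /\ B (V' w)]
      (fun z => fine (K z A) * fine (K' z B))).

Let mZ : measurable_fun [set: obs R d] (snd : obs R d -> covariate R d).
Proof. exact: measurable_snd. Qed.

Definition residual (w : obs R d) : R := cond_cdf K' (V' w) w.2.

Lemma measurable_residual : measurable_fun setT residual.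
Proof.
have mp : measurable_fun setT (fun w : obs R d => (w.2, V' w)).
  exact: measurable_fun_pair.
exact: (measurableT_comp (measurable_cond_cdf K') mp).
Qed.

Section fixed_event.
Variable A : set R.
Hypothesis mA : measurable A.

Let f (z : covariate R d) := fine (K z A).

Let mf : measurable_fun setT f.
Proof.
apply: measurable_fine_comp; last exact: measurable_kernel.
by move=> z; exact: pker_fin_num.
Qed.

(** The law of (Z, V') on the event V in A, as predicted by the product of the two
    conditional laws. *)
Definition product_law (E : set (covariate R d * R)) : \bar R :=
  (\int[P]_w ((f w.2)%:E * K' w.2 (xsection E w.2)))%E.

Let f0 z : (0 <= (f z)%:E)%E. Proof. by rewrite lee_fin fine_ge0. Qed.

Let m_sec (E : set (covariate R d * R)) : measurable E ->
  measurable_fun [set: obs R d] (fun w => ((f w.2)%:E * K' w.2 (xsection E w.2))%E).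
Proof.
move=> mE; apply: emeasurable_funM.
  by apply/measurable_EFinP; exact: (measurableT_comp mf mZ).
have h := measurable_fun_xsection_finite_kernel K' (mem_set mE).
exact: (measurableT_comp h mZ).
Qed.

Let product_law0 : product_law set0 = 0%E.
Proof.
apply: integral0_eq => w _; rewrite (_ : xsection set0 w.2 = set0) ?measure0 ?mule0//.
by rewrite xsection0.
Qed.

Let product_law_ge0 E : (0 <= product_law E)%E.
Proof. by apply: integral_ge0 => w _; rewrite mule_ge0. Qed.

Let product_law_sigma_additive : semi_sigma_additive product_law.
Proof.
move=> F mF tF mUF; rewrite /product_law.
rewrite (_ : (\int[P]_w _)%E = (\sum_(n <oo) product_law (F n))%E).
  apply: is_cvg_nneseries => n _ _; exact: product_law_ge0.
rewrite -integral_nneseries//; last 2 first.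
- by move=> n; exact: m_sec.
- by move=> n w _; rewrite mule_ge0.
apply: eq_integral => w _; rewrite nneseriesZl//; congr (_ * _)%E.
rewrite xsection_bigcup; apply/esym/cvg_lim => //.
apply: measure_semi_sigma_additive.
- by move=> n; exact: measurable_xsection.
- exact: trivIset_xsection.
- by apply: bigcup_measurable => n _; exact: measurable_xsection.
Qed.

HB.instance Definition _ := isMeasure.Build _ _ _ product_law product_law0
  product_law_ge0 product_law_sigma_additive.

Let pairZ (w : obs R d) := (w.2, V' w).

Let mpairZ : measurable_fun setT pairZ.
Proof. exact: measurable_fun_pair. Qed.

Let mAV : measurable [set w | A (V w)].
Proof. by rewrite -[X in measurable X]setTI; exact: mV. Qed.

(** On boxes this is the hypothesis of conditional independence; boxes determine
    finite measures. It is what allows V' to be plugged into functions that depend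
    on Z as well. *)
Lemma disintegration (E : set (covariate R d * R)) : measurable E ->
  P ([set w | A (V w)] `&` pairZ @^-1` E) = product_law E.
Proof.
move=> mE; pose Q := mrestr P mAV.
have -> : P ([set w | A (V w)] `&` pairZ @^-1` E) = pushforward Q pairZ E.
  by rewrite /Q /pushforward /mrestr setIC.
apply: (measure_unique [set C `*` B | C in measurable & B in measurable]
  (fun=> setT)) => //.
- by rewrite measurable_prod_measurableType.
- move=> _ _ [C1 mC1 [B1 mB1 <-]] [C2 mC2 [B2 mB2 <-]].
  exists (C1 `&` C2); first exact: measurableI.
  by exists (B1 `&` B2); [exact: measurableI|rewrite setXI].
- by move=> _; exists setT => //; exists setT => //; rewrite setXTT.
- by rewrite bigcup_const.
- move=> _ [C mC [B mB <-]].
  have [_ _ /(_ C mC) indepE] := indep mA mB.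
  transitivity (P ([set w | A (V w) /\ B (V' w)] `&` [set w | C w.2])).
    rewrite /Q /pushforward/= /mrestr; congr (P _).
    by apply/seteqP; split => w /=; [case=> -[]|case=> -[]].
  rewrite indepE [LHS]integral_mkcond /product_law; apply: eq_integral => w _.
  rewrite patchE; case: ifPn => [|wC].
    rewrite inE/= => wC; rewrite in_xsectionX ?inE// EFinM; congr (_ * _)%E.
    by rewrite fineK// pker_fin_num.
  by rewrite notin_xsectionX ?measure0 ?mule0.
- move=> _; apply: le_lt_trans (ltry 1).
  rewrite /pushforward/= /Q /mrestr; apply: probability_le1.
  by apply: measurableI => //; rewrite preimage_setT.
Qed.

(** By the probability integral transform the residual is uniform given (V, Z). *)
Lemma residual_box (C : set (covariate R d)) (B : set R) :
  measurable C -> measurable B ->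
  P ([set w | A (V w) /\ C w.2] `&` residual @^-1` B) =
  (P [set w | (A (V w) /\ C w.2)%classic] * uniform_prob (@ltr01 R) B)%E.
Proof.
move=> mC mB.
pose E D : set (covariate R d * R) :=
  [set p | C p.1 /\ D (cond_cdf K' p.2 p.1)].
have mE D : measurable D -> measurable (E D).
  move=> mD; rewrite (_ : E D = (fst @^-1` C) `&`
    ((fun p : covariate R d * R => cond_cdf K' p.2 p.1) @^-1` D))//.
  apply: measurableI; rewrite -[X in measurable X]setTI.
    exact: measurable_fst.
  exact: measurable_cond_cdf.
have PE D : measurable D ->
    P ([set w | A (V w) /\ C w.2] `&` residual @^-1` D) = product_law (E D).
  move=> mD; rewrite -disintegration; last exact: mE.
  congr (P _); apply/seteqP; split => w /=; first by case=> -[].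
  by case=> ? [].
have PET : P [set w | A (V w) /\ C w.2] = product_law (E setT).
  by rewrite -PE// preimage_setT setIT.
rewrite PE// PET /product_law -ge0_integralZr//; last 2 first.
- by apply: m_sec; exact: mE.
- by move=> w _; rewrite mule_ge0.
apply: ae_eq_integral => //.
- by apply: m_sec; exact: mE.
- apply: emeasurable_funM => //; apply: m_sec; exact: mE.
have mcube : measurable [set w : obs R d | cube w.2].
  by rewrite -[X in measurable X]setTI; apply: mZ => //; exact: measurable_cube.
have PC : P (~` [set w | cube w.2]) = 0%E by rewrite probability_setC// Pcube subee.
exists (~` [set w | cube w.2]); split => //; first exact: measurableC.
move=> w /= h wcube; apply: h => _; rewrite -muleA; congr (_ * _)%E.
have [_ /(_ w.2 wcube)[K01 cF]] := K'P.
have [wC|wC] := pselect (C w.2).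
  have secE D : xsection (E D) w.2 = (fun y => cond_cdf K' y w.2) @^-1` D.
    by apply/seteqP; split => y; rewrite /xsection/= inE /E/=; [case|].
  by rewrite !secE preimage_setT prob_kernel mul1e cond_cdf_uniform.
have secE D : xsection (E D) w.2 = set0.
  by apply/seteqP; split => y //; rewrite /xsection/= inE /E/= => -[].
by rewrite !secE measure0 mul0e.
Qed.

End fixed_event.

(** The joint law of ((V, Z), residual) is a product law because it is one on boxes, by
    the preceding lemma. *)
Lemma residual_indep (h : measurableTypeR R -> R) (k : R * covariate R d -> R) :
  bmfun h -> bmfun k ->
  \int[P]_w (h (residual w) * k (V w, w.2)) =
  \int[uniform_prob (@ltr01 R)]_u h u * \int[P]_w k (V w, w.2).
Proof.
move=> mh mk; pose RB := measurableTypeR R.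
pose U : probability RB R := uniform_prob (@ltr01 R).
pose VZ (w : obs R d) := (V w, w.2).
have mVZ : measurable_fun setT VZ by exact: measurable_fun_pair.
pose X1 (w : obs R d) : (R * covariate R d) * RB := (VZ w, residual w).
pose X2 (p : obs R d * RB) : (R * covariate R d) * RB := (VZ p.1, p.2).
have mX1 : measurable_fun setT X1.
  by apply: measurable_fun_pair => //; exact: measurable_residual.
have mX2 : measurable_fun setT X2.
  by apply: measurable_fun_pair => //; exact: (measurableT_comp mVZ measurable_fst).
pose f (q : (R * covariate R d) * RB) := h q.2 * k q.1.
have mf : bmfun f.
  apply: bmfunM; first exact: (bmfun_comp measurable_snd mh).
  exact: (bmfun_comp measurable_fst mk).
transitivity (\int[(P \x U)%E]_p f (X2 p)); last first.
  rewrite Rintegral_fubini; last exact: bmfun_comp.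
  transitivity (\int[P]_w (\int[U]_u h u * k (VZ w))).
    congr Rintegral; apply/funext => w; rewrite mulrC -RintegralZb//.
    by congr Rintegral; apply/funext => u; rewrite mulrC.
  by rewrite RintegralZb//; exact: bmfun_comp.
pose G : set (set ((R * covariate R d) * RB)) :=
  [set (ACB.1.1 `*` ACB.1.2) `*` ACB.2 | ACB in
    [set ACB : (set R * set (covariate R d)) * set RB |
      [/\ measurable ACB.1.1, measurable ACB.1.2 & measurable ACB.2]]].
apply: (@eq_law_Rintegral _ _ _ _ _ _ R P (P \x U)%E X1 X2 G) => //.
- apply/seteqP; split; last first.
    apply: smallest_sub; first exact: sigma_algebra_measurable.
    by move=> _ [[[A C] B] /= [mA mC mB] <-]; apply: measurableX => //; exact: measurableX.
  rewrite [X in X `<=` _]measurable_prod_measurableType.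
  apply: smallest_sub; first exact: smallest_sigma_algebra.
  move=> _ [D mD [B mB <-]].
  rewrite (_ : D `*` B = fst @^-1` D `&` snd @^-1` B)//.
  apply: (@measurableI _ (g_sigma_algebraType G)).
    suff : measurable `<=` image_set_system setT
        (fst : (R * covariate R d) * RB -> R * covariate R d) <<s G >>.
      by move=> /(_ _ mD); rewrite /image_set_system/= setTI.
    rewrite [X in X `<=` _]measurable_prod_measurableType.
    apply: smallest_sub.
      exact: sigma_algebra_image (smallest_sigma_algebra _ _).
    move=> _ [A mA [C mC <-]]; rewrite /image_set_system/= setTI.
    apply: sub_sigma_algebra; exists ((A, C), setT) => //=.
    by apply/seteqP; split => -[q u] //= [].
  apply: sub_sigma_algebra; exists ((setT, setT), B) => //=.
  by apply/seteqP; split => -[q u] //= [].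
- move=> _ _ [[[A1 C1] B1] /= [mA1 mC1 mB1] <-] [[[A2 C2] B2] /= [mA2 mC2 mB2] <-].
  exists ((A1 `&` A2, C1 `&` C2), B1 `&` B2) => /=.
    by split; exact: measurableI.
  by rewrite !setXI.
- by exists ((setT, setT), setT) => //=; rewrite !setXTT.
move=> _ [[[A C] B] /= [mA mC mB] <-].
transitivity (P ([set w | A (V w) /\ C w.2] `&` residual @^-1` B)).
  by congr (P _).
rewrite residual_box//.
have -> : X2 @^-1` ((A `*` C) `*` B) = [set w | A (V w) /\ C w.2] `*` B by [].
have mAC : measurable [set w | A (V w) /\ C w.2].
  rewrite (_ : [set w | _] = VZ @^-1` (A `*` C))//.
  by rewrite -[X in measurable X]setTI; apply: mVZ => //; exact: measurableX.
exact/esym/product_measure1E.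
Qed.

End residual_independence.

(** * Score functions *)

Lemma Rintegral_uniform {R : realType} (h : measurableTypeR R -> R) : bmfun h ->
  \int[uniform_prob (@ltr01 R)]_u h u = \int[lebesgue_measure]_(u in `[0, 1]) h u.
Proof.
move=> mh; have [M M0 hM] := bmfun_bound mh.
pose RB := measurableTypeR R.
pose U : probability RB R := uniform_prob (@ltr01 R).
have m01 : measurable (`[0, 1]%classic : set RB) by exact: measurable_itv.
have l01 : lebesgue_measure (`[0, 1]%classic : set RB) = 1%E.
  by rewrite lebesgue_measure_itv/= lte_fin ltr01 sube0.
pose I01 : set RB := `[0, 1]%classic.
have fin01 : (lebesgue_measure I01 < +oo)%E.
  by rewrite /I01 l01 ltry.
have int01 (g : RB -> R) : bmfun g ->
    lebesgue_measure.-integrable I01 (EFin \o g).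
  move=> [mg [N gN]]; apply: measurable_bounded_integrable => //.
  - exact: measurable_funTS.
  - exists N; split; first exact: num_real.
    by move=> N' NN' x _; apply: le_trans (gN x) (ltW NN').
have mhM : bmfun (fun u => h u + M) by apply: bmfunD => //; exact: bmfun_cst.
have hM0 u : 0 <= h u + M.
  by have := hM u; rewrite ler_norml => /andP[+ _]; lra.
have E : \int[U]_u (h u + M) = \int[lebesgue_measure]_(u in `[0, 1]) (h u + M).
  rewrite /Rintegral integral_uniform ?subr0 ?invr1 ?mul1e//.
  by apply/measurable_EFinP; case: mhM.
move: E; rewrite RintegralDb//; last exact: bmfun_cst.
rewrite Rintegral_cstb RintegralD//; [|exact: int01|exact: (int01 _ (bmfun_cst M))].
have -> : \int[lebesgue_measure]_(_ in `[0, 1]) M = M.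
  by rewrite Rintegral_cst// [X in fine X](_ : _ = 1%E) ?mulr1//; exact: l01.
by move=> /addIr.
Qed.

Definition clip01 {R : realType} (u : R) : R := Num.max 0 (Num.min u 1).

Section clip.
Context {R : realType}.
Implicit Types u v : R.

Lemma clip01_itv u : clip01 u \in `[0, 1].
Proof. by rewrite in_itv/= le_max lexx ge_max ler01 ge_min lexx orbT. Qed.

Lemma clip01_id u : u \in `[0, 1] -> clip01 u = u.
Proof.
by rewrite in_itv/= => /andP[u0 u1]; rewrite /clip01 (min_idPl u1) (max_idPr u0).
Qed.

Lemma clip01_lipschitz u v : `|clip01 u - clip01 v| <= `|u - v|.
Proof.
wlog uv : u v / u <= v.
  move=> H; have [/H//|/ltW/H] := leP u v.
  by rewrite distrC [leRHS]distrC.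
rewrite (distrC u) (ger0_norm (x := v - u)) ?subr_ge0// /clip01.
rewrite ler_norml !maxEle !minEle.
case: (leP u 1) => u1; case: (leP v 1) => v1; rewrite ?ler01;
  (case: (leP 0 u) => u0); (case: (leP 0 v) => v0); apply/andP; split; lra.
Qed.

End clip.

Section score_facts.
Context {R : realType} {q : nat}.
Variable phi : 'I_q -> R -> R.
Hypotheses (hq : (0 < q)%N) (hphi : score_functions phi).
Local Notation t0 := (tau_min phi).
Local Notation t1 := (tau_max phi).
Let RB := measurableTypeR R.

Lemma score_lipschitz : exists2 L, 0 < L & forall k u v,
  u \in `[0, 1] -> v \in `[0, 1] -> `|phi k u - phi k v| <= L * `|u - v|.
Proof.
have [_ lip _ _ _] := hphi.
have /choice[L HL] : forall k, exists L, forall u v,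
    u \in `[0, 1] -> v \in `[0, 1] -> `|phi k u - phi k v| <= L * `|u - v|.
  move=> k; have [M [_ HM]] := lip k; exists (M + 1) => u v u01 v01.
  have MM : M < M + 1 by rewrite ltrDl.
  exact: (HM _ MM (u, v)).
exists (1 + \sum_k `|L k|) => [|k u v u01 v01].
  by rewrite ltr_pwDl// sumr_ge0.
apply: (le_trans (HL k u v u01 v01)); rewrite ler_wpM2r//.
apply: (le_trans (ler_norm _)); rewrite (bigD1 k)//= addrCA lerDl.
by rewrite addr_ge0// sumr_ge0.
Qed.

(** Each support is closed and misses 0 and 1. *)
Lemma support_margin : exists2 e, 0 < e &
  forall k u, support01 (phi k) u -> e <= u <= 1 - e.
Proof.
have [supp _ _ _ _] := hphi.
have near_notin k (x : R) : ~ support01 (phi k) x -> exists2 e, 0 < e &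
    forall u, support01 (phi k) u -> e <= `|x - u|.
  move=> xk; have : open (~` support01 (phi k)).
    by rewrite openC; exact: closed_closure.
  rewrite openE => /(_ x xk) /nbhs_ballP[e /= e0 be].
  exists e => // u uk; rewrite leNgt; apply/negP => xu.
  by apply: (be u).
have /choice[e He] : forall k, exists e, 0 < e /\
    forall u, support01 (phi k) u -> e <= u <= 1 - e.
  move=> k; have [_ sub] := supp k.
  have [|a a0 Ha] := near_notin k 0.
    by move=> /sub/=; rewrite in_itv/= ltxx.
  have [|b b0 Hb] := near_notin k 1.
    by move=> /sub/=; rewrite in_itv/= ltxx andbF.
  exists (Num.min a b); split; first by rewrite lt_min a0.
  move=> u uk; have := sub u uk; rewrite /= in_itv/= => /andP[u0 u1].
  have := Ha u uk; have := Hb u uk.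
  rewrite sub0r normrN (gtr0_norm u0) gtr0_norm ?subr_gt0// => bu au.
  by rewrite ge_min au/= lerBrDr -lerBrDl ge_min bu orbT.
exists (\big[Num.min/1]_k e k).
  by apply: lt_bigmin => // k _; have [] := He k.
move=> k u uk; have [_ /(_ u uk)/andP[eu ue]] := He k.
have ek := bigmin_le 1 k e.
by rewrite (le_trans ek)//= (le_trans ue)// lerD2l lerN2.
Qed.

Let S : set R := \bigcup_k support01 (phi k).

Let supp_phi k u : u \in `[0, 1] -> phi k u != 0 -> S u.
Proof. by move=> u01 pu; exists k => //; exact: subset_closure. Qed.

Let S_nonempty : S !=set0.
Proof.
have [_ _ _ int1 _] := hphi.
have k : 'I_q by exact: (Ordinal hq).
apply: contrapT => S0; have := int1 k.
rewrite (_ : \int[_]_(_ in _) _ = 0); first by move/esym/eqP; rewrite oner_eq0.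
rewrite /Rintegral integral0_eq// => u /= u01.
have [->|pu] := eqVneq (phi k u) 0; first by rewrite expr0n.
by exfalso; apply: S0; exists u; exact: supp_phi pu.
Qed.

Let S_bounds : exists2 e, 0 < e & forall u, S u -> e <= u <= 1 - e.
Proof.
have [e e0 He] := support_margin; exists e => // u [k _]; exact: He.
Qed.

Lemma tau_bounds : [/\ 0 < t0, t0 <= t1 & t1 < 1].
Proof.
have [e e0 He] := S_bounds; have [u Su] := S_nonempty.
have lbS : has_lbound S by exists e => x /He/andP[].
have ubS : has_ubound S by exists (1 - e) => x /He/andP[].
split.
- apply: (lt_le_trans e0); apply: lb_le_inf; first exact: S_nonempty.
  by move=> x /He/andP[].
- by apply: (@le_trans _ _ u); [exact: ge_inf|exact: ub_le_sup].
- apply: (@le_lt_trans _ _ (1 - e)); last by rewrite gtrBl.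
  by apply: ge_sup; [exact: S_nonempty|move=> x /He/andP[]].
Qed.

Let phi_strict k u : u \in `[0, 1] -> (u < t0) || (t1 < u) -> phi k u = 0.
Proof.
move=> u01 ut; apply/eqP; apply/negP => /negP pu.
have Su := supp_phi u01 pu; have [e e0 He] := S_bounds.
have lbS : has_lbound S by exists e => x /He/andP[].
have ubS : has_ubound S by exists (1 - e) => x /He/andP[].
case/orP: ut; rewrite ltNge => /negP; apply.
  exact: ge_inf.
exact: ub_le_sup.
Qed.

(** By continuity the scores also vanish at the two end points. *)
Lemma score_vanish k u : u \in `[0, 1] -> (u <= t0) || (t1 <= u) -> phi k u = 0.
Proof.
move=> u01 ut; have [L L0 HL] := score_lipschitz.
have [t00 t01 t11] := tau_bounds.
apply/eqP; rewrite -normr_le0; apply/ler_addgt0Pr => e e0; rewrite add0r.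
pose dl := Num.min (e / L) (Num.min t0 (1 - t1)).
have dl0 : 0 < dl by rewrite !lt_min divr_gt0// t00 subr_gt0.
have dlL : L * dl <= e by rewrite mulrC -ler_pdivlMr// ge_min lexx.
have dlt0 : dl <= t0 by rewrite !ge_min lexx orbT.
have dlt1 : dl <= 1 - t1 by rewrite !ge_min lexx !orbT.
move: (u01); rewrite in_itv/= => /andP[u0 u1].
have step v : v \in `[0, 1] -> `|u - v| <= dl -> (v < t0) || (t1 < v) ->
    `|phi k u| <= e.
  move=> v01 uv vt; have := HL k u v u01 v01.
  rewrite (phi_strict k v01 vt) subr0 => /le_trans; apply.
  by apply: le_trans dlL; rewrite ler_wpM2l// ltW.
have [utt|t0u] := ltP u t0.
  by apply: (step u) => //; rewrite ?subrr ?normr0 ?utt// ltW.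
have [utt|ut1] := ltP t1 u.
  by apply: (step u) => //; rewrite ?subrr ?normr0 ?utt ?orbT// ltW.
case/orP: ut => h.
  apply: (step (u - dl)).
  - by rewrite in_itv/= subr_ge0 (le_trans dlt0)//= (le_trans _ u1)// gerBl ltW.
  - by rewrite opprB addrC subrK gtr0_norm.
  - by rewrite ltrBlDl (le_lt_trans h)// ltrDr.
apply: (step (u + dl)).
- by rewrite in_itv/= addr_ge0 ?(ltW dl0)//=; lra.
- by rewrite opprD addrA subrr sub0r normrN gtr0_norm.
- by rewrite (le_lt_trans h) ?orbT// ltrDl.
Qed.

End score_facts.

Section clipped_scores.
Context {R : realType} {q : nat}.
Variable phi : 'I_q -> R -> R.
Hypotheses (hq : (0 < q)%N) (hphi : score_functions phi).
Let RB := measurableTypeR R.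

(** The scores are only constrained on [0, 1]; composing with the projection onto
    [0, 1] makes them bounded and measurable on the whole line. *)
Definition clip_score (k : 'I_q) (u : R) : R := phi k (clip01 u).

Lemma clip_score_id k u : u \in `[0, 1] -> clip_score k u = phi k u.
Proof. by move=> u01; rewrite /clip_score clip01_id. Qed.

Lemma clip_score_lipschitz : exists2 L, 0 < L & forall k u v,
  `|clip_score k u - clip_score k v| <= L * `|u - v|.
Proof.
have [L L0 HL] := score_lipschitz hphi; exists L => // k u v.
apply: (le_trans (HL k _ _ (clip01_itv u) (clip01_itv v))).
by rewrite ler_wpM2l ?(ltW L0)// clip01_lipschitz.
Qed.

Lemma continuous_lipschitz (f : R -> R) (L : R) : 0 < L ->
  (forall u v, `|f u - f v| <= L * `|u - v|) -> continuous f.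
Proof.
move=> L0 fL u; apply/cvgrPdist_lt => e e0; near=> v.
apply: (le_lt_trans (fL u v)); rewrite mulrC -ltr_pdivlMr//.
by near: v; apply/nbhs_ballP; exists (e / L) => //=; rewrite divr_gt0.
Unshelve. all: by end_near. Qed.

Lemma bmfun_clip_score k : bmfun (clip_score k : RB -> R).
Proof.
have [L L0 HL] := clip_score_lipschitz; split.
  apply: continuous_measurable_fun.
  exact: continuous_lipschitz L0 (HL k).
have [t00 _ _] := tau_bounds hq hphi.
have [L' L'0 HL'] := score_lipschitz hphi.
have z01 : (0 : R) \in `[0, 1] by rewrite in_itv/= lexx ler01.
exists L' => u; have := HL' k _ _ (clip01_itv u) z01.
rewrite (score_vanish hq hphi k z01) ?(ltW t00)// !subr0 => /le_trans; apply.
have := clip01_itv u; rewrite in_itv/= => /andP[c0 c1].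
by rewrite (ger0_norm c0) ler_piMr// ltW.
Qed.

Lemma uniform_clip_score k :
  \int[uniform_prob (@ltr01 R)]_u clip_score k u = 0.
Proof.
have [_ _ int0 _ _] := hphi.
rewrite Rintegral_uniform; last exact: bmfun_clip_score.
rewrite -[RHS](int0 k); apply: eq_Rintegral => u; rewrite inE/= => u01.
exact: clip_score_id.
Qed.

Lemma uniform_clip_scoreM k s :
  \int[uniform_prob (@ltr01 R)]_u (clip_score k u * clip_score s u) =
  Sigma phi k s.
Proof.
rewrite Rintegral_uniform; last by apply: bmfunM; exact: bmfun_clip_score.
rewrite mxE; apply: eq_Rintegral => u; rewrite inE/= => u01.
by rewrite !clip_score_id.
Qed.

(** The quadratic form of the Gram matrix is the integral of a square, and a
    continuous function whose square integrates to 0 vanishes. *)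
Lemma Sigma_posdef : sym_posdef (Sigma phi).
Proof.
split.
  apply/matrixP => k s; rewrite !mxE; apply: eq_Rintegral => u _.
  by rewrite mulrC.
move=> v v0; pose U : probability RB R := uniform_prob (@ltr01 R).
pose g (u : RB) : R := \sum_k v 0 k * clip_score k u.
have mg : bmfun g.
  by apply: bmfun_sum => k; apply: bmfunZ; exact: bmfun_clip_score.
have -> : (v *m Sigma phi *m v^T) 0 0 = \int[U]_u (g u ^+ 2).
  rewrite mxE; under eq_bigr do rewrite mxE mxE mulr_suml.
  rewrite exchange_big/=.
  transitivity (\int[U]_u \sum_k \sum_s
      v 0 k * v 0 s * (clip_score k u * clip_score s u)); last first.
    congr Rintegral; apply/funext => u; rewrite expr2 /g mulr_suml.
    by apply: eq_bigr => k _; rewrite mulr_sumr; apply: eq_bigr => s _; ring.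
  have mks k s : bmfun (fun u : RB =>
      v 0 k * v 0 s * (clip_score k u * clip_score s u)).
    by apply: bmfunZ; apply: bmfunM; exact: bmfun_clip_score.
  rewrite Rintegral_sumb; last by move=> k; exact: bmfun_sum.
  apply: eq_bigr => k _; rewrite Rintegral_sumb//; apply: eq_bigr => s _.
  rewrite RintegralZb; last by apply: bmfunM; exact: bmfun_clip_score.
  by rewrite uniform_clip_scoreM; ring.
have [u0 u001 gu0] : exists2 u0, u0 \in `[0, 1] & g u0 != 0.
  apply: contrapT => gno; move/eqP : v0; apply.
  have [_ _ _ _ free] := hphi.
  apply/rowP => k; rewrite [RHS]mxE; apply: (free (fun k => v 0 k)) => u u01.
  apply: contrapT => /eqP gu; apply: gno; exists u => //.
  by rewrite /g; under eq_bigr do rewrite clip_score_id//.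
have [L L0 HL] := clip_score_lipschitz.
pose M := 1 + \sum_k `|v 0 k| * L.
have M0 : 0 < M.
  by rewrite /M ltr_pwDl// sumr_ge0// => k _; rewrite mulr_ge0// ltW.
have gM (x y : R) : `|g x - g y| <= M * `|x - y|.
  rewrite /g -sumrB; apply: (le_trans (ler_norm_sum _ _ _)).
  apply: (@le_trans _ _ ((\sum_k `|v 0 k| * L) * `|x - y|)).
    rewrite mulr_suml; apply: ler_sum => k _; rewrite -mulrBr normrM -mulrA.
    by rewrite ler_wpM2l.
  by rewrite ler_wpM2r// lerDr.
pose c := `|g u0|; have c0 : 0 < c by rewrite normr_gt0.
pose dl := Num.min (c / (2 * M)) 2^-1.
have dl0 : 0 < dl by rewrite lt_min divr_gt0//= ?invr_gt0// mulr_gt0.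
have dlM : M * dl <= c / 2.
  rewrite -ler_pdivlMl//; apply: (@le_trans _ _ (c / (2 * M))).
    by rewrite ge_min lexx.
  by rewrite le_eqVlt; apply/orP; left; apply/eqP; field; rewrite gt_eqF.
have dl2 : dl <= 2^-1 by rewrite ge_min lexx orbT.
move: (u001); rewrite in_itv/= => /andP[u00 u01].
have [a [a0 adl au ua]] : exists a, [/\ 0 <= a, a + dl <= 1, a <= u0 & u0 <= a + dl].
  have [h|h] := leP u0 2^-1.
    by exists u0; split => //; lra.
  by exists (u0 - dl); split; lra.
pose J : set RB := `[a, a + dl]%classic.
have mJ : measurable J by exact: measurable_itv.
have UJ : fine (U J) = dl.
  rewrite -Rintegral_indicb// Rintegral_uniform; last exact: bmfun_indic.
  rewrite /Rintegral integral_indic//.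
  rewrite (_ : J `&` _ = J); last first.
    apply/seteqP; split => x /=; first by case.
    rewrite /J/= !in_itv/= => /andP[ax xa]; rewrite ax xa (le_trans a0 ax).
    by rewrite (le_trans xa adl).
  have lJ : lebesgue_measure J = dl%:E.
    rewrite /J lebesgue_measure_itv/= lte_fin ltrDl dl0 -EFinB.
    by rewrite addrAC subrr add0r.
  by rewrite [X in fine X](_ : _ = dl%:E)//; exact: lJ.
apply: (@lt_le_trans _ _ ((c / 2) ^+ 2 * dl)).
  by rewrite mulr_gt0// exprn_gt0// divr_gt0.
rewrite -UJ -Rintegral_indicb// -RintegralZb; last exact: bmfun_indic.
apply: le_Rintegralb; [by apply: bmfunZ; exact: bmfun_indic|exact: bmfunX|].
move=> x; rewrite indicE; case: (boolP (x \in J)) => [|_]; last first.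
  by rewrite mulr0 sqr_ge0.
rewrite inE /J/= in_itv/= => /andP[ax xa]; rewrite mulr1.
rewrite -[leRHS]real_normK ?num_real//; apply: lerXn2r; rewrite ?nnegrE//.
  by rewrite divr_ge0// ltW.
have : `|u0 - x| <= dl by rewrite ler_norml; apply/andP; split; lra.
move=> ux; have := gM u0 x.
have : M * `|u0 - x| <= c / 2 by apply: le_trans dlM; rewrite ler_wpM2l// ltW.
have := lerB_dist (g u0) (g x); rewrite -/c; lra.
Qed.

End clipped_scores.

(** * Effect of estimating the conditional distribution functions *)

(** Inside the band the scores are Lipschitz. Outside it the true score is 0, and by
    monotonicity the estimated residual can cross into the support of the score
    by at most the estimation error at the end of the band. Hence the error inside the
    band controls everything. *)
Lemma score_perturbation {R : realType} {d q : nat} (phi : 'I_q -> R -> R)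
    (K : R.-pker (covariate R d) ~> R) (z : covariate R d) (G : R -> R) (L D : R) :
  (0 < q)%N -> score_functions phi ->
  K z `[0, 1]%classic = 1%E -> continuous (fun t => cond_cdf K t z) ->
  0 < L -> (forall k u v, u \in `[0, 1] -> v \in `[0, 1] ->
    `|phi k u - phi k v| <= L * `|u - v|) ->
  {in `[0, 1] &, {homo G : t u / t <= u}} -> G 0 = 0 -> G 1 = 1 ->
  (forall t, quantile_band K (tau_min phi) (tau_max phi) z t ->
    `|cond_cdf K t z - G t| <= D) ->
  forall k t, t \in `[0, 1] ->
    `|phi k (G t) - phi k (cond_cdf K t z)| <= L * D.
Proof.
move=> hq hphi K01 cF L0 lip Ghomo G0 G1 band k t t01.
set F := cond_cdf K ^~ z in band *.
have [t00 t0t1 t11] := tau_bounds hq hphi.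
set tau0 := tau_min phi in band t00 t0t1 *.
set tau1 := tau_max phi in band t0t1 t11 *.
have tau0_itv : 0 < tau0 < 1 by rewrite t00 (le_lt_trans t0t1).
have tau1_itv : 0 < tau1 < 1 by rewrite t11 (lt_le_trans t00).
have [a0_itv Fa0 lt_a0] := cond_quantileP K01 cF tau0_itv.
have [a1_itv Fa1 lt_a1] := cond_quantileP K01 cF tau1_itv.
set a0 := cond_quantile K tau0 z in a0_itv Fa0 lt_a0.
set a1 := cond_quantile K tau1 z in a1_itv Fa1 lt_a1.
have FF0 : F a0 = tau0 := Fa0; have FF1 : F a1 = tau1 := Fa1.
have a01 : a0 <= a1.
  rewrite leNgt; apply/negP => a10.
  by have := lt_a0 a1 a1_itv a10; rewrite Fa1 ltNge t0t1.
have F01 u : F u \in `[0, 1] by rewrite in_itv/= cond_cdf_ge0 cond_cdf_le1.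
have i0 : (0 : R) \in `[0, 1] by rewrite in_itv/= lexx ler01.
have i1 : (1 : R) \in `[0, 1] by rewrite in_itv/= lexx ler01.
have G01 u : u \in `[0, 1] -> G u \in `[0, 1].
  move=> u01; move: (u01); rewrite !in_itv/= => /andP[u0 u1].
  by rewrite -{1}G0 -G1 !Ghomo.
have tau0i : tau0 \in `[0, 1].
  by move: tau0_itv; rewrite in_itv/= => /andP[/ltW -> /ltW ->].
have tau1i : tau1 \in `[0, 1].
  by move: tau1_itv; rewrite in_itv/= => /andP[/ltW -> /ltW ->].
have band0 : `|F a0 - G a0| <= D.
  by apply: band; rewrite /quantile_band/= in_itv/= lexx.
have band1 : `|F a1 - G a1| <= D.
  by apply: band; rewrite /quantile_band/= in_itv/= lexx andbT.
have D0 : 0 <= D by exact: le_trans band0.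
have LD0 : 0 <= L * D by rewrite mulr_ge0// ltW.
have van0 u : u \in `[0, 1] -> u <= tau0 -> phi k u = 0.
  by move=> u01 h; apply: (score_vanish hq hphi) => //; rewrite h.
have van1 u : u \in `[0, 1] -> tau1 <= u -> phi k u = 0.
  by move=> u01 h; apply: (score_vanish hq hphi) => //; rewrite h orbT.
have [ta0|a0t] := ltP t a0.
  rewrite [phi k (F t)]van0//; last exact: ltW (lt_a0 t t01 ta0).
  have [Gt|Gt] := leP (G t) tau0; first by rewrite van0 ?G01// subr0 normr0.
  rewrite -(van0 tau0)//; apply: (le_trans (lip k _ _ (G01 t t01) tau0i)).
  rewrite ler_wpM2l ?(ltW L0)// gtr0_norm ?subr_gt0//.
  have : G t <= G a0 by apply: Ghomo => //; exact: ltW.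
  by move: band0; rewrite FF0 ler_norml => /andP[+ _]; lra.
have [ta1|a1t] := leP t a1.
  apply: (le_trans (lip k _ _ (G01 t t01) (F01 t))).
  rewrite ler_wpM2l ?(ltW L0)// distrC; apply: band.
  by rewrite /quantile_band/= in_itv/= a0t.
have FT1 : tau1 <= F t by rewrite -FF1; apply: cond_cdf_homo; exact: ltW.
rewrite [phi k (F t)]van1//.
have [Gt|Gt] := leP tau1 (G t); first by rewrite van1 ?G01// subr0 normr0.
rewrite -(van1 tau1)//; apply: (le_trans (lip k _ _ (G01 t t01) tau1i)).
rewrite ler_wpM2l ?(ltW L0)// ltr0_norm ?subr_lt0// opprB.
have : G a1 <= G t by apply: Ghomo => //; exact: ltW.
by move: band1; rewrite FF1 ler_norml => /andP[_ +]; lra.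
Qed.

(** The error is only controlled through an outer probability, because the supremum
    defining it need not be measurable. *)
Lemma le_outer_measure {R : realType} {d} {T : measurableType d}
    (Pr : probability T R) (A B : set T) :
  measurable A -> A `<=` B -> (Pr A <= mu_ext Pr B)%E.
Proof.
move=> mA AB; rewrite -(measurable_mu_extE Pr mA).
exact: le_mu_ext.
Qed.

(** The rate may have either sign, whence its absolute value. *)
Lemma bigO_P_event {R : realType} {d} {T : measurableType d}
    (Pr : probability T R) (X : nat -> T -> \bar R) (a : nat -> R) (e : R) :
  bigO_P Pr X a -> 0 < e -> exists2 M, 0 < M & forall n, (0 < n)%N ->
    (mu_ext Pr [set w | ((M * `|a n|)%:E < X n w)%E] <= e%:E)%E.
Proof.
move=> [a0 H] e0; have [M M0 supM] := H e e0; exists M => // n n0.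
apply: le_trans (ltW supM).
apply: le_trans (ereal_sup_ubound _); last by exists n.
apply: le_mu_ext => w /=; have an0 : 0 < `|a n| by rewrite normr_gt0 a0.
have -> : (((a n)%:E)^-1 = ((a n)^-1)%:E)%E by rewrite inver (negbTE (a0 n n0)).
rewrite abseM [X in (_ * X)%E]/= normfV.
case: (X n w) => [x| |]//=.
  rewrite -EFinM !lte_fin => Mx; rewrite ltr_pdivlMr//.
  by rewrite (lt_le_trans Mx)// ler_norm.
by move=> _; rewrite gt0_mulye ?lte_fin ?invr_gt0// ltry.
Qed.

Lemma estimate_itv {R : realType} {d} (F : cdf_estimator R d) n
    (s : n.-tuple (R * covariate R d)) t z :
  is_cdf_estimator F -> (0 < n)%N -> sample_cube s -> t \in `[0, 1] -> cube z ->
  F n s t z \in `[0, 1].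
Proof.
move=> hF n0 cs t01 cz; have [Fs _] := hF n n0.
have [_ homoF F0 F1] := Fs s z cs cz.
have i0 : (0 : R) \in `[0, 1] by rewrite in_itv/= lexx ler01.
have i1 : (1 : R) \in `[0, 1] by rewrite in_itv/= lexx ler01.
move: (t01); rewrite !in_itv/= => /andP[t0 t1].
by rewrite -{1}F0 -F1 !homoF.
Qed.

(** One of the two variables, V, is estimated; the other one, V', enters through its
    true residual. Both X and Y will play the role of V. *)
Section estimated_scores.
Context {R : realType} {d q : nat} {dO : measure_display}
  {Omega : measurableType dO}.
Variables (Pr : probability Omega R) (W : nat -> Omega -> obs R d)
  (P : probability (obs R d) R) (V V' : obs R d -> R)
  (K K' : R.-pker (covariate R d) ~> R) (phi : 'I_q -> R -> R)
  (F : cdf_estimator R d) (g : nat -> R).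
Local Notation RZ := (R * covariate R d)%type.
Local Notation U' := (residual V' K').
Hypotheses (hW : forall i w, obs_cube (W i w)) (iidW : iid_sample Pr W P)
  (hq : (0 < q)%N) (hphi : score_functions phi) (hF : is_cdf_estimator F)
  (mV : measurable_fun setT V) (V01 : forall w, obs_cube w -> V w \in `[0, 1])
  (mV' : measurable_fun setT V')
  (KP : forall z, cube z -> K z `[0, 1]%classic = 1%E /\
    continuous (fun t => cond_cdf K t z))
  (indep : forall (h : measurableTypeR R -> R) (k : RZ -> R),
    bmfun h -> bmfun k ->
    \int[P]_w (h (U' w) * k (V w, w.2)) =
    \int[uniform_prob (@ltr01 R)]_u h u * \int[P]_w k (V w, w.2)).

Lemma measurable_sample_cube n : measurable (@sample_cube R d n).
Proof.
rewrite (_ : sample_cube (n := n) =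
    box (fun _ : 'I_n => (`[0, 1]%classic : set R) `*` cube)) //.
apply: measurable_box => i; apply: measurableX; last exact: measurable_cube.
exact: measurable_itv.
Qed.

(** The estimated residual, extended by 0 to samples outside of the cube, where
    its measurability is not known. *)
Definition est_residual n (i : 'I_n) : n.-tuple RZ -> R :=
  (fun s => F s (tnth s i).1 (tnth s i).2) \_ (@sample_cube R d n).

Lemma measurable_est_residual n (i : 'I_n) :
  measurable_fun setT (est_residual i).
Proof.
apply/(measurable_restrictT _ (@measurable_sample_cube n)).
by have [_] := hF (leq_ltn_trans (leq0n i) (ltn_ord i)).
Qed.

Definition score_error n (k : 'I_q) (i : 'I_n) (s : n.-tuple RZ) : R :=
  clip_score phi k (est_residual i s) -
  clip_score phi k (cond_cdf K (tnth s i).1 (tnth s i).2).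

Lemma bmfun_score_error n (k : 'I_q) (i : 'I_n) : bmfun (score_error k i).
Proof.
have mk := bmfun_clip_score hq hphi k.
apply: bmfunB; first exact: (bmfun_comp (measurable_est_residual i) mk).
apply: bmfun_comp mk.
have mp : measurable_fun setT (fun s : n.-tuple RZ => ((tnth s i).2, (tnth s i).1)).
  apply: measurable_fun_pair.
    exact: (measurableT_comp measurable_snd (@measurable_tnth _ _ _ i)).
  exact: (measurableT_comp measurable_fst (@measurable_tnth _ _ _ i)).
exact: (measurableT_comp (measurable_cond_cdf K) mp).
Qed.

Definition project_tuple n (s : n.-tuple (obs R d)) : n.-tuple RZ :=
  [tuple (V (tnth s i), (tnth s i).2) | i < n].

Lemma measurable_project_tuple n : measurable_fun setT (@project_tuple n).
Proof.
apply: measurable_fun_mktuple => i; apply: measurable_fun_pair.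
  exact: (measurableT_comp mV (@measurable_tnth _ _ _ i)).
exact: (measurableT_comp measurable_snd (@measurable_tnth _ _ _ i)).
Qed.

Definition err n (k : 'I_q) (i : 'I_n) (w : Omega) : R :=
  score_error k i (project_tuple (sample W n w)).

Definition true_score (s : 'I_q) (i : nat) (w : Omega) : R :=
  clip_score phi s (U' (W i w)).

Lemma bmfun_err n (k : 'I_q) (i : 'I_n) : bmfun (err k i).
Proof.
apply: bmfun_comp (bmfun_score_error k i).
exact: (measurableT_comp (@measurable_project_tuple n)
  (@measurable_sample _ _ _ _ _ _ _ iidW n)).
Qed.

Let mU' : measurable_fun setT U'.
Proof. exact: measurable_residual. Qed.

Lemma bmfun_true_score s i : bmfun (true_score s i).
Proof.
have [mW _ _] := iidW.
exact: (bmfun_comp (measurableT_comp mU' (mW i)) (bmfun_clip_score hq hphi s)).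
Qed.

Definition band_error n (w : Omega) : \bar R :=
  norm_in K (tau_min phi) (tau_max phi)
    (fun t z => cond_cdf K t z - F (project_tuple (sample W n w)) t z).

Lemma err_bound : exists2 L, 0 < L & forall n (w : Omega) (D : R),
  (band_error n w <= D%:E)%E ->
  forall k (i : 'I_n), `|err k i w| <= L * D.
Proof.
have [L L0 HL] := score_lipschitz hphi; exists L => // n w D bandD k i.
set s := project_tuple (sample W n w) in bandD *.
have si : tnth s i = (V (W i w), (W i w).2) by rewrite !tnth_mktuple.
have s_cube : sample_cube s.
  move=> j; rewrite !tnth_mktuple/=; split; first exact: V01.
  by have [_ _] := hW j w.
have zcube : cube (W i w).2 by have [_ _] := hW i w.
have t01 : V (W i w) \in `[0, 1] by exact: V01.
have [K01 cF] := KP zcube.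
have [Fs _] := hF (leq_ltn_trans (leq0n i) (ltn_ord i)).
have [_ homoF F0 F1] := Fs s _ s_cube zcube.
have F01 t : cond_cdf K t (W i w).2 \in `[0, 1].
  by rewrite in_itv/= cond_cdf_ge0 cond_cdf_le1.
have G01 : F s (V (W i w)) (W i w).2 \in `[0, 1].
  exact: estimate_itv hF (leq_ltn_trans (leq0n i) (ltn_ord i)) s_cube t01 zcube.
rewrite /err /score_error -/s /est_residual patchE mem_set// si/=.
rewrite !clip_score_id//.
apply: (score_perturbation hq hphi K01 cF L0 HL homoF F0 F1) => // t band_t.
rewrite -lee_fin; apply: le_trans bandD.
rewrite /band_error /norm_in /sup_norm_on.
apply: le_trans (ereal_sup_ubound _); last by exists (W i w).2.
by apply: ereal_sup_ubound; exists t.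
Qed.

(** Given the (V, Z)-sample the true scores of V' are independent and centred, and
    the errors are functions of that sample. *)
Lemma cross_moment n (k s : 'I_q) (i j : 'I_n) : i != j ->
  \int[Pr]_w ((err k i w * true_score s i w) * (err k j w * true_score s j w)) = 0.
Proof.
move=> ij.
pose G (u : n.-tuple (obs R d)) : R :=
  (score_error k i (project_tuple u) * clip_score phi s (U' (tnth u i))) *
  (score_error k j (project_tuple u) * clip_score phi s (U' (tnth u j))).
have mscore l : bmfun (fun u : n.-tuple (obs R d) =>
    clip_score phi s (U' (tnth u l))).
  exact: (bmfun_comp (measurableT_comp mU' (@measurable_tnth _ _ _ l))
    (bmfun_clip_score hq hphi s)).
have merr l : bmfun (fun u : n.-tuple (obs R d) =>
    score_error k l (project_tuple u)).
  exact: bmfun_comp (@measurable_project_tuple n) (bmfun_score_error k l).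
have mG : bmfun G by apply: bmfunM; exact: bmfunM.
have -> : (fun w => (err k i w * true_score s i w) *
    (err k j w * true_score s j w)) = fun w => G (sample W n w).
  by apply/funext => w; rewrite /G /err /true_score !tnth_mktuple.
rewrite (resampling iidW i mG).
rewrite (_ : (fun w => _) = fun=> 0) ?Rintegral_cstb//.
apply/funext => w; set u := sample W n w.
pose vz := project_tuple u.
pose kk (p : RZ) : R := score_error k i (tuple_upd vz i p) *
  (score_error k j (tuple_upd vz i p) * clip_score phi s (U' (tnth u j))).
have mupd : measurable_fun setT (fun p : RZ => tuple_upd vz i p).
  apply: measurable_fun_mktuple => l.
  by case: (l == i); [exact: measurable_id|exact: measurable_cst].
have mkk : bmfun kk.
  apply: bmfunM; first exact: bmfun_comp mupd (bmfun_score_error k i).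
  under eq_fun do rewrite mulrC; apply: bmfunZ.
  exact: bmfun_comp mupd (bmfun_score_error k j).
have := indep (bmfun_clip_score hq hphi s) mkk.
rewrite uniform_clip_score// mul0r => <-.
congr Rintegral; apply/funext => v; rewrite /G.
have -> : project_tuple (tuple_upd u i v) = tuple_upd vz i (V v, v.2).
  apply: eq_from_tnth => l; rewrite !tnth_mktuple /vz.
  by case: eqP => //; rewrite tnth_mktuple.
rewrite !tnth_tuple_upd eqxx eq_sym (negbTE ij) /kk.
by ring.
Qed.

Definition cross_term n (k s : 'I_q) (w : Omega) : R :=
  (Num.sqrt n%:R)^-1 * \sum_(i < n) err k i w * true_score s i w.

Lemma bmfun_cross_term n k s : bmfun (cross_term n k s).
Proof.
apply: bmfunZ; apply: bmfun_sum => i.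
by apply: bmfunM; [exact: bmfun_err|exact: bmfun_true_score].
Qed.

Lemma true_score_bound : exists2 B, 0 < B & forall s i w, `|true_score s i w| <= B.
Proof.
have HB s : exists B, forall u, `|clip_score phi s u| <= B.
  by have [_] := bmfun_clip_score hq hphi s.
have [B BP] := choice HB; exists (1 + \sum_s `|B s|).
  by rewrite ltr_pwDl// sumr_ge0.
move=> s i w; apply: (le_trans (BP s _)); apply: (le_trans (ler_norm _)).
by rewrite (bigD1 s)//= addrCA lerDl addr_ge0// sumr_ge0.
Qed.

(** The off-diagonal moments vanish, so that the n summands contribute n times e, which
    the scaling turns into e. *)
Lemma cross_term_sq : exists2 B, 0 < B & forall n k s (e : R), (0 < n)%N ->
  (forall i : 'I_n, \int[Pr]_w (err k i w ^+ 2) <= e) ->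
  \int[Pr]_w (cross_term n k s w ^+ 2) <= B * e.
Proof.
have [B B0 HB] := true_score_bound; exists (B ^+ 2); first exact: exprn_gt0.
move=> n k s e n0 He.
have mt (i : 'I_n) : bmfun (fun w => err k i w * true_score s i w).
  by apply: bmfunM; [exact: bmfun_err|exact: bmfun_true_score].
have -> : \int[Pr]_w (cross_term n k s w ^+ 2) =
    n%:R^-1 * \sum_(i < n) \int[Pr]_w ((err k i w * true_score s i w) ^+ 2).
  rewrite (_ : (fun w => _) = fun w => n%:R^-1 * (\sum_(i < n) \sum_(j < n)
      (err k i w * true_score s i w) * (err k j w * true_score s j w))).
    rewrite RintegralZb; last first.
      by apply: bmfun_sum => i; apply: bmfun_sum => j; exact: bmfunM.
    congr (_ * _); rewrite Rintegral_sumb; last first.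
      by move=> i; apply: bmfun_sum => j; exact: bmfunM.
    apply: eq_bigr => i _; rewrite Rintegral_sumb; last by move=> j; exact: bmfunM.
    rewrite (bigD1 i)//= big1 ?addr0 => [|j ji]; last by rewrite cross_moment// eq_sym.
    by congr Rintegral; apply/funext => w; rewrite expr2.
  apply/funext => w; rewrite /cross_term exprMn exprVn sqr_sqrtr ?ler0n//.
  congr (_ * _); rewrite expr2 mulr_suml; apply: eq_bigr => i _.
  by rewrite mulr_sumr.
apply: (@le_trans _ _ (n%:R^-1 * \sum_(i < n) (B ^+ 2 * e))); last first.
  rewrite sumr_const card_ord; set c := B ^+ 2 * e.
  by rewrite -(mulr_natl c n) mulKf// pnatr_eq0 -lt0n.
apply: ler_wpM2l; first by rewrite invr_ge0 ler0n.
apply: ler_sum => i _; apply: (@le_trans _ _ (\int[Pr]_w (B ^+ 2 * err k i w ^+ 2))).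
  apply: le_Rintegralb; first exact: bmfunX.
    by apply: bmfunZ; apply: bmfunX; exact: bmfun_err.
  move=> w; rewrite exprMn mulrC; apply: ler_wpM2r; first exact: sqr_ge0.
  rewrite -[leLHS]real_normK ?num_real//; apply: lerXn2r; rewrite ?nnegrE//.
  exact: ltW.
rewrite RintegralZb; last by apply: bmfunX; exact: bmfun_err.
by apply: ler_wpM2l => //; exact: sqr_ge0.
Qed.

Hypotheses (g_cvg : g @ \oo --> (0 : R)) (bandO : bigO_P Pr band_error g).

(** The errors are bounded uniformly in n, so smallness in probability passes to second
    moments. *)
Lemma err_sq_small (e : R) : 0 < e -> exists N, forall n, (N <= n)%N ->
  forall k (i : 'I_n), \int[Pr]_w (err k i w ^+ 2) <= e.
Proof.
move=> e0; have [L L0 HL] := err_bound.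
have [B B0 HB] : exists2 B, 0 < B & forall n k (i : 'I_n) w, `|err k i w| <= B.
  have HBk k : exists B, forall u, `|clip_score phi k u| <= B.
    by have [_] := bmfun_clip_score hq hphi k.
  have [B BP] := choice HBk; exists (1 + \sum_k (`|B k| + `|B k|)).
    by rewrite ltr_pwDl// sumr_ge0// => k _; rewrite addr_ge0.
  move=> n k i w; apply: (le_trans (ler_normB _ _)).
  apply: (@le_trans _ _ (`|B k| + `|B k|)).
    by apply: lerD; apply: (le_trans (BP k _)); exact: ler_norm.
  by rewrite (bigD1 k)//= addrCA lerDl addr_ge0// sumr_ge0.
pose eta := e / 2; have eta0 : 0 < eta by rewrite divr_gt0.
pose e1 := eta / B ^+ 2; have e10 : 0 < e1 by rewrite divr_gt0// exprn_gt0.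
have [M M0 HM] := bigO_P_event bandO e10.
pose dl := Num.min 1 eta / (L * M).
have dl0 : 0 < dl by rewrite divr_gt0 ?lt_min ?ltr01// mulr_gt0.
move/cvgr0Pnorm_lt : g_cvg => /(_ dl dl0)[N _ HN].
exists (maxn N 1) => n; rewrite geq_max => /andP[Nn n0] k i.
pose A := [set w | eta < err k i w ^+ 2].
have m2 : bmfun (fun w => err k i w ^+ 2) by apply: bmfunX; exact: bmfun_err.
have mA : measurable A.
  rewrite (_ : A = (fun w => err k i w ^+ 2) @^-1` `]eta, +oo[%classic).
    by rewrite -[X in measurable X]setTI; apply: (bmfun_measurable m2).
  by apply/seteqP; split => w; rewrite /A/= in_itv/= andbT.
have PA : fine (Pr A) <= e1.
  rewrite -lee_fin fineK ?fin_num_measure//.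
  apply: le_trans (HM n n0); apply: le_outer_measure => // w; rewrite /A/= => Aw.
  rewrite ltNge; apply/negP => /HL/(_ k i) errL.
  have gn : `|g n| < dl by exact: (HN n Nn).
  have gL : L * (M * `|g n|) <= Num.min 1 eta.
    by rewrite mulrA -ler_pdivlMl ?mulr_gt0// mulrC ltW.
  have em : `|err k i w| <= Num.min 1 eta by exact: le_trans errL gL.
  move: Aw; rewrite ltNge => /negP; apply.
  rewrite -real_normK ?num_real// expr2.
  move: em; rewrite le_min => /andP[em1 em2].
  by rewrite -[leRHS]mulr1; apply: ler_pM.
apply: (@le_trans _ _ (\int[Pr]_w (eta + B ^+ 2 * \1_A w))).
  apply: le_Rintegralb => //.
    apply: bmfunD; first exact: bmfun_cst.
    by apply: bmfunZ; exact: bmfun_indic.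
  move=> w; rewrite indicE; case: (boolP (w \in A)) => [_|].
    rewrite mulr1 ler_wpDl ?(ltW eta0)// -[leLHS]real_normK ?num_real//.
    by apply: lerXn2r; rewrite ?nnegrE// ltW.
  by rewrite notin_setE /A/= => /negP; rewrite -leNgt mulr0 addr0.
rewrite RintegralDb; [|exact: bmfun_cst|by apply: bmfunZ; exact: bmfun_indic].
rewrite Rintegral_cstb RintegralZb ?Rintegral_indicb//; last exact: bmfun_indic.
have : B ^+ 2 * fine (Pr A) <= eta.
  by rewrite -ler_pdivlMl ?exprn_gt0// mulrC.
by rewrite /eta; lra.
Qed.

Lemma cross_term_small (e : R) : 0 < e -> exists N, forall n, (N <= n)%N ->
  forall k s, \int[Pr]_w (cross_term n k s w ^+ 2) <= e.
Proof.
move=> e0; have [B B0 HB] := cross_term_sq.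
have [N HN] := err_sq_small (divr_gt0 e0 B0).
exists (maxn N 1) => n; rewrite geq_max => /andP[Nn n0] k s.
rewrite -(divfK (lt0r_neq0 B0) e) mulrC; apply: HB => // i.
exact: HN.
Qed.

End estimated_scores.

(** * Negligible remainders *)

Section negligible_seq.
Context {R : realType} {d : measure_display} {T : measurableType d}.
Variable Pr : probability T R.
Implicit Types Y Z : nat -> T -> R.

(** Convergence to 0 in probability, metrised by the truncated mean so that sums
    are handled by the triangle inequality. *)
Definition negligible_seq Y := forall e : R, 0 < e ->
  exists N, forall n, (N <= n)%N -> \int[Pr]_w Num.min 1 `|Y n w| <= e.

Lemma bmfun_trunc (f : T -> R) : bmfun f -> bmfun (fun w => Num.min 1 `|f w|).
Proof.
move=> mf; split.
  apply: measurable_minr; first exact: measurable_cst.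
  by case: (bmfun_norm mf).
by exists 1 => w; rewrite ger0_norm ?ge_min ?lexx// le_min ler01 normr_ge0.
Qed.

Lemma negligible_seqD Y Z : (forall n, bmfun (Y n)) -> (forall n, bmfun (Z n)) ->
  negligible_seq Y -> negligible_seq Z ->
  negligible_seq (fun n w => Y n w + Z n w).
Proof.
move=> mY mZ Y0 Z0 e e0; have e20 : 0 < e / 2 by rewrite divr_gt0.
have [N HN] := Y0 _ e20; have [N' HN'] := Z0 _ e20.
exists (maxn N N') => n; rewrite geq_max => /andP[/HN Yn /HN' Zn].
have mtY := bmfun_trunc (mY n); have mtZ := bmfun_trunc (mZ n).
apply: (@le_trans _ _ (\int[Pr]_w (Num.min 1 `|Y n w| + Num.min 1 `|Z n w|))).
  apply: le_Rintegralb; [by apply: bmfun_trunc; exact: bmfunD|exact: bmfunD|].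
  move=> w; have := ler_normD (Y n w) (Z n w).
  rewrite !minEle; have := normr_ge0 (Y n w); have := normr_ge0 (Z n w).
  by case: (leP 1 `|Y n w + Z n w|) => ?; case: (leP 1 `|Y n w|) => ?;
    case: (leP 1 `|Z n w|) => ?; lra.
rewrite RintegralDb//; lra.
Qed.

Lemma negligible_seqZ (a : R) Y : (forall n, bmfun (Y n)) -> negligible_seq Y ->
  negligible_seq (fun n w => a * Y n w).
Proof.
move=> mY Y0 e e0; have a1 : 0 < `|a| + 1 by rewrite ltr_wpDl.
have [N HN] := Y0 _ (divr_gt0 e0 a1); exists N => n /HN Yn.
have mtY := bmfun_trunc (mY n).
apply: (@le_trans _ _ (\int[Pr]_w ((`|a| + 1) * Num.min 1 `|Y n w|))).
  apply: le_Rintegralb; [by apply: bmfun_trunc; exact: bmfunZ|exact: bmfunZ|].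
  move=> w; rewrite normrM; have := normr_ge0 (Y n w); have := normr_ge0 a.
  rewrite !minEle => x0 y0; have := mulr_ge0 x0 y0.
  by case: (leP 1 (`|a| * `|Y n w|)) => ?; case: (leP 1 `|Y n w|) => ?; lra.
rewrite RintegralZb//; move: Yn; rewrite ler_pdivlMr// mulrC; lra.
Qed.

Lemma negligible_seq_sum (I : Type) (r : seq I) (Y : I -> nat -> T -> R) :
  (forall i n, bmfun (Y i n)) -> (forall i, negligible_seq (Y i)) ->
  negligible_seq (fun n w => \sum_(i <- r) Y i n w).
Proof.
move=> mY Y0; elim: r => [|i r IH].
  move=> e e0; exists 0%N => n _.
  rewrite (_ : (fun w => _) = fun=> 0) ?Rintegral_cstb ?ltW//.
  by apply/funext => w; rewrite big_nil normr0 minEle ler10.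
rewrite (_ : (fun n w => _) = fun n w => Y i n w + \sum_(j <- r) Y j n w).
  by apply: negligible_seqD => // n; exact: bmfun_sum.
by apply/funext => n; apply/funext => w; rewrite big_cons.
Qed.

Lemma negligible_seq_L2 Y : (forall n, bmfun (Y n)) ->
  (forall e : R, 0 < e -> exists N, forall n, (N <= n)%N ->
    \int[Pr]_w (Y n w ^+ 2) <= e) -> negligible_seq Y.
Proof.
move=> mY Y0 e e0; pose eta := e / 2; have eta0 : 0 < eta by rewrite divr_gt0.
have [N HN] := Y0 (eta ^+ 2) (exprn_gt0 _ eta0); exists N => n /HN Yn.
have m2 := bmfunX 2 (mY n); have mtY := bmfun_trunc (mY n).
apply: (@le_trans _ _ (\int[Pr]_w (eta + eta^-1 * Y n w ^+ 2))).
  apply: le_Rintegralb => //.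
    by apply: bmfunD; [exact: bmfun_cst|exact: bmfunZ].
  move=> w; rewrite ge_min; apply/orP; right.
  (* either |y| <= eta, or |y| <= |y| (|y| / eta) *)
  rewrite -[Y n w ^+ 2]real_normK ?num_real//.
  have y0 := normr_ge0 (Y n w); move: `|Y n w| y0 => y y0.
  have [h|h] := leP y eta; first by rewrite ler_wpDr// mulr_ge0 ?sqr_ge0 ?invr_ge0 ?ltW.
  apply: (@le_trans _ _ (eta^-1 * y ^+ 2)); last by rewrite lerDr ltW.
  by rewrite ler_pdivlMl// expr2 ler_wpM2r// ltW.
rewrite RintegralDb; [|exact: bmfun_cst|exact: bmfunZ].
rewrite Rintegral_cstb RintegralZb//.
have : eta^-1 * \int[Pr]_w (Y n w ^+ 2) <= eta.
  by rewrite ler_pdivrMl// -expr2.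
by rewrite /eta; lra.
Qed.

(** An outer probability is enough, since the event that Y is large is measurable. *)
Lemma negligible_seq_outer Y : (forall n, bmfun (Y n)) ->
  (forall e : R, 0 < e -> exists N, forall n, (N <= n)%N -> exists B : set T,
    (mu_ext Pr B <= e%:E)%E /\ forall w, ~ B w -> `|Y n w| <= e) ->
  negligible_seq Y.
Proof.
move=> mY Y0 e e0; have e20 : 0 < e / 2 by rewrite divr_gt0.
have [N HN] := Y0 _ e20; exists N => n /HN[B [PB HB]].
pose A := [set w | e / 2 < `|Y n w|].
have mA : measurable A.
  rewrite (_ : A = (fun w => `|Y n w|) @^-1` `](e / 2), +oo[%classic).
    by rewrite -[X in measurable X]setTI; apply: (bmfun_measurable (bmfun_norm (mY n))).
  by apply/seteqP; split => w; rewrite /A/= in_itv/= andbT.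
have PA : fine (Pr A) <= e / 2.
  rewrite -lee_fin fineK ?fin_num_measure//; apply: le_trans PB.
  apply: le_outer_measure => // w; rewrite /A/= => Aw.
  by apply: contrapT => /HB; rewrite leNgt Aw.
apply: (@le_trans _ _ (\int[Pr]_w (e / 2 + \1_A w))).
  apply: le_Rintegralb.
  - exact: bmfun_trunc.
  - by apply: bmfunD; [exact: bmfun_cst|exact: bmfun_indic].
  - move=> w; rewrite indicE ge_min; case: (boolP (w \in A)) => [_|].
      by rewrite lerDr ltW.
    by rewrite notin_setE /A/= => /negP; rewrite -leNgt addr0 => ->; rewrite orbT.
rewrite RintegralDb; [|exact: bmfun_cst|exact: bmfun_indic].
by rewrite Rintegral_cstb Rintegral_indicb//; lra.
Qed.

End negligible_seq.

Section gaussian_lipschitz.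
Context {R : realType} {I : finType}.
Variable s : R.
Hypothesis s0 : 0 < s.
Let G (x : I -> R) := expR (- (s * sqnorm x / 2)).

Let G_le1 x : G x <= 1.
Proof.
rewrite -[leRHS]expR0 ler_expR oppr_le0 divr_ge0// mulr_ge0 ?sqnorm_ge0//.
exact: ltW.
Qed.

(** From 1 + t <= exp t; the factor exp (- s |x|^2 / 2) absorbs the term linear in x. *)
Let one_sided (x r : I -> R) : (forall i, `|r i| <= 1) ->
  G x - G (fun i => x i + r i) <= (1 + s) * \sum_i `|r i|.
Proof.
move=> r1; set y := fun i => x i + r i.
have h : G x * (1 - (s * sqnorm y / 2 - s * sqnorm x / 2)) <= G y.
  have -> : G y = G x * expR (- (s * sqnorm y / 2 - s * sqnorm x / 2)).
    by rewrite -expRD; congr expR; ring.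
  by rewrite ler_wpM2l ?expR_ge0// expR_ge1Dx.
apply: (@le_trans _ _ (G x * (s * sqnorm y / 2 - s * sqnorm x / 2))); first lra.
have -> : s * sqnorm y / 2 - s * sqnorm x / 2 =
    \sum_i s / 2 * (2 * x i * r i + r i ^+ 2).
  rewrite -mulr_sumr -mulrBl -mulrBr mulrAC; congr (_ * _).
  by rewrite /sqnorm -sumrB; apply: eq_bigr => i _; rewrite /y; ring.
rewrite !mulr_sumr; apply: ler_sum => i _.
have xi2 : G x * x i ^+ 2 <= 2 / s.
  have : expR (- (s * x i ^+ 2 / 2)) * (s * x i ^+ 2 / 2) <= 1.
    rewrite mulrC expRN ler_pdivrMr ?expR_gt0// mul1r.
    by have := expR_ge1Dx (s * x i ^+ 2 / 2); lra.
  have Gi : G x <= expR (- (s * x i ^+ 2 / 2)).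
    rewrite ler_expR lerN2 ler_wpM2r// ler_wpM2l ?(ltW s0)//.
    rewrite /sqnorm (bigD1 i)//= lerDl sumr_ge0// => j _; exact: sqr_ge0.
  rewrite ler_pdivlMr// => e1.
  have : G x * (s * x i ^+ 2 / 2) <= expR (- (s * x i ^+ 2 / 2)) * (s * x i ^+ 2 / 2).
    by rewrite ler_wpM2r// divr_ge0// mulr_ge0 ?sqr_ge0// ltW.
  lra.
have G0 : 0 <= G x by exact: expR_ge0.
have G1 := G_le1 x.
have bound : 2 * x i * r i + r i ^+ 2 <= (x i ^+ 2 + 2) * `|r i|.
  have ri0 := normr_ge0 (r i).
  have q1 : r i ^+ 2 <= `|r i|.
    by rewrite -real_normK ?num_real// expr2 -[leRHS]mulr1 ler_wpM2l.
  have q2 : 2 * x i * r i <= (x i ^+ 2 + 1) * `|r i|.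
    apply: (le_trans (ler_norm _)); rewrite normrM; apply: ler_wpM2r => //.
    by rewrite normrM gtr0_norm// -[X in _ <= X + _]real_normK ?num_real//;
      have := sqr_ge0 (`|x i| - 1); rewrite !expr2; lra.
  by move: q1 q2; rewrite !mulrDl; lra.
apply: (@le_trans _ _ (G x * (s / 2 * ((x i ^+ 2 + 2) * `|r i|)))).
  by rewrite ler_wpM2l// ler_wpM2l// divr_ge0// ltW.
have -> : G x * (s / 2 * ((x i ^+ 2 + 2) * `|r i|)) =
  (s / 2 * (G x * x i ^+ 2 + 2 * G x)) * `|r i| by ring.
apply: ler_wpM2r => //.
apply: (@le_trans _ _ (s / 2 * (2 / s + 2))).
  by rewrite ler_wpM2l ?divr_ge0 ?(ltW s0)//; lra.
by rewrite le_eqVlt; apply/orP; left; apply/eqP; field; rewrite gt_eqF.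
Qed.

(** Large displacements cost at most 1, the range of the profile. *)
Lemma gaussian_lipschitz (x r : I -> R) :
  `|G (fun i => x i + r i) - G x| <= (1 + s) * \sum_i Num.min 1 `|r i|.
Proof.
have G01 y : 0 <= G y <= 1 by rewrite expR_ge0 G_le1.
have [/forallP r1|/forallPn[i ri]] := boolP [forall i, `|r i| <= 1].
  have -> : \sum_i Num.min 1 `|r i| = \sum_i `|r i|.
    by apply: eq_bigr => i _; rewrite (min_idPr (r1 i)).
  rewrite ler_norml; apply/andP; split.
    by rewrite -opprB lerN2; exact: one_sided.
  have := @one_sided (fun i => x i + r i) (fun i => - r i).
  have -> : (fun i => x i + r i + - r i) = x by apply/funext => i; rewrite addrK.
  under eq_bigr do rewrite normrN.
  by apply => i; rewrite normrN.
move: ri; rewrite -ltNge => ri.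
apply: (@le_trans _ _ 1).
  have := G01 x; have := G01 (fun i => x i + r i) => /andP[? ?] /andP[? ?].
  by rewrite ler_norml; apply/andP; split; lra.
apply: (@le_trans _ _ (\sum_i Num.min 1 `|r i|)).
  by rewrite (bigD1 i)//= (min_idPl (ltW ri)) lerDl sumr_ge0.
by rewrite ler_peMl ?lerDl ?(ltW s0)// sumr_ge0.
Qed.

End gaussian_lipschitz.

(** * Quantiles of atomless laws on the half-line *)

(** The distribution function is continuous, so the level p is hit exactly. *)
Lemma quantile_atomless {R : realType} (mu : probability (measurableTypeR R) R)
    (p : R) :
  mu `]-oo, (0 : R)[%classic = 0%E -> (forall x : R, mu [set x] = 0%E) ->
  0 < p < 1 ->
  0 < quantile mu p /\ mu `]-oo, quantile mu p]%classic = p%:E.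
Proof.
move=> mu0 mu1 /andP[p0 p1].
pose RB := measurableTypeR R.
pose Q := [set x : R | (p%:E <= mu `]-oo, x]%classic)%E].
pose c := quantile mu p.
have closed_open x : mu `]-oo, x]%classic = mu `]-oo, x[%classic.
  rewrite -(@setUitv1 _ _ _ _ true) ?bnd_simp// measureU//.
    by rewrite [X in (_ + X)%E](_ : _ = 0%E) ?adde0//; exact: mu1.
  by apply/seteqP; split => // y [/=]; rewrite in_itv/= => yx yE; move: yx; rewrite yE ltxx.
have mono x y : x <= y -> (mu `]-oo, x]%classic <= mu `]-oo, y]%classic)%E.
  by move=> xy; apply: le_measure; rewrite ?inE//; exact: subitvPr.
have Qpos x : Q x -> 0 < x.
  rewrite /Q/= => px; rewrite ltNge; apply/negP => x0.
  have := le_trans px (mono _ _ x0); rewrite closed_open mu0 lee_fin.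
  by rewrite leNgt p0.
have Qne : Q !=set0.
  pose F n : set RB := `]-oo, n%:R]%classic.
  have cupF : \bigcup_n F n = setT.
    apply/seteqP; split => // x _; exists (Num.truncn x).+1 => //=.
    by rewrite /F/= in_itv/= ltW// truncnS_gt.
  have FT : mu \o F @ \oo --> mu (\bigcup_n F n).
    apply: nondecreasing_cvg_mu.
    - by move=> n; exact: measurable_itv.
    - by rewrite cupF.
    - move=> n m nm; rewrite subsetEset => x; rewrite /F/= !in_itv/=.
      by move/le_trans; apply; rewrite ler_nat.
  rewrite cupF probability_setT in FT.
  have fT : fine \o (mu \o F) @ \oo --> (1 : R) by exact: fine_cvg.
  have p10 : 0 < 1 - p by rewrite subr_gt0.
  move/cvgrPdist_lt : fT => /(_ _ p10)[n _ /(_ n (leqnn n))]/= fn.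
  exists n%:R; rewrite /Q/= -[leRHS]fineK ?fin_num_measure// lee_fin.
  by move: fn; rewrite ltr_norml => /andP[_]; rewrite /F; lra.
have Qinf : has_inf Q by split => //; exists 0 => x /Qpos/ltW.
have c0 : 0 <= c by apply: lb_le_inf => // x /Qpos/ltW.
have upper : (p%:E <= mu `]-oo, c]%classic)%E.
  pose F n : set RB := `]-oo, (c + n.+1%:R^-1)]%classic.
  have capF : \bigcap_n F n = `]-oo, c]%classic.
    apply/seteqP; split => x /=; rewrite in_itv/=.
      move=> Fx; apply/ler_addgt0Pr => e e0.
      have [n] := ltr_add_invr e0; rewrite add0r => ne.
      by have := Fx n I; rewrite /F/= in_itv/= => /le_trans; apply; rewrite lerD2l ltW.
    by move=> xc n _; rewrite /F/= in_itv/= (le_trans xc)// lerDl invr_ge0.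
  have Fc : mu \o F @ \oo --> mu (\bigcap_n F n).
    apply: nonincreasing_cvg_mu.
    - apply: le_lt_trans (ltry 1); apply: probability_le1; exact: measurable_itv.
    - by move=> n; exact: measurable_itv.
    - by rewrite capF; exact: measurable_itv.
    - move=> n m nm; rewrite subsetEset => x; rewrite /F/= !in_itv/=.
      by move/le_trans; apply; rewrite lerD2l lef_pV2 ?posrE// ler_nat.
  rewrite -capF -(cvg_lim _ Fc)//; apply: lime_ge.
    by apply/cvg_ex; exists (mu (\bigcap_n F n)).
  apply: nearW => n /=.
  have n0 : (0 : R) < n.+1%:R^-1 by rewrite invr_gt0.
  have [x Qx xc] := inf_adherent n0 Qinf.
  by apply: le_trans Qx _; apply: mono; exact: ltW.
have lower : (mu `]-oo, c]%classic <= p%:E)%E.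
  rewrite closed_open.
  pose F n : set RB := `]-oo, (c - n.+1%:R^-1)]%classic.
  have cupF : \bigcup_n F n = `]-oo, c[%classic.
    apply/seteqP; split => x /=; rewrite in_itv/=.
      by move=> [n _]; rewrite /F/= in_itv/= => /le_lt_trans; apply; rewrite gtrBl invr_gt0.
    move=> xc; have xc0 : 0 < c - x by rewrite subr_gt0.
    have [n] := ltr_add_invr xc0; rewrite add0r => nx.
    by exists n => //; rewrite /F/= in_itv/= lerBrDr -lerBrDl ltW.
  have Fc : mu \o F @ \oo --> mu (\bigcup_n F n).
    apply: nondecreasing_cvg_mu.
    - by move=> n; exact: measurable_itv.
    - by rewrite cupF; exact: measurable_itv.
    - move=> n m nm; rewrite subsetEset => x; rewrite /F/= !in_itv/=.
      by move/le_trans; apply; rewrite lerD2l lerN2 lef_pV2 ?posrE// ler_nat.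
  rewrite -cupF -(cvg_lim _ Fc)//; apply: lime_le.
    by apply/cvg_ex; exists (mu (\bigcup_n F n)).
  apply: nearW => n /=; rewrite leNgt; apply/negP => pF.
  have := ge_inf (proj2 Qinf) (ltW pF : Q (c - n.+1%:R^-1)).
  by rewrite -/c -[inf _]/c; rewrite lerBrDr gerDl leNgt invr_gt0 ltr0n.
have cE : mu `]-oo, c]%classic = p%:E by apply/eqP; rewrite eq_le upper lower.
split => //; rewrite lt_neqAle c0 andbT; apply/eqP => c00.
have cz : c = 0 := esym c00.
by move: cE; rewrite closed_open cz mu0 => -[] p00; move: p0; rewrite -p00 ltxx.
Qed.

(** * The test statistic as a perturbed sum of independent vectors *)

(** Slutsky's lemma for Laplace transforms of squared norms. *)
Lemma laplace_negligible {R : realType} {d} {T : measurableType d} {I : finType}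
    (Pr : probability T R) (x r : nat -> I -> T -> R) (s l : R) : 0 < s ->
  (forall n i, bmfun (x n i)) -> (forall n i, bmfun (r n i)) ->
  (forall i, negligible_seq Pr (fun n => r n i)) ->
  (fun n => \int[Pr]_w expR (- (s * sqnorm (x n ^~ w) / 2))) @ \oo --> l ->
  (fun n => \int[Pr]_w expR (- (s * sqnorm (fun i => x n i w + r n i w) / 2)))
    @ \oo --> l.
Proof.
move=> s0 mx mr r0 xl.
have mG (y : I -> T -> R) : (forall i, bmfun (y i)) ->
    bmfun (fun w => expR (- (s * sqnorm (y ^~ w) / 2))).
  move=> my; apply: (bmfun_continuous_comp (@continuous_expR R)).
    have mq : bmfun (fun w => sqnorm (y ^~ w)).
      by apply: bmfun_sum => i; exact: bmfunX.
    apply: (@bmfun_measurable _ _ _ (fun w => - (s * sqnorm (y ^~ w) / 2))).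
    under eq_fun do rewrite mulrAC -mulNr; exact: bmfunZ.
  exists 1 => w; rewrite ger0_norm ?expR_ge0// -[leRHS]expR0 ler_expR oppr_le0.
  by rewrite divr_ge0// mulr_ge0 ?sqnorm_ge0// ltW.
have mt n i := bmfun_trunc (mr n i).
rewrite (_ : (fun n => _) = fun n => \int[Pr]_w expR (- (s * sqnorm (x n ^~ w) / 2)) +
    (\int[Pr]_w expR (- (s * sqnorm (fun i => x n i w + r n i w) / 2)) -
     \int[Pr]_w expR (- (s * sqnorm (x n ^~ w) / 2)))); last first.
  by apply/funext => n; rewrite addrC subrK.
rewrite -[X in _ --> X]addr0; apply: cvgD => //.
apply/cvgr0Pnorm_lt => e e0.
pose c : R := (1 + s) * (#|I|%:R + 1).
have c0 : 0 < c by rewrite mulr_gt0// ltr_wpDl.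
pose e1 := e / (2 * c); have e10 : 0 < e1 by rewrite divr_gt0// mulr_gt0.
have [N HN] := choice (fun i => r0 i e1 e10).
exists (\max_i N i)%N => //= n /= nN.
rewrite -RintegralBb; [|by apply: (@mG (fun i w => x n i w + r n i w)) => i; exact: bmfunD
  |exact: mG].
apply: (@le_lt_trans _ _ (\int[Pr]_w ((1 + s) * \sum_i Num.min 1 `|r n i w|))).
  apply: Rintegral_norm_le.
  - apply: bmfunB; last exact: mG.
    by apply: (@mG (fun i w => x n i w + r n i w)) => i; exact: bmfunD.
  - by apply: bmfunZ; exact: bmfun_sum.
  - by move=> w; exact: (gaussian_lipschitz s0 (x n ^~ w)).
rewrite RintegralZb; last exact: bmfun_sum.
rewrite Rintegral_sumb//.
apply: (@le_lt_trans _ _ ((1 + s) * (#|I|%:R * e1))).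
  apply: ler_wpM2l; first by rewrite addr_ge0// ltW.
  rewrite [leRHS]mulr_natl -sumr_const; apply: ler_sum => i _; apply: HN.
  by apply: leq_trans nN; exact: leq_bigmax.
apply: (@le_lt_trans _ _ (c * e1)).
  rewrite /c -!mulrA ler_wpM2l ?addr_ge0 ?(ltW s0)// ler_wpM2r ?(ltW e10)//.
  by rewrite lerDl.
have -> : c * e1 = e / 2 by rewrite /e1; field; rewrite gt_eqF.
by rewrite ltr_pdivrMr// ltr_pMr// ltr1n.
Qed.

Section orthonormal_scores.
Context {R : realType} {q : nat}.
Variable phi : 'I_q -> R -> R.
Hypotheses (hq : (0 < q)%N) (hphi : score_functions phi).
Local Notation S := (inv_sqrtmx (Sigma phi)).

Lemma inv_sqrt_Sigma : S^T = S /\ S *m Sigma phi *m S = 1%:M.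
Proof.
have := Sigma_posdef hq hphi; case: q phi hq => // q' phi' _.
exact: inv_sqrtmxP.
Qed.

(** The scores, orthonormalised in L2 of the uniform law. *)
Definition orth_score (k : 'I_q) (u : measurableTypeR R) : R :=
  \sum_l S k l * clip_score phi l u.

Lemma bmfun_orth_score k : bmfun (orth_score k).
Proof. by apply: bmfun_sum => l; apply: bmfunZ; exact: bmfun_clip_score. Qed.

Lemma uniform_orth_score k :
  \int[uniform_prob (@ltr01 R)]_u orth_score k u = 0.
Proof.
rewrite Rintegral_sumb => [|l]; last by apply: bmfunZ; exact: bmfun_clip_score.
rewrite big1// => l _; rewrite RintegralZb ?uniform_clip_score ?mulr0//.
exact: bmfun_clip_score.
Qed.

Lemma uniform_orth_scoreM k l :
  \int[uniform_prob (@ltr01 R)]_u (orth_score k u * orth_score l u) = (k == l)%:R.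
Proof.
have mM i j : bmfun (fun u : measurableTypeR R => clip_score phi i u * clip_score phi j u).
  by apply: bmfunM; exact: bmfun_clip_score.
have [ST SS] := inv_sqrt_Sigma.
have -> : (k == l)%:R = (S *m Sigma phi *m S) k l by rewrite SS mxE.
rewrite (_ : (fun u => _) = fun u => \sum_j \sum_i (S k i * S l j) *
    (clip_score phi i u * clip_score phi j u)); last first.
  apply/funext => u; rewrite mulr_sumr; apply: eq_bigr => j _.
  by rewrite mulr_suml; apply: eq_bigr => i _; ring.
rewrite Rintegral_sumb => [|j]; last by apply: bmfun_sum => i; exact: bmfunZ.
rewrite mxE; apply: eq_bigr => j _.
rewrite Rintegral_sumb => [|i]; last exact: bmfunZ.
rewrite mxE mulr_suml; apply: eq_bigr => i _.
rewrite RintegralZb// uniform_clip_scoreM// -[in S l j]ST [S^T l j]mxE.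
by rewrite mulrAC.
Qed.

End orthonormal_scores.

Section null_sample.
Context {R : realType} {d q : nat} {dO : measure_display}
  {Omega : measurableType dO}.
Variables (Pr : probability Omega R) (W : nat -> Omega -> obs R d)
  (P : probability (obs R d) R) (KX KY : R.-pker (covariate R d) ~> R)
  (phi : 'I_q -> R -> R) (FX FY : cdf_estimator R d) (g h : nat -> R).
Local Notation VX := (fun w : obs R d => w.1.1).
Local Notation VY := (fun w : obs R d => w.1.2).
Local Notation UX := (residual VX KX).
Local Notation UY := (residual VY KY).
Local Notation S := (inv_sqrtmx (Sigma phi)).
Local Notation I := ('I_q * 'I_q)%type.
Hypotheses (hW : forall i w, obs_cube (W i w)) (iidW : iid_sample Pr W P)
  (hq : (0 < q)%N) (hphi : score_functions phi)
  (hFX : is_cdf_estimator FX) (hFY : is_cdf_estimator FY)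
  (hKX : continuous_cond_law P VX KX) (hKY : continuous_cond_law P VY KY)
  (Pcube : P obs_cube = 1%E) (ci : cond_indep P).

Let mVX : measurable_fun setT VX.
Proof. exact: (measurableT_comp measurable_fst measurable_fst). Qed.

Let mVY : measurable_fun setT VY.
Proof. exact: (measurableT_comp measurable_snd measurable_fst). Qed.

Let Pcube2 : P [set w | cube w.2] = 1%E.
Proof.
apply/eqP; rewrite eq_le probability_le1 /=; last first.
  rewrite -[X in measurable X]setTI.
  exact: (measurable_snd _ _ measurable_cube).
rewrite -Pcube; apply: le_measure; rewrite ?inE.
- rewrite (_ : obs_cube = ((`[0, 1]%classic : set R) `*` `[0, 1]%classic) `*` cube).
    by apply: measurableX; [exact: measurableX|exact: measurable_cube].
  by apply/seteqP; split => w; [case=> ? ? ?; split|case=> -[? ?] ?; split].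
- rewrite -[X in measurable X]setTI.
  exact: (measurable_snd _ _ measurable_cube).
- by move=> w [].
Qed.

Let indepXY (f : measurableTypeR R -> R) (k : R * covariate R d -> R) :
  bmfun f -> bmfun k ->
  \int[P]_w (f (UY w) * k (w.1.1, w.2)) =
  \int[uniform_prob (@ltr01 R)]_u f u * \int[P]_w k (w.1.1, w.2).
Proof.
apply: (residual_indep mVX mVY Pcube2 hKY) => A B mA mB.
by apply: ci => //; [exact: hKX.1|exact: hKY.1].
Qed.

Let indepYX (f : measurableTypeR R -> R) (k : R * covariate R d -> R) :
  bmfun f -> bmfun k ->
  \int[P]_w (f (UX w) * k (w.1.2, w.2)) =
  \int[uniform_prob (@ltr01 R)]_u f u * \int[P]_w k (w.1.2, w.2).
Proof.
apply: (residual_indep mVY mVX Pcube2 hKX) => A B mA mB.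
rewrite (_ : [set w | _ /\ _] = [set w | B w.1.1 /\ A w.1.2]); last first.
  by apply/seteqP; split => w [].
rewrite (_ : (fun z => _) = fun z => fine (KX z B) * fine (KY z A)); last first.
  by apply/funext => z; rewrite mulrC.
by apply: ci => //; [exact: hKX.1|exact: hKY.1].
Qed.

(** The summand of the oracle statistic, flattened from a q by q matrix. *)
Definition oracle (p : I) (w : obs R d) : R :=
  orth_score phi p.1 (UX w) * orth_score phi p.2 (UY w).

Let mUX : measurable_fun setT UX. Proof. exact: measurable_residual. Qed.
Let mUY : measurable_fun setT UY. Proof. exact: measurable_residual. Qed.

Lemma bmfun_oracle p : bmfun (oracle p).
Proof.
by apply: bmfunM; [apply: bmfun_comp mUX _|apply: bmfun_comp mUY _];
  exact: bmfun_orth_score.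
Qed.

Let mcdfX : measurable_fun setT (fun v : R * covariate R d => cond_cdf KX v.1 v.2).
Proof.
exact: (measurableT_comp (measurable_cond_cdf KX)
  (measurable_fun_pair measurable_snd measurable_fst)).
Qed.

Lemma oracle_mean p : \int[P]_w oracle p w = 0.
Proof.
rewrite /oracle; under eq_Rintegral do rewrite mulrC.
have mk : bmfun (fun v : R * covariate R d => orth_score phi p.1 (cond_cdf KX v.1 v.2)).
  by apply: bmfun_comp mcdfX _; exact: bmfun_orth_score.
have := indepXY (bmfun_orth_score hq hphi p.2) mk.
by rewrite uniform_orth_score// mul0r.
Qed.

(** Each factor is integrated against the uniform law in turn, so the covariance of the
    products is the product of the two covariances. *)
Lemma oracle_cov p r : \int[P]_w (oracle p w * oracle r w) = (p == r)%:R.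
Proof.
have mM k l : bmfun (fun u : measurableTypeR R => orth_score phi k u * orth_score phi l u).
  by apply: bmfunM; exact: bmfun_orth_score.
rewrite (_ : (fun w => _) = fun w =>
    (orth_score phi p.2 (UY w) * orth_score phi r.2 (UY w)) *
    (orth_score phi p.1 (UX w) * orth_score phi r.1 (UX w))); last first.
  by apply/funext => w; rewrite /oracle; ring.
have mk : bmfun (fun v : R * covariate R d =>
    orth_score phi p.1 (cond_cdf KX v.1 v.2) * orth_score phi r.1 (cond_cdf KX v.1 v.2)).
  exact: bmfun_comp mcdfX (mM p.1 r.1).
have := indepXY (mM p.2 r.2) mk; rewrite uniform_orth_scoreM// => ->.
have := indepYX (mM p.1 r.1) (bmfun_cst 1).
rewrite uniform_orth_scoreM// Rintegral_cstb mulr1.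
under [X in X = _ -> _]eq_Rintegral do rewrite mulr1.
move=> ->; rewrite -natrM mulnb.
by rewrite -pair_eqE andbC.
Qed.

Let aX k i w := true_score W VX KX phi k i w.
Let aY k i w := true_score W VY KY phi k i w.
Let eX n k (i : 'I_n) w := err W VX KX phi FX k i w.
Let eY n k (i : 'I_n) w := err W VY KY phi FY k i w.

Let product_error n (k l : 'I_q) w : R :=
  (Num.sqrt n%:R)^-1 * \sum_(i < n) eX k i w * eY l i w.

(** What estimating the residuals adds to the (k, l) entry of the scaled matrix. *)
Let entry_remainder n k l w : R :=
  cross_term W VX VY KX KY phi FX n k l w +
  cross_term W VY VX KY KX phi FY n l k w + product_error n k l w.

Definition remainder n (p : I) w : R :=
  \sum_k \sum_l (S p.1 k * S p.2 l) * entry_remainder n k l w.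

Lemma xz_sampleE n w : xz_sample W n w = project_tuple VX (sample W n w).
Proof. by apply: eq_from_tnth => i; rewrite !tnth_mktuple. Qed.

Lemma yz_sampleE n w : yz_sample W n w = project_tuple VY (sample W n w).
Proof. by apply: eq_from_tnth => i; rewrite !tnth_mktuple. Qed.

Lemma score_U1 n (i : 'I_n) k w : phi k (U1 FX W w i) = aX k i w + eX k i w.
Proof.
have [x01 _ cz] := hW i w.
have cs : sample_cube (xz_sample W n w).
  by move=> j; have [? ? ?] := hW j w; rewrite tnth_mktuple.
have n0 := leq_ltn_trans (leq0n i) (ltn_ord i).
have u01 := estimate_itv hFX n0 cs x01 cz.
rewrite /aX /eX /err /score_error /true_score /est_residual -xz_sampleE.
rewrite patchE mem_set// tnth_mktuple/= [X in _ = _ + (X - _)]clip_score_id//.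
by rewrite addrC subrK.
Qed.

Lemma score_U2 n (i : 'I_n) k w : phi k (U2 FY W w i) = aY k i w + eY k i w.
Proof.
have [_ y01 cz] := hW i w.
have cs : sample_cube (yz_sample W n w).
  by move=> j; have [? ? ?] := hW j w; rewrite tnth_mktuple.
have n0 := leq_ltn_trans (leq0n i) (ltn_ord i).
have u01 := estimate_itv hFY n0 cs y01 cz.
rewrite /aY /eY /err /score_error /true_score /est_residual -yz_sampleE.
rewrite patchE mem_set// tnth_mktuple/= [X in _ = _ + (X - _)]clip_score_id//.
by rewrite addrC subrK.
Qed.

Lemma scaled_rho_hat n k l w : (0 < n)%N ->
  Num.sqrt n%:R * rho_hat phi FX FY W n w k l =
  (Num.sqrt n%:R)^-1 * \sum_(i < n) (aX k i w * aY l i w) + entry_remainder n k l w.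
Proof.
move=> n0; have rn0 : Num.sqrt n%:R != 0 :> R by rewrite gt_eqF// sqrtr_gt0 ltr0n.
rewrite /rho_hat mxE summxE mulrA.
have -> : Num.sqrt n%:R * n%:R^-1 = (Num.sqrt n%:R)^-1 :> R.
  by rewrite -{2}[n%:R](@sqr_sqrtr R) ?ler0n// expr2 invfM mulrA mulfV// mul1r.
rewrite /entry_remainder /cross_term /product_error -!mulrDr; congr (_ * _).
rewrite -!big_split/=; apply: eq_bigr => i _.
rewrite mxE big_ord1 !mxE score_U1 score_U2 /eX /eY /aX /aY.
by ring.
Qed.

(** S is symmetric, so both factors of S rho S act on the scores from the left, and the
    squared Frobenius norm is a squared Euclidean norm over pairs of indices. *)
Lemma scaled_test_stat n w : (0 < n)%N ->
  n%:R * test_stat phi FX FY W n w =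
  sqnorm (fun p => scaled_sum W oracle n p w + remainder n p w).
Proof.
move=> n0; rewrite /test_stat /frobenius sqr_sqrtr; last first.
  by apply: sumr_ge0 => i _; apply: sumr_ge0 => j _; exact: sqr_ge0.
rewrite pair_bigA/= mulr_sumr /sqnorm; apply: eq_bigr => -[i j] _ /=.
rewrite -{1}[n%:R](@sqr_sqrtr R) ?ler0n// -exprMn; congr (_ ^+ 2).
have [ST _] := inv_sqrt_Sigma hq hphi.
transitivity (\sum_k \sum_l (S i k * S j l) *
    (Num.sqrt n%:R * rho_hat phi FX FY W n w k l)).
  rewrite mxE mulr_sumr exchange_big/=; apply: eq_bigr => l _.
  rewrite mxE mulr_suml mulr_sumr; apply: eq_bigr => k _.
  by rewrite -[in S j l]ST [S^T j l]mxE; ring.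
under eq_bigr do under eq_bigr do rewrite scaled_rho_hat// mulrDr.
under eq_bigr do rewrite big_split/=.
rewrite big_split/=; congr (_ + _).
rewrite /scaled_sum mulr_sumr.
under eq_bigr do under eq_bigr do rewrite mulrCA !mulr_sumr.
under eq_bigr do rewrite exchange_big/=.
rewrite exchange_big/=; apply: eq_bigr => m _.
rewrite /oracle /orth_score/= mulr_suml mulr_sumr; apply: eq_bigr => k _.
rewrite mulr_sumr mulr_sumr; apply: eq_bigr => l _.
by rewrite /aX /aY /true_score; ring.
Qed.

Let meX n k (i : 'I_n) : bmfun (eX k i).
Proof. exact: (bmfun_err KX iidW hq hphi hFX mVX). Qed.
Let meY n k (i : 'I_n) : bmfun (eY k i).
Proof. exact: (bmfun_err KY iidW hq hphi hFY mVY). Qed.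

Let bmfun_product_error n k l : bmfun (product_error n k l).
Proof. by apply: bmfunZ; apply: bmfun_sum => i; exact: bmfunM. Qed.

Let bmfun_crossX n k l : bmfun (cross_term W VX VY KX KY phi FX n k l).
Proof. exact: (bmfun_cross_term KX KY iidW hq hphi hFX mVX mVY). Qed.

Let bmfun_crossY n k l : bmfun (cross_term W VY VX KY KX phi FY n k l).
Proof. exact: (bmfun_cross_term KY KX iidW hq hphi hFY mVY mVX). Qed.

Let bmfun_entry_remainder n k l : bmfun (entry_remainder n k l).
Proof. by apply: bmfunD => //; exact: bmfunD. Qed.

Lemma bmfun_remainder n p : bmfun (remainder n p).
Proof. by apply: bmfun_sum => k; apply: bmfun_sum => l; exact: bmfunZ. Qed.

Hypotheses (g_cvg : g @ \oo --> (0 : R)) (h_cvg : h @ \oo --> (0 : R))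
  (bandX : bigO_P Pr (band_error W VX KX phi FX) g)
  (bandY : bigO_P Pr (band_error W VY KY phi FY) h)
  (gh_cvg : (fun n => Num.sqrt n%:R * g n * h n) @ \oo --> (0 : R)).

(** No cancellation is available when both factors are errors: the term is bounded by
    its size, sqrt n times the product of the two rates. *)
Lemma product_error_negligible k l :
  negligible_seq Pr (fun n => product_error n k l).
Proof.
apply: negligible_seq_outer => // e e0.
have e20 : 0 < e / 2 by rewrite divr_gt0.
have X01 w : obs_cube w -> VX w \in `[0, 1] by case.
have Y01 w : obs_cube w -> VY w \in `[0, 1] by case.
have [LX LX0 HX] := err_bound hW hq hphi hFX X01 hKX.2.
have [LY LY0 HY] := err_bound hW hq hphi hFY Y01 hKY.2.
have [M M0 HM] := bigO_P_event bandX e20.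
have [M' M'0 HM'] := bigO_P_event bandY e20.
pose c := LX * M * (LY * M').
have c0 : 0 < c by rewrite !mulr_gt0.
move/cvgr0Pnorm_lt : gh_cvg => /(_ (e / c) (divr_gt0 e0 c0))[N _ HN].
exists (maxn N 1) => n; rewrite geq_max => /andP[Nn n0].
exists ([set w | ((M * `|g n|)%:E < band_error W VX KX phi FX n w)%E] `|`
        [set w | ((M' * `|h n|)%:E < band_error W VY KY phi FY n w)%E]); split.
  apply: (le_trans (outer_measureU2 _ _ _)).
  have -> : e%:E = ((e / 2)%:E + (e / 2)%:E)%E by rewrite -EFinD -splitr.
  exact: leeD (HM n n0) (HM' n n0).
move=> w /not_orP[]/= /negP; rewrite -leNgt => /HX wX /negP; rewrite -leNgt => /HY wY.
have rn0 : 0 < Num.sqrt n%:R :> R by rewrite sqrtr_gt0 ltr0n.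
rewrite /product_error normrM ger0_norm ?invr_ge0 ?(ltW rn0)//.
apply: (@le_trans _ _ ((Num.sqrt n%:R)^-1 *
    \sum_(i < n) (LX * (M * `|g n|)) * (LY * (M' * `|h n|)))).
  rewrite ler_wpM2l ?invr_ge0 ?(ltW rn0)//; apply: (le_trans (ler_norm_sum _ _ _)).
  by apply: ler_sum => i _; rewrite normrM; apply: ler_pM.
rewrite sumr_const card_ord -[X in _ * X]mulr_natl -{2}[n%:R](@sqr_sqrtr R) ?ler0n//.
have -> : (Num.sqrt n%:R)^-1 * ((Num.sqrt n%:R) ^+ 2 *
    (LX * (M * `|g n|) * (LY * (M' * `|h n|)))) =
    c * (Num.sqrt n%:R * `|g n| * `|h n|) by rewrite /c; field; rewrite gt_eqF.
have := HN n Nn; rewrite /= !normrM (ger0_norm (ltW rn0)).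
by rewrite ltr_pdivlMr// mulrC => /ltW.
Qed.

(** The terms with a single error are small without any rate, by cancellation. *)
Lemma remainder_negligible p : negligible_seq Pr (fun n => remainder n p).
Proof.
rewrite /remainder; apply: negligible_seq_sum => [k n|k].
  by apply: bmfun_sum => l; exact: bmfunZ.
apply: negligible_seq_sum => [l n|l]; first exact: bmfunZ.
apply: negligible_seqZ => //.
apply: negligible_seqD => //; last exact: product_error_negligible.
  by move=> n; exact: bmfunD.
have X01 w : obs_cube w -> VX w \in `[0, 1] by case.
have Y01 w : obs_cube w -> VY w \in `[0, 1] by case.
apply: negligible_seqD => //; apply: negligible_seq_L2 => // e e0.
  have [N HN] := cross_term_small hW iidW hq hphi hFX mVX X01 mVY hKX.2 indepXY
    g_cvg bandX e0.
  by exists N => n /HN.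
have [N HN] := cross_term_small hW iidW hq hphi hFY mVY Y01 mVX hKY.2 indepYX
  h_cvg bandY e0.
by exists N => n /HN.
Qed.

Let statistic n w := sqnorm (fun p => scaled_sum W oracle n p w + remainder n p w).

Let bmfun_scaled_sum n p : bmfun (scaled_sum W oracle n p).
Proof.
have [mW _ _] := iidW.
apply: bmfunZ; apply: bmfun_sum => k.
exact: bmfun_comp (mW k) (bmfun_oracle p).
Qed.

Let bmfun_statistic n : bmfun (statistic n).
Proof.
by apply: bmfun_sum => p; apply: bmfunX; apply: bmfunD => //; exact: bmfun_remainder.
Qed.

Let statistic_laplace (s : R) : 0 < s ->
  (fun n => \int[Pr]_w expR (- (s * statistic n w / 2))) @ \oo -->
  \int[chi_squared (q ^ 2)]_x expR (- (s * Num.max x 0 / 2)).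
Proof.
move=> s0; rewrite chi_squared_laplace//.
have -> : (q ^ 2)%N = #|{: I}| by rewrite card_prod card_ord.
apply: laplace_negligible => //; first exact: bmfun_remainder.
  exact: remainder_negligible.
exact: (laplace_clt iidW bmfun_oracle oracle_mean oracle_cov).
Qed.

(** The Laplace transform identifies the limit law, and the chi-squared law has no atom
    at its quantile. *)
Lemma test_level_cvg (alpha : R) (c := quantile (chi_squared (q ^ 2)) (1 - alpha)) :
  0 < alpha < 1 ->
  (fun n => 'E_Pr[test phi FX FY W n ^~ c])%E @ \oo --> alpha%:E.
Proof.
move=> /andP[a0 a1].
have atomless (x : R) : chi_squared (q ^ 2) [set x] = 0%E.
  have -> : (q ^ 2)%N = (q ^ 2).-1.+1 by rewrite prednK// expn_gt0 hq.
  exact: chi_squared_set1.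
have a01 : 0 < 1 - alpha < 1 by apply/andP; split; lra.
have [c0 muc] := quantile_atomless (chi_squared_ge0 _) atomless a01.
have mX n : measurable_fun setT (statistic n) by exact: bmfun_measurable.
have X0 n w : 0 <= statistic n w by exact: sqnorm_ge0.
have := cvg_tail mX X0 statistic_laplace c0 (atomless _).
have -> : fine (chi_squared (q ^ 2) `]c, +oo[%classic) = alpha.
  rewrite -setCitvl probability_setC// muc.
  by rewrite -EFinB/= subKr.
move=> tail_cvg.
have mA n : measurable [set w | c < statistic n w].
  rewrite (_ : [set w | _] = statistic n @^-1` `]c, +oo[%classic).
    by rewrite -[X in measurable X]setTI; exact: mX.
  by apply/seteqP; split => w /=; rewrite in_itv/= andbT.
have : (fun n => Pr [set w | c < statistic n w]) @ \oo --> alpha%:E.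
  by apply: cvg_EFin tail_cvg; apply: nearW => n; rewrite fin_num_measure.
apply: cvg_trans; apply: near_eq_cvg; near=> n.
have n0 : (0 < n)%N by near: n; exact: nbhs_infty_gt.
rewrite -(expectation_indic _ (mA n)).
congr expectation; apply/funext => w; rewrite /test indicE; congr (_%:R).
rewrite ltr_pdivrMl ?ltr0n// scaled_test_stat//.
by congr nat_of_bool; apply/idP/idP; rewrite inE.
Unshelve. all: by end_near. Qed.

End null_sample.

Theorem corollary17 (R : realType) (d q : nat) (hq : (0 < q)%N)
  (dO : measure_display) (Omega : measurableType dO)
  (W : nat -> Omega -> obs R d)
  (hW : forall i w, obs_cube (W i w))
  (P0 : set (probability (obs R d) R))
  (hP0 : P0 `<=` ac_distributions)
  (Pr : probability (obs R d) R -> probability Omega R)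
  (hPr : forall P, P0 P -> iid_sample (Pr P) W P)
  (KX KY : probability (obs R d) R -> R.-pker (covariate R d) ~> R)
  (hKX : forall P, P0 P -> continuous_cond_law P (fun w => w.1.1) (KX P))
  (hKY : forall P, P0 P -> continuous_cond_law P (fun w => w.1.2) (KY P))
  (phi : 'I_q -> R -> R) (hphi : score_functions phi)
  (FX FY : cdf_estimator R d)
  (hFX : is_cdf_estimator FX) (hFY : is_cdf_estimator FY)
  (hrates : forall P, P0 P ->
     exists (g h : nat -> R) (xi xi' : R -> covariate R d -> R),
       let t0 := tau_min phi in
       let t1 := tau_max phi in
       [/\ (g @ \oo --> (0 : R)) /\ (h @ \oo --> (0 : R)),
           bigO_P (Pr P) (fun n w => norm_in (KX P) t0 t1
             (fun t z => cond_cdf (KX P) t z - FX n (xz_sample W n w) t z)) g /\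
           bigO_P (Pr P) (fun n w => norm_in (KY P) t0 t1
             (fun t z => cond_cdf (KY P) t z - FY n (yz_sample W n w) t z)) h,
           bigO_P (Pr P) (fun n w => norm_out (KX P) t0 t1
             (fun t z => xi t z - FX n (xz_sample W n w) t z)) g /\
           bigO_P (Pr P) (fun n w => norm_out (KY P) t0 t1
             (fun t z => xi' t z - FY n (yz_sample W n w) t z)) h &
           (fun n => Num.sqrt n%:R * g n * h n) @ \oo --> (0 : R)])
  (alpha : R) (halpha : 0 < alpha < 1) :
  let c := quantile (chi_squared (q ^ 2)) (1 - alpha) in
  forall P, (P0 `&` null_distributions) P ->
    limn_esup (fun n => 'E_(Pr P)[test phi FX FY W n ^~ c])%E = alpha%:E.
Proof.
move=> c P [P0P [[Pcube _] ci]].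
have [g [h [_ [_ [[g0 h0] [gO hO] _ gh0]]]]] := hrates P P0P.
have level : (fun n => 'E_(Pr P)[test phi FX FY W n ^~ c])%E @ \oo --> alpha%:E.
  apply: (test_level_cvg hW (hPr P P0P) hq hphi hFX hFY (hKX P P0P) (hKY P P0P) Pcube ci
    g0 h0 _ _ gh0 halpha).
    rewrite /band_error; under eq_fun do under eq_fun do rewrite -xz_sampleE.
    exact: gO.
  rewrite /band_error; under eq_fun do under eq_fun do rewrite -yz_sampleE.
  exact: hO.
rewrite is_cvg_limn_esupE; first exact/cvg_lim.
by apply/cvg_ex; exists alpha%:E.
Qed.
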